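(* Let $n\ge1$. (i) A cycle $V\in\mathcal V$ is determined by, and determines, the germs at $0\in\mathbb C^n$ of the functions $$b\mapsto {\rm Tr}_V(y^k)(0,b),\qquad k=0,\dots,{\rm Tr}_V(1);$$ that is, for $V,V'\in\mathcal V$ one has $V=V'$ if and only if ${\rm Tr}_V(1)={\rm Tr}_{V'}(1)$ and ${\rm Tr}_V(y^k)(0,b)={\rm Tr}_{V'}(y^k)(0,b)$ as germs at $b=0$ for all $0\le k\le {\rm Tr}_V(1)$. (ii) Let $V\in\mathcal V$ be a reduced cycle. A function $h\in M(|V|)$ is determined by, and determines, the germs at $0\in\mathbb C^n$ of the functions $$b\mapsto {\rm Tr}_V(y^kh)(0,b),\qquad k=0,\dots,{\rm Tr}_V(1)-1;$$ that is, for $h,h'\in M(|V|)$ one has $h=h'$ if and only if ${\rm Tr}_V(y^kh)(0,b)={\rm Tr}_V(y^kh')(0,b)$ as germs of meromorphic functions at $b=0$ for all $0\le k\le{\rm Tr}_V(1)-1$.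
   Context: Affine coordinates on $\mathbb C^{n+1}\subset\mathbb P^{n+1}(\mathbb C)$ are $(x,y)=(x_1,\dots,x_n,y)$, and $\Delta$ is the projective closure of the vertical line $\{x=0\}$. For $(a,b)=(a_1,\dots,a_n,b_1,\dots,b_n)\in\mathbb C^{2n}$ near $0$, $L_{(a,b)}$ is the line $x_i=a_iy+b_i$, $i=1,\dots,n$ (so $L_{(0,0)}=\Delta$). $\mathcal V$ is the set of finite formal sums $V=\sum_ik_iV_i$, with nonnegative integer coefficients, of irreducible germs of analytic hypersurfaces $V_i$ at points $(0,y_P)$ of $\Delta$ (distinct from the point at infinity of $\Delta$) which intersect $\Delta$ properly (i.e. do not contain the germ of $\Delta$). $V$ is reduced if it is a sum of pairwise distinct irreducible germs. $|V|$ denotes the support (union of the germs occurring in $V$). $M(|V|)$ is the set of meromorphic functions on $|V|$: the data, at each of the finitely many points $P$ of $|V|\cap\Delta$, of the restriction to the germ of $|V|$ at $P$ of a germ at $P$ of meromorphic function of the ambient space whose polar locus contains no component of $|V|$. For an irreducible germ $V_i=\{f_i=0\}$ at $(0,y_P)$ ($f_i$ reduced) and $h\in M(|V_i|)$, ${\rm Tr}_{V_i}(h)$ is the germ of meromorphic function in $(a,b)$ given for generic $(a,b)$ near $0$ by the sum of the values $h(ay+b,y)$ over the zeros $y$ near $y_P$ of $y\mapsto f_i(ay+b,y)$, counted with multiplicity. For $V=\sum k_iV_i$, ${\rm Tr}_V(h)=\sum_ik_i{\rm Tr}_{V_i}(h)$. The restriction to $a=0$ is the germ of meromorphic function in $b$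 obtained by the same sum along the lines $L_{(0,b)}$, $b$ generic near $0$. ${\rm Tr}_V(1)$ is the constant equal to the vertical degree of $V$ (number of intersection points of $V$ with a generic $L_{(a,b)}$, counted with the multiplicities $k_i$). *)

(* Defs.v *)
From HB Require Import structures.
From mathcomp Require Import all_boot all_order all_algebra.
From mathcomp Require Import finmap multiset complex.
From mathcomp Require Import all_classical all_reals all_analysis.

Set Implicit Arguments.
Unset Strict Implicit.
Unset Printing Implicit Defensive.

Import Order.TTheory GRing.Theory Num.Theory.
Import numFieldNormedType.Exports.

Local Open Scope classical_set_scope.
Local Open Scope complex_scope.
Local Open Scope ring_scope.

(* R[i] gets the topology of the modulus, its norm as a numFieldType. *)
HB.instance Definition _ (R : realType) := PseudoMetric.copy R[i] R[i]^o.
HB.instance Definition _ (R : realType) := Pointed.copy R[i] R[i]^o.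

Section LocalAnalyticGeometry.
Variable R : realType.
Local Notation C := R[i].

(* Partial sum of a power series over the box of multi-indices {0..N-1}^m. *)
Definition box_sum (m N : nat) (F : {ffun 'I_m -> nat} -> C) : C :=
  \sum_(e : {ffun 'I_m -> 'I_N}) F [ffun i => nat_of_ord (e i)].

Definition monomial (m : nat) (e : {ffun 'I_m -> nat}) (z : 'rV[C]_m) : C :=
  \prod_i z 0 i ^+ e i.

(* f is, near p, the sum of a power series centred at p which converges
   absolutely on a polydisc of positive radius. *)
Definition analytic_at (m : nat) (f : 'rV[C]_m -> C) (p : 'rV[C]_m) : Prop :=
  exists (c : {ffun 'I_m -> nat} -> C) (rho M : R),
    [/\ 0 < rho,
        forall N : nat,
          box_sum N (fun e => `|c e| * rho%:C ^+ (\sum_i e i)) <= M%:C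
      & \forall z \near p,
          (fun N : nat => box_sum N (fun e => c e * monomial e (z - p)))
            @ \oo --> f z].

Definition germ_eq_set (m : nat) (p : 'rV[C]_m) (A B : set 'rV[C]_m) : Prop :=
  \forall z \near p, A z <-> B z.

Definition zeros (m : nat) (f : 'rV[C]_m -> C) : set 'rV[C]_m :=
  [set z | f z = 0].

Definition analytic_set_at (m : nat) (A : set 'rV[C]_m) (p : 'rV[C]_m) : Prop :=
  exists (k : nat) (g : 'I_k -> 'rV[C]_m -> C),
    (forall i, analytic_at (g i) p) /\
    germ_eq_set p A [set z | forall i, g i z = 0].

Definition irreducible_at (m : nat) (A : set 'rV[C]_m) (p : 'rV[C]_m) : Prop :=
  A p /\
  forall A1 A2 : set 'rV[C]_m,
    analytic_set_at A1 p -> analytic_set_at A2 p ->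
    germ_eq_set p A (A1 `|` A2) -> germ_eq_set p A A1 \/ germ_eq_set p A A2.

(* No factor of f in the local ring at p is the square of a non-unit; this
   excludes f = 0. *)
Definition reduced_at (m : nat) (f : 'rV[C]_m -> C) (p : 'rV[C]_m) : Prop :=
  forall g u : 'rV[C]_m -> C, analytic_at g p -> analytic_at u p ->
    (\forall z \near p, f z = g z ^+ 2 * u z) -> g p != 0.

(* P holds outside a proper analytic subset of a neighborhood of 0. *)
Definition generically (m : nat) (P : 'rV[C]_m -> Prop) : Prop :=
  exists g : 'rV[C]_m -> C,
    [/\ analytic_at g 0,
        ~ (\forall t \near (0 : 'rV[C]_m), g t = 0)
      & \forall t \near (0 : 'rV[C]_m), g t != 0 -> P t].

(* A germ at 0 which is only known for generic parameters is handled through a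
   family T of functions, T r being computed with the zeros at distance < r of
   their base points. The germ is the common generic value of the T r for all
   small r, and two meromorphic germs are equal iff they agree generically. *)
Definition germ_eq (m : nat) (T T' : R -> 'rV[C]_m -> C) : Prop :=
  exists r0 : R, 0 < r0 /\
    forall r : R, 0 < r < r0 -> generically (fun t => T r t = T' r t).

Definition zero_order (phi : C -> C) (y0 : C) : nat :=
  xget 0%N [set m : nat | exists u : C -> C,
    [/\ {for y0, continuous u}, u y0 != 0
      & \forall y \near y0, phi y = (y - y0) ^+ m * u y]].

End LocalAnalyticGeometry.

Section Cycles.
Variables (R : realType) (n : nat).
Local Notation C := R[i].
Local Notation space := 'rV[C]_(n + 1).

(* The affine space C^(n+1) with coordinates (x, y). *)
Definition pt (x : 'rV[C]_n) (y : C) : space := row_mx x y%:M.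
Definition ycoord (z : space) : C := z 0 (rshift n ord0).

(* The point of ordinate y of the line x = a y + b. *)
Definition line_pt (a b : 'rV[C]_n) (y : C) : space := pt (y *: a + b) y.

Definition irr_equation (f : space -> C) (yP : C) : Prop :=
  [/\ analytic_at f (pt 0 yP),
      f (pt 0 yP) = 0,
      reduced_at f (pt 0 yP),
      irreducible_at (zeros f) (pt 0 yP)
    & ~ (\forall y \near yP, f (pt 0 y) = 0)].

(* An irreducible germ of analytic hypersurface at (0, yP), meeting the
   vertical line {x = 0} properly. A germ of set is the class of all the sets
   which coincide with it near (0, yP), so that = is equality of germs. *)
Record irr_germ : Type := IrrGerm {
  base : C;
  germ_class : set (set space);
  irr_germP : exists f : space -> C, irr_equation f base /\
    germ_class = [set A | germ_eq_set (pt 0 base) A (zeros f)]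
}.

HB.instance Definition _ := gen_eqMixin irr_germ.
HB.instance Definition _ := gen_choiceMixin irr_germ.

Definition base_pt (X : irr_germ) : space := pt 0 (base X).

(* A reduced equation; unique up to a unit of the local ring. *)
Definition eqn (X : irr_germ) : space -> C := projT1 (cid (irr_germP X)).

(* Finite formal sums with coefficients in nat: V X is the coefficient of X,
   finsupp V the set of components. *)
Definition vcycle : Type := {mset irr_germ}%mset.

Definition reduced_cycle (V : vcycle) : Prop := forall X, (V X <= 1)%N.

Definition line_zeros (X : irr_germ) (r : R) (a b : 'rV[C]_n) : set C :=
  [set y | `|y - base X| < r%:C /\ eqn X (line_pt a b y) = 0].

(* The parameter (a, b) of the line is encoded as row_mx a b. *)
Definition local_trace (X : irr_germ) (h : space -> C)
    (r : R) (ab : 'rV[C]_(n + n)) : C :=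
  let a := lsubmx ab in let b := rsubmx ab in
  \sum_(y \in line_zeros X r a b)
     (zero_order (fun t => eqn X (line_pt a b t)) y)%:R * h (line_pt a b y).

(* h yP is the function used near the point (0, yP). *)
Definition trace (V : vcycle) (h : C -> space -> C)
    (r : R) (ab : 'rV[C]_(n + n)) : C :=
  \sum_(X <- finsupp V) (V X)%:R * local_trace X (h (base X)) r ab.

Definition trace0 (V : vcycle) (h : C -> space -> C)
    (r : R) (b : 'rV[C]_n) : C :=
  trace V h r (row_mx 0 b).

(* The natural number d such that Tr_V(1) is the constant germ d. *)
Definition vdeg (V : vcycle) : nat :=
  xget 0%N [set d : nat | germ_eq (trace V (fun _ _ => 1)) (fun _ _ => d%:R)].

Definition ypow (k : nat) : C -> space -> C := fun _ z => ycoord z ^+ k.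

(* At each point (0, yP) of |V|, a germ of fraction num yP / den yP whose
   denominator vanishes identically on no component of |V|. Its polar locus
   lies in {den yP = 0}, and conversely a germ whose polar locus contains no
   component is of this form, by its expression in lowest terms. Values of num
   and den at the other yP are irrelevant. *)
Record mero (V : vcycle) : Type := Mero {
  num : C -> space -> C;
  den : C -> space -> C;
  num_analytic : forall X : irr_germ, X \in finsupp V ->
    analytic_at (num (base X)) (base_pt X);
  den_analytic : forall X : irr_germ, X \in finsupp V ->
    analytic_at (den (base X)) (base_pt X);
  den_neq0 : forall X : irr_germ, X \in finsupp V ->
    ~ (\forall z \near base_pt X, eqn X z = 0 -> den (base X) z = 0)
}.

(* Equality of the restrictions of the two fractions to |V|: a mero V is a
   representative of an element of M(|V|). *)
Definition mero_eq (V : vcycle) (h h' : mero V) : Prop :=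
  forall X : irr_germ, X \in finsupp V ->
    \forall z \near base_pt X, eqn X z = 0 ->
      num h (base X) z * den h' (base X) z
      = num h' (base X) z * den h (base X) z.

Definition ypow_mul (V : vcycle) (k : nat) (h : mero V) : C -> space -> C :=
  fun yP z => ycoord z ^+ k * (num h yP z / den h yP z).

End Cycles.

(* Main.v *)
Require Import Defs.
From HB Require Import structures.
From mathcomp Require Import all_boot all_order all_algebra.
From mathcomp Require Import separable.
From mathcomp Require Import finmap multiset complex.
From mathcomp Require Import all_classical all_reals all_analysis.
From mathcomp Require Import ring lra zify.

Set Implicit Arguments.
Unset Strict Implicit.
Unset Printing Implicit Defensive.

Import Order.TTheory GRing.Theory Num.Theory.
Import numFieldNormedType.Exports.

Local Open Scope classical_set_scope.
Local Open Scope complex_scope.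
Local Open Scope ring_scope.

(** Both statements are read off the fibres of the cycle over a generic point
    [b] close to the origin. By the Weierstrass preparation theorem an
    irreducible germ [X] is, near its base point, the zero set of a monic
    polynomial [W] in the ordinate, with coefficients analytic in [b], and the
    trace along the line over [b] is the sum over the roots of this polynomial
    ([trace0_fibre]). The same theorem, applied to the family of all the lines
    close to the axis, shows that the trace of 1 is the constant
    [sum_X V X * degree X] ([vdegE]).

    Generically in [b] all these roots are simple, and the roots that belong to
    distinct germs are distinct ([generic_fibre_uniq],
    [generic_fibres_disjoint]). In (i) the power sums determine, by Newton's
    identities, the list of the points of [V] over [b], and the multiplicity of
    [X] in [V] is that of any point of its fibre ([cycle_eq]). In (ii) the
    traces form a Vandermonde system in the values of [h] at the points of the
    fibres ([trace_mero_eq]).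

    What makes this work is that irreducible germs, defined here as germs of
    sets, behave like primes. The key is [divides_or_generic]: a function [g]
    either is divisible by the reduced equation of the germ, or vanishes on the
    germ only over a proper analytic subset of the parameters. Its proof
    computes with greatest common divisors of polynomials over the domain of
    germs of analytic functions in [b]. A factor of [W] over the fraction field
    of this domain has, once it is monic, bounded roots, hence bounded
    coefficients; and a bounded quotient of analytic functions is analytic
    ([analytic_dvd_of_le]), by Weierstrass division after a linear change of
    coordinates. So such a factor decomposes the germ itself, and a square
    factor contradicts reducedness ([weierstrass_separable]).

    Convergent power series are handled through the weighted sums of the moduli
    of their coefficients ([power_series]). These norms are submultiplicative
    and complete, which gives composition, inverses and, as a geometric series,
    Weierstrass division ([ps_division]). *)

(** * Convergence in the complex numbers *)

Section Convergence.
Variable R : realType.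
Local Notation C := R[i].

(** The norm of [R[i]] takes its values in [R[i]], which is only partially
    ordered; estimates are carried out with this real-valued version. *)
Definition cmod (z : C) : R := Normc.normc z.

Lemma normcE_cmod (z : C) : `|z| = (cmod z)%:C.
Proof. by case: z => a b; rewrite normc_def. Qed.

Lemma cmod_ge0 (z : C) : 0 <= cmod z.
Proof. by rewrite -ler0c -normcE_cmod normr_ge0. Qed.

Lemma cmodD (x y : C) : cmod (x + y) <= cmod x + cmod y.
Proof. by rewrite -lecR rmorphD /= -!normcE_cmod ler_normD. Qed.

Lemma cmodN (x : C) : cmod (- x) = cmod x.
Proof. by apply: complexI; rewrite -!normcE_cmod normrN. Qed.

Lemma cmodBC (x y : C) : cmod (x - y) = cmod (y - x).
Proof. by rewrite -cmodN opprB. Qed.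

Lemma cmodM (x y : C) : cmod (x * y) = cmod x * cmod y.
Proof. exact: Normc.normcM. Qed.

Lemma cmod0 : cmod 0 = 0.
Proof. exact: Normc.normc0. Qed.

Lemma cmod1 : cmod 1 = 1.
Proof. exact: Normc.normc1. Qed.

Lemma cmodX (x : C) n : cmod (x ^+ n) = cmod x ^+ n.
Proof. by elim: n => [|n IH]; rewrite ?cmod1 // !exprS cmodM IH. Qed.

Lemma cmodV (x : C) : cmod x^-1 = (cmod x)^-1.
Proof. exact: Normc.normcV. Qed.

Lemma cmod_eq0 (x : C) : (cmod x == 0) = (x == 0).
Proof.
by apply/eqP/eqP => [/Normc.eq0_normc | ->]; last exact: cmod0.
Qed.

Lemma cmod_gt0 (x : C) : (0 < cmod x) = (x != 0).
Proof. by rewrite lt_def cmod_eq0 cmod_ge0 andbT. Qed.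

Lemma cmod_real (x : R) : cmod x%:C = `|x|.
Proof. by rewrite /cmod /Normc.normc /= expr0n /= addr0 sqrtr_sqr. Qed.

Lemma cmod_sum (I : Type) (r : seq I) (P : pred I) (F : I -> C) :
  cmod (\sum_(i <- r | P i) F i) <= \sum_(i <- r | P i) cmod (F i).
Proof.
elim/big_ind2: _ => [|x1 x2 y1 y2 h1 h2|//]; first by rewrite cmod0.
by apply: le_trans (cmodD _ _) _; apply: lerD.
Qed.

Lemma cmod_small (x : C) : (forall e : R, 0 < e -> cmod x <= e) -> x = 0.
Proof.
move=> h; apply/eqP; rewrite -cmod_eq0 -[_ == 0]negbK; apply/negP => n0.
have p : 0 < cmod x by rewrite lt_def n0 cmod_ge0.
by have := h _ (divr_gt0 p (ltr0n _ 2)); lra.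
Qed.

Lemma cmodB_ge (x y : C) : cmod x - cmod y <= cmod (x - y).
Proof. by have := cmodD (x - y) y; rewrite subrK; lra. Qed.

Lemma Re_le_cmod (z : C) : `|complex.Re z| <= cmod z.
Proof.
case: z => a b /=; rewrite /cmod /= -(sqrtr_sqr a) ler_wsqrtr //.
by rewrite lerDl sqr_ge0.
Qed.

Lemma Im_le_cmod (z : C) : `|complex.Im z| <= cmod z.
Proof.
case: z => a b /=; rewrite /cmod /= -(sqrtr_sqr b) ler_wsqrtr //.
by rewrite lerDr sqr_ge0.
Qed.

Definition clim (u : nat -> C) (l : C) : Prop :=
  forall e : R, 0 < e -> exists N, forall n, (N <= n)%N -> cmod (u n - l) < e.

Definition csum (a : nat -> C) (s : C) : Prop :=
  clim (fun N => \sum_(k < N) a k) s.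

Lemma clim_uniq u l l' : clim u l -> clim u l' -> l = l'.
Proof.
move=> h h'; apply/eqP; rewrite -subr_eq0; apply/eqP/cmod_small => e e0.
have e20 : 0 < e / 2 by lra.
have [N hN] := h _ e20; have [N' hN'] := h' _ e20.
have a := hN (maxn N N') (leq_maxl _ _); have b := hN' (maxn N N') (leq_maxr _ _).
set v := u _ in a b.
have -> : l - l' = (v - l') - (v - l) by ring.
by have := cmodD (v - l') (- (v - l)); rewrite cmodN; lra.
Qed.

Lemma clim_ext u v l : u =1 v -> clim u l -> clim v l.
Proof. by move=> /funext ->. Qed.

Lemma clim_cst l : clim (fun=> l) l.
Proof. by move=> e e0; exists 0%N => n _; rewrite subrr cmod0. Qed.

Lemma climD u v l l' : clim u l -> clim v l' -> clim (fun n => u n + v n) (l + l').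
Proof.
move=> h h' e e0; have e20 : 0 < e / 2 by lra.
have [N hN] := h _ e20; have [N' hN'] := h' _ e20.
exists (maxn N N') => n; rewrite geq_max => /andP[/hN a /hN' b].
rewrite opprD addrACA; have := cmodD (u n - l) (v n - l'); lra.
Qed.

Lemma climZ c u l : clim u l -> clim (fun n => c * u n) (c * l).
Proof.
move=> h e e0.
have c0 : 0 < cmod c + 1 by have := cmod_ge0 c; lra.
have [N hN] := h _ (divr_gt0 e0 c0).
exists N => n /hN; rewrite -mulrBr cmodM ltr_pdivlMr // => a.
apply: le_lt_trans a; rewrite mulrC ler_wpM2l ?cmod_ge0 //; lra.
Qed.

Lemma clim_sum (I : Type) (r : seq I) (u : I -> nat -> C) (l : I -> C) :
  (forall i, clim (u i) (l i)) ->
  clim (fun n => \sum_(i <- r) u i n) (\sum_(i <- r) l i).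
Proof.
move=> h; elim: r => [|i r IH].
  by rewrite big_nil; apply: clim_ext (clim_cst 0) => n; rewrite big_nil.
rewrite big_cons; apply: clim_ext (climD (h i) IH) => n.
by rewrite big_cons.
Qed.

Lemma clim_bound u l (M : R) N0 :
  (forall n, (N0 <= n)%N -> cmod (u n) <= M) -> clim u l -> cmod l <= M.
Proof.
move=> h hl; apply/ler_addgt0Pr => e e0; have [N hN] := hl e e0.
have a := hN (maxn N N0) (leq_maxl _ _).
have b := h (maxn N N0) (leq_maxr _ _).
by have := cmodB_ge l (u (maxn N N0)); rewrite cmodBC; lra.
Qed.

Lemma csumZ c a s : csum a s -> csum (fun k => c * a k) (c * s).
Proof.
by move=> h; apply: clim_ext (climZ c h) => N; rewrite mulr_sumr.
Qed.

Lemma csumD a b s t : csum a s -> csum b t -> csum (fun k => a k + b k) (s + t).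
Proof.
by move=> h h'; apply: clim_ext (climD h h') => N; rewrite big_split.
Qed.

Lemma bounded_sum_tail (B : nat -> R) (M e : R) :
  (forall k, 0 <= B k) -> (forall K, \sum_(k < K) B k <= M) -> 0 < e ->
  exists N, forall K L, (N <= K <= L)%N -> \sum_(K <= k < L) B k < e.
Proof.
move=> B0 hM e0.
pose S := range (fun K => \sum_(k < K) B k).
have hS : has_sup S.
  by split; [exists (\sum_(k < 0) B k), 0%N | exists M => _ [K _ <-]].
have [_ [N _ <-] hN] := sup_adherent e0 hS.
exists N => K L /andP[hK hL].
have : \sum_(k < L) B k <= sup S by apply: sup_upper_bound => //; exists L.
have h1 : \sum_(k < N) B k <= \sum_(k < K) B k.
  rewrite -!(big_mkord xpredT B) (big_cat_nat (n := N) (p := K)) //=.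
  by rewrite lerDl sumr_ge0.
move: h1 hN; rewrite -!(big_mkord xpredT B) (big_cat_nat (n := K) (p := L)) //=.
lra.
Qed.

Lemma cmod_sum_nat (a : nat -> C) (B : nat -> R) K L :
  (forall k, cmod (a k) <= B k) ->
  cmod (\sum_(K <= k < L) a k) <= \sum_(K <= k < L) B k.
Proof. by move=> h; apply: le_trans (cmod_sum _ _ _) _; apply: ler_sum. Qed.

(** Completeness, in the form of the comparison test. *)
Lemma dominated_csum (a : nat -> C) (B : nat -> R) (M : R) :
  (forall k, cmod (a k) <= B k) -> (forall K, \sum_(k < K) B k <= M) ->
  exists s, csum a s.
Proof.
move=> aB hM.
have B0 k : 0 <= B k := le_trans (cmod_ge0 _) (aB k).
have cB : cvgn (series B).
  apply: nondecreasing_is_cvgn.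
    by apply/nondecreasing_seqP => n; rewrite /series /= big_nat_recr //= lerDl.
  by exists M => _ [K _ <-]; rewrite /series /= big_mkord.
have real (b : nat -> R) : (forall k, `|b k| <= cmod (a k)) ->
    exists l, forall e, 0 < e ->
      exists N, forall n, (N <= n)%N -> `|\sum_(k < n) b k - l| < e.
  move=> bA; have cb : cvgn (series b).
    apply: normed_cvg; apply: series_le_cvg cB => //= n.
    exact: le_trans (bA n) (aB n).
  exists (limn (series b)) => e e0.
  have /cvgrPdist_lt/(_ _ e0)[N _ hN] := cb.
  exists N => n hn; have := hN n hn; rewrite /series /= big_mkord distrC.
  exact.
have [x hx] := real (fun k => complex.Re (a k)) (fun k => Re_le_cmod _).
have [y hy] := real (fun k => complex.Im (a k)) (fun k => Im_le_cmod _).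
exists (x +i* y) => e e0; have e20 : 0 < e / 2 by lra.
have [N hN] := hx _ e20; have [N' hN'] := hy _ e20.
exists (maxn N N') => n; rewrite geq_max => /andP[/hN ha /hN' hb].
set s := \sum_(k < n) _.
have -> : s - (x +i* y)
    = (\sum_(k < n) complex.Re (a k) - x)%:C
      + 'i * (\sum_(k < n) complex.Im (a k) - y)%:C.
  have -> : s = (\sum_(k < n) complex.Re (a k)) +i* (\sum_(k < n) complex.Im (a k)).
    rewrite /s; elim: n {s ha hb} => [|n IH]; first by rewrite !big_ord0.
    by rewrite !big_ord_recr /= IH; case: (a n).
  by apply/eqP; rewrite eq_complex /= !mul0r !mul1r !subr0 !addr0 !add0r !eqxx.
apply: le_lt_trans (cmodD _ _) _; rewrite cmodM !cmod_real.
have -> : cmod 'i = 1 by rewrite /cmod /= expr0n /= add0r expr1n sqrtr1.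
by rewrite mul1r; lra.
Qed.

Lemma csum_bound (a : nat -> C) (B : nat -> R) (M : R) s :
  (forall k, cmod (a k) <= B k) -> (forall K, \sum_(k < K) B k <= M) ->
  csum a s -> cmod s <= M.
Proof.
move=> aB hM; apply: (clim_bound (N0 := 0%N)) => n _.
apply: le_trans (hM n); apply: le_trans (cmod_sum _ _ _) _.
by apply: ler_sum => i _; apply: aB.
Qed.

(** Dominated convergence. Uniformity in the number of terms covers infinite
    sums as well as sums whose length varies with the index of the limit. *)
Lemma tannery (a : nat -> nat -> C) (c : nat -> C) (B : nat -> R) (M e : R) :
  (forall k N, cmod (a k N) <= B k) -> (forall K, \sum_(k < K) B k <= M) ->
  (forall k, clim (a k) (c k)) -> 0 < e ->
  exists N0, forall N K, (N0 <= N)%N -> cmod (\sum_(k < K) (a k N - c k)) < e.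
Proof.
move=> aB hM ac e0.
have B0 k : 0 <= B k := le_trans (cmod_ge0 _) (aB k 0%N).
have cB k : cmod (c k) <= B k.
  by apply: (clim_bound (N0 := 0%N) _ (ac k)) => n _; apply: aB.
have e40 : 0 < e / 4 by lra.
have [K0 hK0] := bounded_sum_tail B0 hM e40.
have e20 : 0 < e / (2 * (K0.+1)%:R).
  by apply: divr_gt0 => //; apply: mulr_gt0 => //; rewrite ltr0n.
have /choice[Nk hNk] : forall k, exists N, forall n, (N <= n)%N ->
    cmod (a k n - c k) < e / (2 * (K0.+1)%:R) by move=> k; apply: ac.
exists (\max_(k < K0) Nk k)%N => N K hN.
have small L : (L <= K0)%N -> cmod (\sum_(k < L) (a k N - c k)) < e / 2.
  move=> hL; apply: (@le_lt_trans _ _ (\sum_(k < L) e / (2 * (K0.+1)%:R))).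
    apply: le_trans (cmod_sum _ _ _) _; apply: ler_sum => k _; apply/ltW/hNk.
    apply: leq_trans hN.
    exact: (leq_bigmax (Ordinal (leq_trans (ltn_ord k) hL))).
  rewrite sumr_const card_ord -(mulr_natr _ L) invfM mulrA -mulrA gtr_pMr; last lra.
  rewrite mulrC.
  by rewrite ltr_pdivrMr ?ltr0n // mul1r ltr_nat.
case: (leqP K K0) => hK; first by have := small _ hK; lra.
rewrite -(big_mkord xpredT (fun k => a k N - c k)).
rewrite (big_cat_nat (n := K0)) //=; last exact: ltnW.
have h1 := small _ (leqnn K0); rewrite -(big_mkord xpredT (fun k => a k N - c k)) in h1.
apply: le_lt_trans (cmodD _ _) _.
have h2 : cmod (\sum_(K0 <= k < K) (a k N - c k)) <= \sum_(K0 <= k < K) (2 * B k).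
  apply: cmod_sum_nat => k; apply: le_trans (cmodD _ _) _; rewrite cmodN.
  have := aB k N; have := cB k; lra.
rewrite -mulr_sumr in h2.
by have := hK0 K0 K; rewrite leqnn (ltnW hK) => /(_ isT); lra.
Qed.

(** Monotone convergence, without naming the sum of the limit series. *)
Lemma monotone_columns (u : nat -> nat -> R) (M : R) :
  (forall k J J', (J <= J')%N -> u J k <= u J' k) ->
  (forall K J, \sum_(k < K) u J k <= M) ->
  exists B : nat -> R, (forall J k, u J k <= B k) /\
    (forall K, \sum_(k < K) B k <= M).
Proof.
move=> mono hM.
have uM k : exists b, forall J, u J k <= b.
  exists (M - \sum_(i < k) u 0%N i) => J; rewrite lerBrDl.
  apply: le_trans (hM k.+1 J); rewrite big_ord_recr lerD2r.
  by apply: ler_sum => i _; apply: mono.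
pose S k := range (fun J => u J k).
have hS k : has_sup (S k).
  split; first by exists (u 0%N k), 0%N.
  by have [b hb] := uM k; exists b => _ [J _ <-].
exists (fun k => sup (S k)); split=> [J k | K].
  by apply: sup_upper_bound => //; exists J.
apply/ler_addgt0Pr => d d0.
have d1 : 0 < d / K.+1%:R by rewrite divr_gt0 ?ltr0n.
have /choice[Jk hJk] : forall k, exists J, sup (S k) - d / K.+1%:R < u J k.
  by move=> k; have [_ [J _ <-] ?] := sup_adherent d1 (hS k); exists J.
pose J := (\max_(k < K) Jk k)%N.
apply: (@le_trans _ _ (\sum_(k < K) (u J k + d / K.+1%:R))).
  apply: ler_sum => k _; rewrite -lerBlDr; apply: le_trans (ltW (hJk k)) _.
  by apply: mono; apply: (leq_bigmax k).
rewrite big_split /= sumr_const card_ord; apply: lerD; first exact: hM.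
rewrite -(mulr_natl _ K) mulrCA ler_piMr //; first exact: ltW.
by rewrite ler_pdivrMr ?ltr0n // mul1r ler_nat.
Qed.

Lemma column_sums (b : nat -> nat -> R) (Mj : nat -> R) (M : R) :
  (forall j k, 0 <= b j k) ->
  (forall j K, \sum_(k < K) b j k <= Mj j) ->
  (forall J, \sum_(j < J) Mj j <= M) ->
  exists B : nat -> R, (forall J k, \sum_(j < J) b j k <= B k) /\
    (forall K, \sum_(k < K) B k <= M).
Proof.
move=> b0 bM hM; apply: (@monotone_columns (fun J k => \sum_(j < J) b j k)).
  move=> k J J' le; rewrite -!(big_mkord xpredT (fun j => b j k)).
  by rewrite (big_cat_nat (n := J) (p := J')) //= lerDl sumr_ge0.
move=> K J; rewrite exchange_big; apply: le_trans (hM J).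
by apply: ler_sum => j _; apply: bM.
Qed.

(** The partial sums of the columns are dominated, column by column, by the sums
    of the bounds, so that dominated convergence applies to them. *)
Lemma csum_exchange (a : nat -> nat -> C) (b : nat -> nat -> R) (Mj : nat -> R)
    (M : R) (r c : nat -> C) s :
  (forall j k, cmod (a j k) <= b j k) ->
  (forall j K, \sum_(k < K) b j k <= Mj j) ->
  (forall J, \sum_(j < J) Mj j <= M) ->
  (forall j, csum (a j) (r j)) -> (forall k, csum (a^~ k) (c k)) ->
  csum r s -> csum c s.
Proof.
move=> ab bM hM ar ac rs e e0.
have b0 j k : 0 <= b j k := le_trans (cmod_ge0 _) (ab j k).
have [B [bB BM]] := column_sums b0 bM hM.
have aB k J : cmod (\sum_(j < J) a j k) <= B k.
  apply: le_trans (bB J k); apply: le_trans (cmod_sum _ _ _) _.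
  by apply: ler_sum => j _; apply: ab.
have e30 : 0 < e / 3 by lra.
have [N0 hN0] := tannery aB BM ac e30.
have [J0 hJ0] := rs _ e30.
pose J := maxn N0 J0.
have [K0 hK0] := clim_sum (index_enum (ordinal J)) (fun j => ar j) e30.
exists K0 => K /hK0; rewrite exchange_big /= => h1.
have h2 := hN0 J K (leq_maxl _ _); have h3 := hJ0 J (leq_maxr _ _).
rewrite sumrB in h2; move: h1 h2 h3.
set X := \sum_(k < K) \sum_(j < J) _; set Y := \sum_(k < K) c k.
set Z := \sum_(j < J) r j => h1 h2 h3.
have -> : Y - s = (X - Z) + (Z - s) - (X - Y) by ring.
have := cmodD (X - Z + (Z - s)) (- (X - Y)); rewrite cmodN.
by have := cmodD (X - Z) (Z - s); lra.
Qed.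

(** Partial sums that change with the length of the sum; this is how sums over
    boxes of multi-indices are compared with iterated sums. *)
Lemma csum_diagonal (a : nat -> nat -> C) (c : nat -> C) (B : nat -> R) (M : R) s :
  (forall k N, cmod (a k N) <= B k) -> (forall K, \sum_(k < K) B k <= M) ->
  (forall k, clim (a k) (c k)) -> csum c s ->
  clim (fun N => \sum_(k < N) a k N) s.
Proof.
move=> aB hM ac cs e e0; have e20 : 0 < e / 2 by lra.
have [N0 h] := tannery aB hM ac e20.
have [N1 h1] := cs _ e20.
exists (maxn N0 N1) => n; rewrite geq_max => /andP[hn0 /h1 a1].
have := h n n hn0; rewrite sumrB => a0; move: a0 a1.
set X := \sum_(k < n) a k n; set Y := \sum_(k < n) c k => a0 a1.
have -> : X - s = (X - Y) + (Y - s) by ring.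
by have := cmodD (X - Y) (Y - s); lra.
Qed.

Lemma lerXl (a b : R) k : 0 <= a -> a <= b -> a ^+ k <= b ^+ k.
Proof. by move=> a0 ab; apply: lerXn2r => //; rewrite nnegrE // (le_trans a0). Qed.

Lemma csum_single (a : nat -> C) d : (forall k, k != d -> a k = 0) -> csum a (a d).
Proof.
move=> h e e0; exists d.+1 => n hn; rewrite (bigD1 (Ordinal hn)) //= big1 ?addr0 ?subrr ?cmod0 //.
by move=> i; rewrite -val_eqE /= => /h.
Qed.

Lemma csum_recl (a : nat -> C) s : csum (fun k => a k.+1) s -> csum a (a 0%N + s).
Proof.
move=> h e /h[N hN]; exists N.+1 => -[//|n] hn; rewrite big_ord_recl /=.
by rewrite opprD addrACA subrr add0r; apply: hN.
Qed.

Lemma geometric_sum (t : R) K : 0 <= t -> t < 1 -> \sum_(k < K) t ^+ k <= (1 - t)^-1.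
Proof.
move=> t0 t1; have h : 0 < 1 - t by lra.
rewrite -[leRHS]mul1r ler_pdivlMr // mulrC.
have -> : (1 - t) * \sum_(k < K) t ^+ k = 1 - t ^+ K.
  by rewrite -[1 - t]opprB mulNr -subrX1 opprB.
by rewrite gerBl exprn_ge0.
Qed.

Lemma csum_geometric (u : C) : cmod u < 1 -> csum (fun k => u ^+ k) (1 - u)^-1.
Proof.
move=> u1.
have [s hs] : exists s, csum (fun k => u ^+ k) s.
  apply: (@dominated_csum _ (fun k => cmod u ^+ k) (1 - cmod u)^-1) => k.
    by rewrite cmodX.
  by apply: geometric_sum; rewrite ?cmod_ge0.
suff -> : (1 - u)^-1 = s by [].
have h : csum (fun k => u ^+ k) (1 + u * s).
  apply: (@csum_recl (fun k => u ^+ k)); apply: clim_ext (climZ u hs) => N.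
  by rewrite mulr_sumr; apply: eq_bigr => k _; rewrite exprS.
have e := clim_uniq hs h.
have n0 : 1 - u != 0.
  by apply/eqP => /eqP; rewrite subr_eq0 => /eqP u_1; move: u1; rewrite -u_1 cmod1 ltxx.
by apply: (mulfI n0); rewrite divff // mulrBl mul1r {1}e; ring.
Qed.

End Convergence.
(** * Absolutely convergent power series on polydiscs *)

Section PowerSeries.
Variable R : realType.
Local Notation C := R[i].
Local Notation pnt := (nat -> C).
Implicit Types (rho sigma : nat -> R) (z w : pnt) (f g : pnt -> C).

Definition polydisc m rho z := forall i, (i < m)%N -> cmod (z i) <= rho i.

(** [f] is, on the closed polydisc of radii [rho], the sum of a power series in
    the first [m] coordinates whose coefficients satisfy
    [sum |c_e| rho^e <= M]. Points are sequences, of which only the first [m]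
    terms matter: no dependent type has to change when the last variable is
    split off, and the recursion is the expansion along this variable, with
    coefficients which are functions of the others. *)
Fixpoint power_series m rho (M : R) f : Prop :=
  if m is m'.+1 then
    exists (g : nat -> pnt -> C) (B : nat -> R),
      [/\ forall k, power_series m' rho (B k) (g k),
          forall K, \sum_(k < K) B k * rho m' ^+ k <= M
        & forall z, polydisc m'.+1 rho z ->
            csum (fun k => g k z * z m' ^+ k) (f z)]
  else exists c, cmod c <= M /\ forall z, f z = c.

Lemma polydiscS m rho z : polydisc m.+1 rho z -> polydisc m rho z.
Proof. by move=> h i hi; apply: h; rewrite ltnS ltnW. Qed.

Lemma polydisc0 m rho : (forall i, 0 < rho i) -> polydisc m rho (fun=> 0).
Proof. by move=> h i _; rewrite cmod0 ltW. Qed.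

Lemma ps_ge0 m rho M f : power_series m rho M f -> 0 <= M.
Proof.
case: m => [[c [h _]]|m [g [B [_ h _]]]]; first exact: le_trans (cmod_ge0 c) h.
by have := h 0%N; rewrite big_ord0.
Qed.

Lemma ps_ext m rho M f f' :
  (forall z, polydisc m rho z -> f z = f' z) ->
  power_series m rho M f -> power_series m rho M f'.
Proof.
case: m => [|m] e.
  by move=> [c [h hf]]; exists c; split=> // z; rewrite -e.
by move=> [g [B [h1 h2 h3]]]; exists g, B; split=> [||z hz]; [exact: h1 | exact: h2 | rewrite -e //; exact: h3].
Qed.

Lemma ps_le m rho M M' f :
  M <= M' -> power_series m rho M f -> power_series m rho M' f.
Proof.
move=> le; case: m => [|m].
  by move=> [c [h hf]]; exists c; split=> //; apply: le_trans le.
by move=> [g [B [h1 h2 h3]]]; exists g, B; split=> [|K|]; [exact: h1 | exact: le_trans le | exact: h3].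
Qed.

Lemma polydisc_shrink m rho sigma z :
  (forall i, (i < m)%N -> sigma i <= rho i) ->
  polydisc m sigma z -> polydisc m rho z.
Proof. by move=> le h i hi; apply: le_trans (h i hi) (le i hi). Qed.

Lemma ps_shrink m rho sigma M f :
  (forall i, (i < m)%N -> 0 <= sigma i <= rho i) ->
  power_series m rho M f -> power_series m sigma M f.
Proof.
elim: m M f => [//|m IH] M f le [g [B [h1 h2 h3]]]; exists g, B; split=> [k|K|z hz].
- by apply: (IH _ _ _ (h1 k)) => i hi; apply: le; rewrite ltnS ltnW.
- apply: le_trans (h2 K); apply: ler_sum => k _; apply: ler_wpM2l; first exact: ps_ge0 (h1 k).
  by have /andP[a b] := le _ (ltnSn m); apply: lerXn2r => //; rewrite nnegrE ?(le_trans a b).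
- apply: h3; apply: polydisc_shrink hz => i hi; by case/andP: (le i hi).
Qed.

Lemma ps_bound m rho M f z :
  power_series m rho M f -> polydisc m rho z -> cmod (f z) <= M.
Proof.
elim: m M f => [|m IH] M f; first by move=> [c [h hf]] _; rewrite hf.
move=> [g [B [h1 h2 h3]]] hz.
apply: (@csum_bound _ _ (fun k => B k * rho m ^+ k)) h2 (h3 z hz) => k.
have zm := hz m (ltnSn m).
rewrite cmodM cmodX; apply: ler_pM; [exact: cmod_ge0 | by rewrite exprn_ge0 ?cmod_ge0 | |].
  exact: IH (h1 k) (polydiscS hz).
exact: lerXl (cmod_ge0 _) zm.
Qed.

(** By uniqueness of limits along the recursion. It allows one to change the
    irrelevant coordinates of a point at will, in particular to make them small. *)
Lemma ps_local m rho M f z z' :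
  power_series m rho M f -> polydisc m rho z ->
  (forall i, (i < m)%N -> z i = z' i) -> f z = f z'.
Proof.
elim: m M f => [|m IH] M f; first by move=> [c [h hf]] _ _; rewrite !hf.
move=> [g [B [h1 h2 h3]]] hz e.
have hz' : polydisc m.+1 rho z' by move=> i hi; rewrite -e //; apply: hz.
apply: clim_uniq (h3 z hz) _; apply: clim_ext (h3 z' hz') => N.
apply: eq_bigr => k _; rewrite -(e m) //; congr (_ * _).
by apply/esym; apply: IH (h1 k) (polydiscS hz) _ => i hi; apply: e; rewrite ltnS ltnW.
Qed.

Lemma ps_zero m rho : power_series m rho 0 (fun=> 0).
Proof.
elim: m => [|m IH]; first by exists 0; rewrite cmod0.
exists (fun _ _ => 0), (fun=> 0); split=> // [K|z _].
  by rewrite big1 // => k _; rewrite mul0r.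
by apply: clim_ext (@clim_cst _ 0) => N; rewrite big1 // => k _; rewrite mul0r.
Qed.

Lemma ps_monomial m rho M f d : (forall i, 0 < rho i) ->
  power_series m rho M f ->
  power_series m.+1 rho (M * rho m ^+ d) (fun z => f z * z m ^+ d).
Proof.
move=> r0 h; have M0 := ps_ge0 h.
exists (fun k => if k == d then f else fun=> 0), (fun k => if k == d then M else 0).
split=> [k|K|z hz].
- by case: eqP => // _; apply: ps_zero.
- have [hd|hd] := ltnP d K.
    rewrite (bigD1 (Ordinal hd)) //= eqxx big1 ?addr0 // => i.
    by rewrite -val_eqE /= => /negbTE ->; rewrite mul0r.
  rewrite big1 ?mulr_ge0 ?exprn_ge0 // ?ltW // => i _.
  by rewrite ltn_eqF ?mul0r // (leq_trans (ltn_ord i)).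
- pose a k := (if k == d then f else fun=> 0) z * z m ^+ k.
  have -> : f z * z m ^+ d = a d by rewrite /a eqxx.
  by apply: csum_single => k /negbTE hk; rewrite /a hk mul0r.
Qed.

Lemma ps_embed m rho M f : (forall i, 0 < rho i) ->
  power_series m rho M f -> power_series m.+1 rho M f.
Proof.
move=> r0 h; rewrite -[M](mulr1 M) -(expr0 (rho m)).
by apply: ps_ext (ps_monomial 0 r0 h) => z _; rewrite expr0 mulr1.
Qed.

Lemma ps_cst m rho c : (forall i, 0 < rho i) ->
  power_series m rho (cmod c) (fun=> c).
Proof. by move=> r0; elim: m => [|m IH]; [exists c | apply: ps_embed]. Qed.

Lemma ps_coord m rho i : (forall i, 0 < rho i) -> (i < m)%N ->
  power_series m rho (rho i) (fun z => z i).
Proof.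
move=> r0; elim: m => [//|m IH]; rewrite ltnS leq_eqVlt => /orP[/eqP -> | /IH].
  rewrite -[rho m]mul1r -(cmod1 R) -[rho m]expr1.
  by apply: ps_ext (ps_monomial 1 r0 (ps_cst m 1 r0)) => z _; rewrite mul1r expr1.
exact: ps_embed.
Qed.

Lemma ps_add m rho M M' f f' : power_series m rho M f -> power_series m rho M' f' ->
  power_series m rho (M + M') (fun z => f z + f' z).
Proof.
elim: m M M' f f' => [|m IH] M M' f f'.
  move=> [c [h hf]] [c' [h' hf']]; exists (c + c'); split.
    exact: le_trans (cmodD _ _) (lerD h h').
  by move=> z; rewrite hf hf'.
move=> [g [B [h1 h2 h3]]] [g' [B' [h1' h2' h3']]].
exists (fun k z => g k z + g' k z), (fun k => B k + B' k); split=> [k|K|z hz].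
- exact: IH (h1 k) (h1' k).
- under eq_bigr do rewrite mulrDl; rewrite big_split; exact: lerD.
- apply: clim_ext (csumD (h3 z hz) (h3' z hz)) => N.
  by apply: eq_bigr => k _; rewrite mulrDl.
Qed.

Lemma ps_sum m rho d (Ms : nat -> R) (fs : nat -> pnt -> C) :
  (forall k, (k < d)%N -> power_series m rho (Ms k) (fs k)) ->
  power_series m rho (\sum_(k < d) Ms k) (fun z => \sum_(k < d) fs k z).
Proof.
elim: d => [|d IH] h.
  by rewrite big_ord0; apply: ps_ext (ps_zero m rho) => z _; rewrite big_ord0.
rewrite big_ord_recr; apply: ps_ext (ps_add (IH _) (h d (ltnSn d))) => [z _|k hk].
  by rewrite big_ord_recr.
by apply: h; rewrite ltnS ltnW.
Qed.

(** Completeness of the space of absolutely convergent power series. *)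
Lemma ps_infinite_sum m rho (Ms : nat -> R) M (fs : nat -> pnt -> C) f :
  (forall i, 0 < rho i) ->
  (forall j, power_series m rho (Ms j) (fs j)) ->
  (forall J, \sum_(j < J) Ms j <= M) ->
  (forall z, polydisc m rho z -> csum (fs^~ z) (f z)) ->
  power_series m rho M f.
Proof.
move=> r0; elim: m Ms M fs f => [|m IH] Ms M fs f hfs hM hf.
  have /choice[c hc] := hfs; exists (f (fun=> 0)).
  have P0 z : polydisc 0 rho z by [].
  have e z j : fs j z = c j by case: (hc j) => _; apply.
  split.
    apply: (@csum_bound _ c Ms) => [k||]; [by case: (hc k) | by [] |].
    by apply: clim_ext (hf _ (P0 (fun=> 0))) => N; apply: eq_bigr => j _.
  move=> z; apply: clim_uniq (hf z (P0 z)) _.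
  by apply: clim_ext (hf _ (P0 (fun=> 0))) => N; apply: eq_bigr => j _; rewrite !e.
have /choice[G] := hfs => /choice[B] hB.
have G1 j k : power_series m rho (B j k) (G j k) by case: (hB j) => h _ _; exact: h.
have B2 j K : \sum_(k < K) B j k * rho m ^+ k <= Ms j by case: (hB j) => _ h _; exact: h.
have G3 j z : polydisc m.+1 rho z -> csum (fun k => G j k z * z m ^+ k) (fs j z).
  by move=> hz; case: (hB j) => _ _ h; exact: h.
have rk k : 0 < rho m ^+ k by rewrite exprn_gt0.
have b0 j k : 0 <= B j k * rho m ^+ k by rewrite mulr_ge0 ?(ps_ge0 (G1 j k)) // ltW.
have [T [T1 T2]] := column_sums b0 B2 hM.
have BT J k : \sum_(j < J) B j k <= T k / rho m ^+ k.
  by rewrite ler_pdivlMr // mulr_suml.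
have : forall kz : nat * pnt, exists s,
    polydisc m rho kz.2 -> csum (fun j => G j kz.1 kz.2) s.
  move=> [k z] /=; case: (pselect (polydisc m rho z)) => hz; last by exists 0.
  have [s hs] := @dominated_csum _ (fun j => G j k z) (fun j => B j k) (T k / rho m ^+ k)
    (fun j => ps_bound (G1 j k) hz) (BT^~ k).
  by exists s.
move=> /choice[F hF].
exists (fun k z => F (k, z)), (fun k => T k / rho m ^+ k); split=> [k|K|z hz].
- by apply: (IH (fun j => B j k) _ (fun j => G j k)) => // z hz; apply: (hF (k, z)).
- by under eq_bigr => k _ do rewrite divfK ?gt_eqF //.
- apply: (@csum_exchange _ (fun j k => G j k z * z m ^+ k) (fun j k => B j k * rho m ^+ k)
    Ms M (fs^~ z)) => // [j k|j|k|]; last exact: hf.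
  + rewrite cmodM cmodX.
    apply: ler_pM; [exact: cmod_ge0 | by rewrite exprn_ge0 ?cmod_ge0 | |].
      exact: ps_bound (G1 j k) (polydiscS hz).
    exact: lerXl (cmod_ge0 _) (hz m (ltnSn m)).
  + exact: G3.
  + rewrite /= mulrC; apply: clim_ext (climZ (z m ^+ k) (hF (k, z) (polydiscS hz))) => N.
    by rewrite mulr_sumr; apply: eq_bigr => j _; rewrite mulrC.
Qed.

Lemma ps_mulX m rho M f d : (forall i, 0 < rho i) ->
  power_series m.+1 rho M f ->
  power_series m.+1 rho (M * rho m ^+ d) (fun z => f z * z m ^+ d).
Proof.
move=> r0 [g [B [h1 h2 h3]]].
apply: (@ps_infinite_sum _ _ (fun k => B k * rho m ^+ k * rho m ^+ d) _
  (fun k z => g k z * z m ^+ (k + d))) => // [k|J|z hz].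
- by rewrite -mulrA -exprD; apply: ps_monomial (h1 k).
- by rewrite -mulr_suml; apply: ler_wpM2r (h2 J); rewrite exprn_ge0 // ltW.
- rewrite mulrC; apply: clim_ext (climZ (z m ^+ d) (h3 z hz)) => N.
  by rewrite mulr_sumr; apply: eq_bigr => k _; rewrite exprD; ring.
Qed.

Lemma ps_mul m rho M M' f f' : (forall i, 0 < rho i) ->
  power_series m rho M f -> power_series m rho M' f' ->
  power_series m rho (M * M') (fun z => f z * f' z).
Proof.
move=> r0; elim: m M M' f f' => [|m IH] M M' f f'.
  move=> [c [h hf]] [c' [h' hf']]; exists (c * c'); split.
    by rewrite cmodM; apply: ler_pM; rewrite ?cmod_ge0.
  by move=> z; rewrite hf hf'.
move=> [g [B [h1 h2 h3]]] hf'; have M'0 := ps_ge0 hf'.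
have gf' k : power_series m.+1 rho (B k * M') (fun z => g k z * f' z).
  case: hf' => [g' [B' [h1' h2' h3']]].
  exists (fun j z => g k z * g' j z), (fun j => B k * B' j); split=> [j|K|z hz].
  - exact: IH (h1 k) (h1' j).
  - under eq_bigr do rewrite -mulrA; rewrite -mulr_sumr.
    by apply: ler_wpM2l (h2' K); apply: ps_ge0 (h1 k).
  - by apply: clim_ext (csumZ (g k z) (h3' z hz)) => N; apply: eq_bigr => j _; rewrite mulrA.
apply: (@ps_infinite_sum _ _ (fun k => B k * M' * rho m ^+ k) _
  (fun k z => g k z * f' z * z m ^+ k)) => // [k|J|z hz].
- exact: ps_mulX.
- under eq_bigr do rewrite mulrAC; rewrite -mulr_suml; exact: ler_wpM2r.
- rewrite mulrC; apply: clim_ext (climZ (f' z) (h3 z hz)) => N.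
  by rewrite mulr_sumr; apply: eq_bigr => k _; ring.
Qed.

Lemma ps_exp m rho M f d : (forall i, 0 < rho i) ->
  power_series m rho M f -> power_series m rho (M ^+ d) (fun z => f z ^+ d).
Proof.
move=> r0 h; elim: d => [|d IH].
  by rewrite expr0 -(cmod1 R); apply: ps_ext (ps_cst m 1 r0) => z _; rewrite expr0.
by rewrite exprS; apply: ps_ext (ps_mul r0 h IH) => z _; rewrite exprS.
Qed.

Lemma ps_comp m m' rho sigma M f (g : nat -> pnt -> C) : (forall i, 0 < sigma i) ->
  power_series m rho M f ->
  (forall i, (i < m)%N -> power_series m' sigma (rho i) (g i)) ->
  power_series m' sigma M (fun z => f (g^~ z)).
Proof.
move=> s0; elim: m M f => [|m IH] M f.
  move=> [c [h hf]] _; apply: ps_le h _.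
  by apply: ps_ext (ps_cst m' c s0) => z _; rewrite hf.
move=> [gf [B [h1 h2 h3]]] hg.
have hg' i : (i < m)%N -> power_series m' sigma (rho i) (g i).
  by move=> hi; apply: hg; rewrite ltnS ltnW.
apply: (@ps_infinite_sum _ _ (fun k => B k * rho m ^+ k) _
  (fun k z => gf k (g^~ z) * g m z ^+ k)) => // [k|z hz].
  by apply: ps_mul => //; [apply: IH (h1 k) hg' | apply: ps_exp => //; apply: hg].
by apply: (h3 (g^~ z)) => i hi; apply: ps_bound hz; apply: hg.
Qed.

(** Every monomial other than the constant one gains at least one factor [lam]
    when the radii are multiplied by [lam]. This is the source of continuity and
    of all smallness arguments. *)
Lemma ps_vanishing m rho M f (lam : R) : (forall i, 0 < rho i) ->
  0 < lam <= 1 -> power_series m rho M f ->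
  power_series m (fun i => lam * rho i) (lam * M) (fun z => f z - f (fun=> 0)).
Proof.
move=> r0 /andP[l0 l1]; elim: m M f => [|m IH] M f.
  move=> [c [h hf]]; exists 0; rewrite cmod0; split=> [|z]; last by rewrite !hf subrr.
  exact: mulr_ge0 (ltW l0) (le_trans (cmod_ge0 c) h).
move=> [g [B [h1 h2 h3]]].
have f0 : f (fun=> 0) = g 0%N (fun=> 0).
  have /clim_uniq := h3 _ (polydisc0 (m := m.+1) r0); apply.
  pose a k := g k (fun=> 0) * (0 : C) ^+ k.
  have -> : g 0%N (fun=> 0) = a 0%N by rewrite /a expr0 mulr1.
  by apply: csum_single => -[//|k] _; rewrite /a expr0n mulr0.
have le i : (i < m)%N -> 0 <= lam * rho i <= rho i.
  move=> _; apply/andP; split; first exact: mulr_ge0 (ltW l0) (ltW (r0 i)).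
  exact: ler_piMl (ltW (r0 i)) l1.
exists (fun k => if k is 0%N then fun z => g 0%N z - g 0%N (fun=> 0) else g k),
  (fun k => if k is 0%N then lam * B 0%N else B k); split=> [[|k]|K|z hz].
- exact: IH (h1 0%N).
- exact: ps_shrink le (h1 _).
- apply: le_trans (_ : \sum_(k < K) lam * (B k * rho m ^+ k) <= _).
    apply: ler_sum => -[[|k] hk] _ /=; first by rewrite !expr0 !mulr1.
    rewrite exprMn mulrCA ler_wpM2r //.
      by rewrite mulr_ge0 ?(ps_ge0 (h1 _)) // exprn_ge0 // ltW.
    by rewrite exprS ler_piMr ?(ltW l0) // exprn_ile1 // ltW.
  by rewrite -mulr_sumr; apply: ler_wpM2l => //; apply: ltW.
- have hz' : polydisc m.+1 rho z.
    by apply: polydisc_shrink hz => i _; rewrite ler_piMl // ltW.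
  rewrite f0; move=> e e0; have [N hN] := h3 z hz' _ e0.
  exists N.+1 => -[//|n] hn; have := hN n.+1 (ltnW hn).
  rewrite !big_ord_recl /= !expr0 !mulr1; congr (_ < _); congr cmod; ring.
Qed.

Lemma power_series1_eq0 (a : nat -> C) (B : nat -> R) (M s d : R) :
  0 < s -> 0 < d ->
  (forall k, cmod (a k) <= B k) -> (forall K, \sum_(k < K) B k * s ^+ k <= M) ->
  (forall y, cmod y <= s -> cmod y <= d -> csum (fun k => a k * y ^+ k) 0) ->
  forall k, a k = 0.
Proof.
move=> s0 d0 aB hM h k; elim/ltn_ind: k => k IH.
have M0 : 0 <= M by have := hM 0%N; rewrite big_ord0.
apply: cmod_small => e e0.
(* The first nonzero term would dominate the others at a small real point. *)
pose t : R := Num.min (Num.min s d) (e * s ^+ k.+1 / (M + 1)).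
have sk j : 0 < s ^+ j by rewrite exprn_gt0.
have t0 : 0 < t.
  by rewrite !lt_min s0 d0 /=; apply: divr_gt0; [apply: mulr_gt0 | lra].
have ts : t <= s by rewrite !ge_min lexx.
have td : t <= d by rewrite !ge_min lexx orbT.
have te : t <= e * s ^+ k.+1 / (M + 1) by rewrite !ge_min lexx !orbT.
have ct : cmod t%:C = t by rewrite cmod_real gtr0_norm.
have ht := h t%:C; rewrite ct in ht; have {}ht := ht ts td.
pose b j := if j == k then 0 else a j * t%:C ^+ j.
have hb : csum b (- (a k * t%:C ^+ k)).
  pose c j := if j == k then - (a k * t%:C ^+ k) else 0.
  have hc : csum c (c k) by apply: csum_single => j /negbTE; rewrite /c => ->.
  have ck : c k = - (a k * t%:C ^+ k) by rewrite /c eqxx.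
  rewrite -ck -[c k]add0r; have := csumD ht hc; apply: clim_ext => N.
  apply: eq_bigr => j _; rewrite /b /c; case: eqP => [->|_]; last by rewrite addr0.
  by rewrite subrr.
have bb j : cmod (b j) <= (t / s) ^+ k.+1 * (B j * s ^+ j).
  have B0 : 0 <= B j := le_trans (cmod_ge0 _) (aB j).
  have rhs0 : 0 <= (t / s) ^+ k.+1 * (B j * s ^+ j).
    apply: mulr_ge0; first by rewrite exprn_ge0 // divr_ge0 ?ltW.
    exact: mulr_ge0 B0 (ltW (sk j)).
  rewrite /b; case: eqP => [_|/eqP hj]; first by rewrite cmod0.
  case: (ltnP j k) => hjk; first by rewrite IH // mul0r cmod0.
  have {hj hjk} hjk : (k.+1 <= j)%N by rewrite ltn_neqAle eq_sym hj.
  rewrite cmodM cmodX ct mulrCA; apply: ler_pM => //; first exact: cmod_ge0.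
    by rewrite exprn_ge0 // ltW.
  have -> : t ^+ j = (t / s) ^+ j * s ^+ j.
    by rewrite exprMn exprVn -mulrA mulVf ?mulr1 // gt_eqF.
  rewrite ler_pM2r // -(subnKC hjk) exprD ler_piMr //.
    by rewrite exprn_ge0 // divr_ge0 ?ltW.
  apply: exprn_ile1; first by rewrite divr_ge0 ?ltW.
  by rewrite ler_pdivrMr // mul1r.
have hbM K : \sum_(j < K) (t / s) ^+ k.+1 * (B j * s ^+ j) <= (t / s) ^+ k.+1 * M.
  by rewrite -mulr_sumr; apply: ler_wpM2l (hM K); rewrite exprn_ge0 // divr_ge0 ?ltW.
have := csum_bound bb hbM hb; rewrite cmodN cmodM cmodX ct => le.
have tk : 0 < t ^+ k by rewrite exprn_gt0.
have : cmod (a k) <= t / s ^+ k.+1 * M.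
  rewrite -(ler_pM2r tk); apply: le_trans le _; rewrite exprMn exprVn [t ^+ k.+1]exprS.
  by rewrite le_eqVlt; apply/orP; left; apply/eqP; ring.
move=> le2; apply: le_trans le2 _; rewrite mulrAC ler_pdivrMr //.
have M1 : 0 < M + 1 by lra.
move: te; rewrite ler_pdivlMr // => te; apply: le_trans te.
by rewrite ler_pM2l //; lra.
Qed.

(** At points with small coordinates the expansions along the last variable
    vanish, so their coefficients vanish near the origin, hence on the polydisc
    by induction on the number of variables. *)
Lemma ps_identity m rho M f (d : R) : (forall i, 0 < rho i) -> 0 < d ->
  power_series m rho M f ->
  (forall z, polydisc m rho z -> polydisc m (fun=> d) z -> f z = 0) ->
  forall z, polydisc m rho z -> f z = 0.
Proof.
move=> r0 d0; elim: m M f => [|m IH] M f; first by move=> _ h z hz; apply: h.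
move=> [g [B [h1 h2 h3]]] h.
have g0 k z : polydisc m rho z -> g k z = 0.
  move=> hz; apply: (IH _ _ (h1 k)) hz => {}z hz hd.
  apply: (@power_series1_eq0 (fun k => g k z) B M (rho m) d) => // [j|y ys yd].
    exact: ps_bound (h1 j) hz.
  pose z' i := if (i < m)%N then z i else y.
  have e i : (i < m)%N -> z i = z' i by rewrite /z' => ->.
  have z'm : z' m = y by rewrite /z' ltnn.
  have P (s : nat -> R) : polydisc m s z -> cmod y <= s m -> polydisc m.+1 s z'.
    move=> hs ym i; rewrite ltnS leq_eqVlt => /orP[/eqP -> | hi]; first by rewrite z'm.
    by rewrite -e //; apply: hs.
  have := h3 z' (P _ hz ys); rewrite h; [| exact: P | exact: P].
  apply: clim_ext => N; apply: eq_bigr => j _; rewrite z'm; congr (_ * _).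
  by apply/esym; apply: ps_local (h1 j) hz e.
move=> z hz; apply: clim_uniq (h3 z hz) _; apply: clim_ext (@clim_cst _ 0) => N.
by rewrite big1 // => k _; rewrite g0 ?mul0r //; apply: polydiscS.
Qed.

Lemma ps_recenter m (rho : R) M f z0 : 0 < rho ->
  power_series m (fun=> rho) M f -> polydisc m (fun=> rho / 2) z0 ->
  power_series m (fun=> rho / 2) M (fun w => f (fun i => z0 i + w i)).
Proof.
move=> r0 hf hz; have r20 : forall _ : nat, 0 < rho / 2 by move=> _; lra.
apply: (@ps_comp m m _ _ _ _ (fun i w => z0 i + w i)) hf _ => // i hi.
apply: ps_le (ps_add (ps_cst m (z0 i) r20) (ps_coord r20 hi)).
by have := hz i hi; clear r20; lra.
Qed.

Lemma ps_continuous m (rho : R) M f z0 (e : R) : 0 < rho -> 0 < e ->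
  power_series m (fun=> rho) M f -> polydisc m (fun=> rho / 2) z0 ->
  exists2 d : R, 0 < d &
    forall z, polydisc m (fun=> d) (fun i => z i - z0 i) -> cmod (f z - f z0) <= e.
Proof.
move=> r0 e0 hf hz; have h := ps_recenter r0 hf hz; have M0 := ps_ge0 hf.
have M1 : 0 < M + 1 by lra.
pose lam := Num.min 1 (e / (M + 1)).
have l0 : 0 < lam by rewrite lt_min ltr01 divr_gt0.
have l1 : lam <= 1 by rewrite ge_min lexx.
have le : lam * M <= e.
  apply: le_trans (_ : e / (M + 1) * M <= _).
    by rewrite ler_wpM2r // ge_min lexx orbT.
  by rewrite mulrAC ler_pdivrMr // ler_pM2l //; lra.
have r20 : forall _ : nat, 0 < rho / 2 by move=> _; lra.
exists (lam * (rho / 2)); first exact: mulr_gt0 l0 (r20 0%N).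
move=> z hd; have l01 : 0 < lam <= 1 by rewrite l0.
have {hd} hd : polydisc m (fun=> lam * (rho / 2)) (fun i => z i - z0 i) := hd.
have := ps_bound (ps_vanishing r20 l01 h) hd.
have -> : (fun i => z0 i + (z i - z0 i)) = z by apply/funext => i; rewrite addrC subrK.
have -> : (fun i => z0 i + 0) = z0 by apply/funext => i; rewrite addr0.
by move/le_trans; apply.
Qed.

End PowerSeries.
(** * Analytic functions near the origin *)

Section Analytic.
Variable R : realType.
Local Notation C := R[i].
Local Notation pnt := (nat -> C).
Implicit Types (z w : pnt) (f g : pnt -> C).

Definition origin : set_system pnt :=
  [set P | exists2 d : R, 0 < d & forall z, (forall i, cmod (z i) <= d) -> P z].

Global Instance origin_filter : ProperFilter origin.
Proof.
split; first by case=> d d0 /(_ (fun=> 0)); apply=> i; rewrite cmod0 ltW.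
split=> [|P Q [d d0 hP] [e e0 hQ]|P Q PQ [d d0 hP]].
- by exists 1.
- exists (Num.min d e); first by rewrite lt_min d0.
  by move=> z hz; split; [apply: hP | apply: hQ] => i;
    apply: le_trans (hz i) _; rewrite ge_min lexx ?orbT.
- by exists d => // z hz; apply/PQ/hP.
Qed.

Lemma origin0 (P : pnt -> Prop) : (\forall z \near origin, P z) -> P (fun=> 0).
Proof. by case=> d d0; apply=> i; rewrite cmod0 ltW. Qed.

Lemma origin_small (d : R) : 0 < d -> \forall z \near origin, forall i, cmod (z i) <= d.
Proof. by move=> d0; exists d. Qed.

Lemma not_near_ex (P Q : pnt -> Prop) :
  ~ (\forall z \near origin, P z) -> (\forall z \near origin, Q z) ->
  exists2 z, Q z & ~ P z.
Proof.
move=> nP hQ; apply: contrapT => h; apply: nP; apply: filterS hQ => z hz.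
by apply: contrapT => nPz; apply: h; exists z.
Qed.

Lemma finite_lower_bound (S : nat -> R) m : (forall i, 0 < S i) ->
  exists2 s : R, 0 < s & forall i, (i < m)%N -> s <= S i.
Proof.
move=> S0; elim: m => [|m [s s0 hs]]; first by exists 1.
exists (Num.min s (S m)); first by rewrite lt_min s0 S0.
move=> i; rewrite ltnS leq_eqVlt ge_min => /orP[/eqP -> | /hs -> //].
by rewrite lexx orbT.
Qed.

Definition analytic m f : Prop :=
  exists rho M : R, 0 < rho /\ power_series m (fun=> rho) M f.

Lemma analytic_shrink m f : analytic m f -> exists2 r0 : R, 0 < r0 &
  forall r, 0 < r -> r <= r0 -> exists M, power_series m (fun=> r) M f.
Proof.
move=> [r0 [M [r00 h]]]; exists r0 => // r rp rr; exists M.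
by apply: ps_shrink h => i _; rewrite ltW.
Qed.

Lemma analytic_common m f g : analytic m f -> analytic m g ->
  exists2 r : R, 0 < r & exists M M', power_series m (fun=> r) M f /\
    power_series m (fun=> r) M' g.
Proof.
move=> /analytic_shrink[r r0 hf] /analytic_shrink[s s0 hg].
have m0 : 0 < Num.min r s by rewrite lt_min r0.
have [||M hM] := hf (Num.min r s) => //; first by rewrite ge_min lexx.
have [||M' hM'] := hg (Num.min r s) => //; first by rewrite ge_min lexx orbT.
by exists (Num.min r s) => //; exists M, M'.
Qed.

Lemma analytic_cst m c : analytic m (fun=> c).
Proof. by exists 1, (cmod c); split=> //; apply: ps_cst. Qed.

Lemma analytic_coord m i : (i < m)%N -> analytic m (fun z => z i).
Proof. by move=> hi; exists 1, 1; split=> //; apply: (@ps_coord R m (fun=> 1)). Qed.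

Lemma analyticD m f g : analytic m f -> analytic m g -> analytic m (fun z => f z + g z).
Proof.
move=> hf hg; have [r r0 [M [M' [h h']]]] := analytic_common hf hg.
by exists r, (M + M'); split=> //; apply: ps_add.
Qed.

Lemma analyticM m f g : analytic m f -> analytic m g -> analytic m (fun z => f z * g z).
Proof.
move=> hf hg; have [r r0 [M [M' [h h']]]] := analytic_common hf hg.
by exists r, (M * M'); split=> //; apply: ps_mul.
Qed.

Lemma analytic_ext m f g : f =1 g -> analytic m f -> analytic m g.
Proof. by move=> /funext ->. Qed.

Lemma analyticN m f : analytic m f -> analytic m (fun z => - f z).
Proof.
by move=> hf; apply: analytic_ext (analyticM (analytic_cst m (-1)) hf) => z; rewrite mulN1r.
Qed.

Lemma analyticB m f g : analytic m f -> analytic m g -> analytic m (fun z => f z - g z).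
Proof. by move=> hf hg; apply: analyticD hf (analyticN hg). Qed.

Lemma analyticX m f d : analytic m f -> analytic m (fun z => f z ^+ d).
Proof.
by move=> [r [M [r0 h]]]; exists r, (M ^+ d); split=> //; apply: ps_exp.
Qed.

Lemma analytic_sum m (I : Type) (s : seq I) (P : pred I) (F : I -> pnt -> C) :
  (forall i, P i -> analytic m (F i)) -> analytic m (fun z => \sum_(i <- s | P i) F i z).
Proof.
move=> h; elim: s => [|i s IH].
  by apply: analytic_ext (analytic_cst m 0) => z; rewrite big_nil.
case: (boolP (P i)) => hi.
  by apply: analytic_ext (analyticD (h i hi) IH) => z; rewrite big_cons hi.
by apply: analytic_ext IH => z; rewrite big_cons (negbTE hi).
Qed.

Lemma analytic_embed m f : analytic m f -> analytic m.+1 f.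
Proof. by move=> [r [M [r0 h]]]; exists r, M; split=> //; apply: ps_embed. Qed.

Lemma analytic_center m f : analytic m f -> forall e : R, 0 < e -> exists2 r0 : R, 0 < r0 &
  forall r, 0 < r -> r <= r0 ->
    exists2 M, M <= e & power_series m (fun=> r) M (fun z => f z - f (fun=> 0)).
Proof.
move=> [r [M [r0 h]]] e e0; have M0 := ps_ge0 h; have M1 : 0 < M + 1 by lra.
pose lam := Num.min 1 (e / (M + 1)).
have l0 : 0 < lam by rewrite lt_min ltr01 divr_gt0.
have l1 : lam <= 1 by rewrite ge_min lexx.
have le : lam * M <= e.
  apply: le_trans (_ : e / (M + 1) * M <= _).
    by rewrite ler_wpM2r // ge_min lexx orbT.
  by rewrite mulrAC ler_pdivrMr // ler_pM2l //; lra.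
exists (lam * r); first exact: mulr_gt0.
move=> s s0 sl; exists (lam * M) => //.
have hr : forall _ : nat, 0 < r by [].
have l01 : 0 < lam <= 1 by rewrite l0.
by apply: ps_shrink (ps_vanishing hr l01 h) => i _; rewrite ltW.
Qed.

Lemma analytic_comp m m' f (g : nat -> pnt -> C) :
  analytic m f -> (forall i, (i < m)%N -> analytic m' (g i)) ->
  (forall i, (i < m)%N -> g i (fun=> 0) = 0) ->
  analytic m' (fun z => f (g^~ z)).
Proof.
move=> [r [M [r0 h]]] hg g0.
have [s s0 hs] : exists2 s : R, 0 < s & forall i, (i < m)%N -> power_series m' (fun=> s) r (g i).
  have /choice[S hS] : forall i, exists s : R, 0 < s /\ forall t, 0 < t -> t <= s ->
      (i < m)%N -> power_series m' (fun=> t) r (g i).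
    move=> i; case: (ltnP i m) => hi; last by exists 1; split.
    have [s s0 hs] := analytic_center (hg i hi) r0; exists s; split=> // t t0 ts _.
    have [M' hM'] := hs t t0 ts; rewrite g0 // => /(ps_le hM').
    by apply: ps_ext => z _; rewrite subr0.
  have [i|s s0 hs] := @finite_lower_bound S m; first by case: (hS i).
  by exists s => // i hi; case: (hS i) => _; apply=> //; apply: hs.
by exists s, M; split=> //; apply: (@ps_comp R m m' (fun=> r)).
Qed.

Lemma analytic_cvg0 m f (e : R) : analytic m f -> 0 < e ->
  \forall z \near origin, cmod (f z - f (fun=> 0)) <= e.
Proof.
move=> hf e0; have [r r0 h] := analytic_center hf e0.
have [M Me hM] := h r r0 (lexx r).
by exists r => // z hz; apply: le_trans Me; apply: (ps_bound (z := z)) hM _ => i _.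
Qed.

Lemma analytic_bounded m f : analytic m f ->
  exists2 M : R, 0 <= M & \forall z \near origin, cmod (f z) <= M.
Proof.
move=> [r [M [r0 h]]]; exists M; first exact: ps_ge0 h.
by exists r => // z hz; apply: ps_bound h _ => i _.
Qed.

Lemma analytic_neq0 m f : analytic m f -> f (fun=> 0) != 0 ->
  \forall z \near origin, f z != 0.
Proof.
move=> hf; rewrite -cmod_gt0 => f0.
have e0 : 0 < cmod (f (fun=> 0)) / 2 by lra.
apply: filterS (analytic_cvg0 hf e0) => z hz; rewrite -cmod_gt0.
by have := cmodB_ge (f (fun=> 0)) (f z); rewrite cmodBC in hz; lra.
Qed.

Lemma analytic_inv m f : analytic m f -> f (fun=> 0) != 0 ->
  analytic m (fun z => (f z)^-1).
Proof.
move=> hf f0.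
pose u z := 1 - (f (fun=> 0))^-1 * f z.
have hu : analytic m u by apply: analyticB (analytic_cst _ _) (analyticM (analytic_cst _ _) hf).
have u0 : u (fun=> 0) = 0 by rewrite /u mulVf // subrr.
have e0 : 0 < (1 / 2 : R) by lra.
have [r r0 h] := analytic_center hu e0; have [M Me hM] := h r r0 (lexx r).
have {hM} h2 : power_series m (fun=> r) (1 / 2) u.
  by apply: ps_le Me _; apply: ps_ext hM => z _; rewrite u0 subr0.
have hr : forall _ : nat, 0 < r by [].
suff hg : power_series m (fun=> r) 2 (fun z => (1 - u z)^-1).
  have : analytic m (fun z => (1 - u z)^-1) by exists r, 2.
  move/(analyticM (analytic_cst m (f (fun=> 0))^-1)); apply: analytic_ext => z.
  by rewrite /u opprB addrC subrK invfM invrK mulrA mulVf // mul1r.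
apply: (@ps_infinite_sum _ _ _ (fun j => (1 / 2) ^+ j) _ (fun j z => u z ^+ j)) => //.
- by move=> j; apply: ps_exp.
- move=> J; apply: le_trans (geometric_sum J _ _) _; clear hr; try lra.
  by have -> : (1 - 1 / 2 : R)^-1 = 2 by field.
- move=> z hz; apply: csum_geometric; have := ps_bound h2 hz; clear hr; lra.
Qed.

Lemma analytic_local m f : analytic m f ->
  \forall z \near origin, forall z', (forall i, (i < m)%N -> z i = z' i) -> f z = f z'.
Proof.
by move=> [r [M [r0 h]]]; exists r => // z hz z'; apply: ps_local h _ => i _.
Qed.

Lemma analytic_continuous m f : analytic m f ->
  \forall z0 \near origin, forall e : R, 0 < e -> exists2 d : R, 0 < d &
    forall z, (forall i, cmod (z i - z0 i) <= d) -> cmod (f z - f z0) <= e.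
Proof.
move=> [r [M [r0 h]]]; have r20 : 0 < r / 2 by lra.
exists (r / 2) => // z0 hz0 e e0.
have [d d0 hd] := ps_continuous r0 e0 h (fun i _ => hz0 i).
by exists d => // z hz; apply: hd => i _.
Qed.

(** The identity theorem: recentering at a point close to the origin gives a
    power series whose polydisc of convergence still contains the origin. *)
Lemma analytic_identity m f : analytic m f ->
  \forall z0 \near origin, forall d : R, 0 < d ->
    (forall z, (forall i, cmod (z i - z0 i) <= d) -> f z = 0) ->
    \forall z \near origin, f z = 0.
Proof.
move=> [r [M [r0 h]]]; have r40 : 0 < r / 4 by lra.
exists (r / 4) => // z0 hz0 d d0 hd.
have P0 : polydisc m (fun=> r / 2) z0 by move=> i _; have := hz0 i; lra.
have h' := ps_recenter r0 h P0.
exists (r / 4) => // z hz.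
have -> : z = (fun i => z0 i + (z i - z0 i)) by apply/funext => i; rewrite addrC subrK.
have r20 : forall _ : nat, 0 < r / 2 by move=> _; lra.
apply: (ps_identity r20 d0 h' _ (z := fun i => z i - z0 i)) => [w hw hwd|i _].
  pose w' i := if (i < m)%N then w i else 0.
  have e i : (i < m)%N -> w i = w' i by rewrite /w' => ->.
  rewrite (ps_local h' hw e); apply: hd => i; rewrite addrC addKr /w'.
  by case: ifP => hi; [apply: hwd | rewrite cmod0 ltW].
by have := cmodD (z i) (- z0 i); rewrite cmodN; have := hz i; have := hz0 i; clear; lra.
Qed.

Lemma analytic_integral m f g : analytic m f -> analytic m g ->
  (\forall z \near origin, f z * g z = 0) ->
  (\forall z \near origin, f z = 0) \/ (\forall z \near origin, g z = 0).
Proof.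
move=> hf hg fg; apply/or_asboolP; rewrite -implyNb; apply/implyP => /asboolPn nf.
apply/asboolP; case: fg => d d0 hd.
have d20 : 0 < d / 2 by lra.
have [z0 [hz0 [cf ig]]] := not_near_ex nf
  (filterI (origin_small d20) (filterI (analytic_continuous hf) (analytic_identity hg))).
move=> /= /eqP; rewrite -cmod_gt0 => f0.
have e0 : 0 < cmod (f z0) / 2 by lra.
have [t t0 ht] := cf _ e0.
apply: (ig (Num.min t (d / 2))); first by rewrite lt_min t0.
move=> z hz; have ht' i : cmod (z i - z0 i) <= t.
  by apply: le_trans (hz i) _; rewrite ge_min lexx.
have hd' i : cmod (z i) <= d.
  have : cmod (z i - z0 i) <= d / 2 by apply: le_trans (hz i) _; rewrite ge_min lexx orbT.
  by have := cmodD (z i - z0 i) (z0 i); rewrite subrK; have := hz0 i; lra.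
have /eqP := hd z hd'; rewrite mulf_eq0 => /orP[/eqP fz|/eqP //].
by exfalso; have := ht z ht'; rewrite fz sub0r cmodN; lra.
Qed.

(** By the identity theorem the points where [c] does not vanish are dense near
    the origin, and both sides of the inequality are continuous. *)
Lemma analytic_le_extend m c f g (K : R) : analytic m c -> analytic m f -> analytic m g ->
  0 <= K -> ~ (\forall z \near origin, c z = 0) ->
  (\forall z \near origin, c z != 0 -> cmod (f z) <= K * cmod (g z)) ->
  \forall z \near origin, cmod (f z) <= K * cmod (g z).
Proof.
move=> hc hf hg K0 nc [d d0 hd].
have d20 : 0 < d / 2 by lra.
apply: filterS (filterI (filterI (analytic_continuous hf) (analytic_continuous hg))
  (filterI (analytic_identity hc) (origin_small d20))).
move=> z0 [[cf cg] [ic hz0]]; apply/ler_addgt0Pr => e e0.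
have e1 : 0 < e / (2 * (K + 1)) by rewrite divr_gt0 // mulr_gt0 //; lra.
have e20 : 0 < e / 2 by lra.
have [s s0 hs] := cf _ e20.
have [t t0 ht] := cg _ e1.
pose u := Num.min (d / 2) (Num.min s t).
have u0 : 0 < u by rewrite !lt_min d20 s0 t0.
have [z hz cz] : exists2 z, forall i, cmod (z i - z0 i) <= u & c z != 0.
  apply: contrapT => H; apply: nc; apply: (ic _ u0) => z hz.
  by apply: contrapT => /eqP cz; apply: H; exists z.
have us : u <= s by rewrite !ge_min lexx !orbT.
have ut : u <= t by rewrite !ge_min lexx !orbT.
have ud : u <= d / 2 by rewrite !ge_min lexx.
have zd i : cmod (z i) <= d.
  by have := cmodD (z i - z0 i) (z0 i); rewrite subrK; have := hz0 i; have := hz i; lra.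
have h1 := hd z zd cz.
have h2 : cmod (f z - f z0) <= e / 2 by apply: hs => i; apply: le_trans us.
have h3 : cmod (g z - g z0) <= e / (2 * (K + 1)) by apply: ht => i; apply: le_trans ut.
have h4 := cmodB_ge (f z0) (f z); have h5 := cmodB_ge (g z) (g z0).
rewrite cmodBC in h4.
have h6 : K * cmod (g z) <= K * (cmod (g z0) + e / (2 * (K + 1))).
  by apply: ler_wpM2l => //; lra.
have h7 : K * (e / (2 * (K + 1))) <= e / 2.
  rewrite mulrA ler_pdivrMr; last by rewrite mulr_gt0 //; lra.
  by rewrite mulrA divfK ?pnatr_eq0 // mulrC ler_pM2l //; lra.
rewrite mulrDr in h6; lra.
Qed.

End Analytic.

Arguments origin {R}.
(** * Complex polynomials in one variable *)

Section ComplexPolynomials.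
Variable R : realType.
Local Notation C := R[i].
Implicit Types (p q : {poly C}) (s : seq C).

Lemma poly_disc_bound p (r : R) :
  exists2 K : R, 0 <= K & forall y, cmod y <= r -> cmod p.[y] <= K.
Proof.
elim/poly_ind: p => [|p c [K K0 hK]].
  by exists 0 => // y _; rewrite horner0 cmod0.
exists (K * `|r| + cmod c); first by rewrite addr_ge0 ?mulr_ge0 ?cmod_ge0.
move=> y hy; rewrite !hornerE; apply: le_trans (cmodD _ _) _; rewrite lerD2r cmodM.
apply: ler_pM; rewrite ?cmod_ge0 //; first exact: hK.
exact: le_trans hy (ler_norm r).
Qed.

Lemma poly_continuous p (a : C) (e : R) : 0 < e ->
  exists2 d : R, 0 < d & forall y, cmod (y - a) <= d -> cmod (p.[y] - p.[a]) <= e.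
Proof.
move=> e0.
have /factor_theorem[q hq] : root (p - p.[a]%:P) a by rewrite rootE !hornerE subrr.
have [K K0 hK] := poly_disc_bound q (cmod a + 1).
have K1 : 0 < K + 1 by lra.
exists (Num.min 1 (e / (K + 1))); first by rewrite lt_min ltr01 divr_gt0.
move=> y; rewrite le_min => /andP[y1 ye].
have -> : p.[y] - p.[a] = q.[y] * (y - a).
  by have /(congr1 (fun u => u.[y])) := hq; rewrite !hornerE.
rewrite cmodM; apply: le_trans (_ : (K + 1) * (e / (K + 1)) <= _).
  apply: ler_pM; rewrite ?cmod_ge0 //; apply: le_trans (hK y _) _; last by lra.
  by have := cmodD (y - a) a; rewrite subrK; lra.
by rewrite mulrC divfK // gt_eqF.
Qed.

Definition root_poly s : {poly C} := \prod_(a <- s) ('X - a%:P).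

(** Each root of the split polynomial is a root of [p]. After division of both
    by the corresponding linear factor the bound persists away from the root,
    and at the root itself by continuity. *)
Lemma root_poly_dvd s p (d K : R) : 0 <= K -> (forall a, a \in s -> cmod a < d) ->
  (forall y, cmod y <= d -> cmod p.[y] <= K * cmod (root_poly s).[y]) ->
  root_poly s %| p.
Proof.
move=> K0; elim: s p => [|a s IH] p hs hp.
  by rewrite /root_poly big_nil dvd1p.
have ha : cmod a < d by apply: hs; rewrite mem_head.
have rpE y : (root_poly (a :: s)).[y] = (y - a) * (root_poly s).[y].
  by rewrite /root_poly big_cons !hornerE.
have /factor_theorem[q hq] : root p a.
  have := hp a (ltW ha); rewrite rpE subrr mul0r cmod0 mulr0 => h.
  by rewrite rootE -cmod_eq0 eq_le h cmod_ge0.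
have hqy y : cmod y <= d -> y != a -> cmod q.[y] <= K * cmod (root_poly s).[y].
  move=> yd ya; have := hp y yd; rewrite rpE hq !hornerE !cmodM.
  by rewrite [X in X <= _]mulrC mulrCA ler_pM2l // cmod_gt0 subr_eq0.
rewrite /root_poly big_cons hq mulrC dvdp_mul2r ?polyXsubC_eq0 //.
apply: IH => [b hb|y yd]; first by apply: hs; rewrite in_cons hb orbT.
have [->|/hqy] := eqVneq y a; last exact.
apply/ler_addgt0Pr => e e0; have K1 : 0 < K + 1 by lra.
have e20 : 0 < e / 2 by lra.
have e30 : 0 < e / (2 * (K + 1)) by rewrite divr_gt0 // mulr_gt0.
have [t t0 ht] := poly_continuous q a e20.
have [u u0 hu] := poly_continuous (root_poly s) a e30.
pose v := Num.min (d - cmod a) (Num.min t u).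
have v0 : 0 < v by rewrite !lt_min t0 u0 subr_gt0 ha.
have vt : v <= t by rewrite !ge_min lexx !orbT.
have vu : v <= u by rewrite !ge_min lexx !orbT.
have vd : v <= d - cmod a by rewrite !ge_min lexx.
pose y1 := a + v%:C.
have y1a : y1 - a = v%:C by rewrite /y1 addrC addKr.
have cv : cmod (y1 - a) = v by rewrite y1a cmod_real gtr0_norm.
have h1 : cmod q.[y1] <= K * cmod (root_poly s).[y1].
  apply: hqy; first by have := cmodD a v%:C; rewrite cmod_real gtr0_norm // -/y1; lra.
  by rewrite -subr_eq0 -cmod_gt0 cv.
have h2 : cmod (q.[y1] - q.[a]) <= e / 2 by apply: ht; rewrite cv.
have h3 : cmod ((root_poly s).[y1] - (root_poly s).[a]) <= e / (2 * (K + 1)).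
  by apply: hu; rewrite cv.
have h4 := cmodB_ge q.[a] q.[y1]; rewrite cmodBC in h4.
have h5 := cmodB_ge (root_poly s).[y1] (root_poly s).[a].
have h6 : K * cmod (root_poly s).[y1] <= K * (cmod (root_poly s).[a] + e / (2 * (K + 1))).
  by apply: ler_wpM2l => //; lra.
have h7 : K * (e / (2 * (K + 1))) <= e / 2.
  rewrite mulrA ler_pdivrMr ?mulr_gt0 //.
  by rewrite mulrA divfK ?pnatr_eq0 // mulrC ler_pM2l //; lra.
rewrite mulrDr in h6; lra.
Qed.

Lemma root_poly_nseq0 k : root_poly (nseq k 0) = 'X^k.
Proof.
rewrite /root_poly; elim: k => [|k IH]; first by rewrite big_nil.
by rewrite /= big_cons subr0 IH exprS.
Qed.

Lemma monic_split p : p \is monic -> exists s, p = root_poly s.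
Proof.
move=> /monicP lp; have [s hs] := closed_field_poly_normal p.
by exists s; rewrite hs lp scale1r.
Qed.

End ComplexPolynomials.

(** * The Weierstrass division and preparation theorems *)

Section Weierstrass.
Variable R : realType.
Local Notation C := R[i].
Local Notation pnt := (nat -> C).
Implicit Types (rho : nat -> R) (z w : pnt) (f g : pnt -> C).

Lemma csum_recl_iter (a : nat -> C) d s :
  csum (fun k => a (k + d)%N) s -> csum a (\sum_(k < d) a k + s).
Proof.
elim: d a s => [|d IH] a s h.
  by rewrite big_ord0 add0r; apply: clim_ext h => N; under eq_bigr do rewrite addn0.
rewrite big_ord_recl -addrA; apply: csum_recl; apply: (IH (fun k => a k.+1)).
by apply: clim_ext h => N; under eq_bigr do rewrite addnS.
Qed.

Lemma ps_geometric m rho (K t : R) (fs : nat -> pnt -> C) : (forall i, 0 < rho i) ->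
  0 <= t -> t < 1 -> (forall j, power_series m rho (K * t ^+ j) (fs j)) ->
  exists2 f, power_series m rho (K * (1 - t)^-1) f &
    forall z, polydisc m rho z -> csum (fs^~ z) (f z).
Proof.
move=> r0 t0 t1 h.
have K0 : 0 <= K by have := ps_ge0 (h 0%N); rewrite expr0 mulr1.
have hM J : \sum_(j < J) K * t ^+ j <= K * (1 - t)^-1.
  by rewrite -mulr_sumr; apply: ler_wpM2l => //; apply: geometric_sum.
have : forall z, exists s, polydisc m rho z -> csum (fs^~ z) s.
  move=> z; case: (pselect (polydisc m rho z)) => hz; last by exists 0.
  have [s hs] := dominated_csum (fun j => ps_bound (h j) hz) hM.
  by exists s.
move=> /choice[f hf]; exists f => //; exact: ps_infinite_sum r0 h hM hf.
Qed.

Lemma ps_expansion m rho M g : (forall i, 0 < rho i) -> power_series m.+1 rho M g ->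
  exists G : nat -> pnt -> C,
  [/\ forall k, power_series m rho (M / rho m ^+ k) (G k),
      forall z, polydisc m.+1 rho z -> csum (fun k => G k z * z m ^+ k) (g z)
    & forall d, exists2 q : pnt -> C, power_series m.+1 rho (M / rho m ^+ d) q &
        forall z, polydisc m.+1 rho z ->
          g z = \sum_(k < d) G k z * z m ^+ k + q z * z m ^+ d].
Proof.
move=> r0 [G [B [h1 h2 h3]]].
have rk k : 0 < rho m ^+ k by rewrite exprn_gt0.
have B0 k : 0 <= B k := ps_ge0 (h1 k).
exists G; split=> [k|z /h3 //|d].
  apply: ps_le (h1 k); rewrite ler_pdivlMr //; apply: le_trans (h2 k.+1).
  rewrite big_ord_recr /= lerDr; apply: sumr_ge0 => i _.
  exact: mulr_ge0 (B0 _) (ltW (rk _)).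
have hM K : \sum_(k < K) B (k + d)%N * rho m ^+ k <= M / rho m ^+ d.
  rewrite ler_pdivlMr // mulr_suml; apply: le_trans (h2 (d + K)%N).
  rewrite big_split_ord /=; apply: le_trans (_ : \sum_(i < K) B (d + i)%N * rho m ^+ (d + i) <= _).
    by apply: ler_sum => k _; rewrite -mulrA -exprD addnC.
  by rewrite lerDr; apply: sumr_ge0 => k _; apply: mulr_ge0 (B0 _) (ltW (rk _)).
have bnd z k : polydisc m.+1 rho z ->
    cmod (G (k + d)%N z * z m ^+ k) <= B (k + d)%N * rho m ^+ k.
  move=> hz; rewrite cmodM cmodX.
  apply: ler_pM; [exact: cmod_ge0 | by rewrite exprn_ge0 ?cmod_ge0 | |].
    exact: ps_bound (h1 _) (polydiscS hz).
  exact: lerXl (cmod_ge0 _) (hz m (ltnSn m)).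
have : forall z, exists s, polydisc m.+1 rho z ->
    csum (fun k => G (k + d)%N z * z m ^+ k) s.
  move=> z; case: (pselect (polydisc m.+1 rho z)) => hz; last by exists 0.
  have [s hs] := dominated_csum (fun k => bnd z k hz) hM.
  by exists s.
move=> /choice[q hq]; exists q => [|z hz].
- by exists (fun k => G (k + d)%N), (fun k => B (k + d)%N); split=> // k; apply: h1.
- apply: clim_uniq (h3 z hz) _.
  apply: (@csum_recl_iter (fun k => G k z * z m ^+ k)).
  rewrite mulrC; apply: clim_ext (csumZ (z m ^+ d) (hq z hz)) => N.
  by apply: eq_bigr => k _; rewrite exprD; ring.
Qed.

(** Division by a function which differs little from a power of the last
    coordinate [y]. Dividing by [y ^+ d] instead leaves a remainder that is
    smaller by the factor [t]; the corrections form a geometric series. *)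
Lemma ps_division m rho (t : R) d F g M : (forall i, 0 < rho i) -> 0 <= t -> t < 1 ->
  power_series m.+1 rho (t * rho m ^+ d) (fun z => F z - z m ^+ d) ->
  power_series m.+1 rho M g ->
  exists (r : nat -> pnt -> C) (q : pnt -> C) (Mr : nat -> R) (Mq : R),
  [/\ forall k, power_series m rho (Mr k) (r k),
      power_series m.+1 rho Mq q
    & forall z, polydisc m.+1 rho z ->
        g z = q z * F z + \sum_(k < d) r k z * z m ^+ k].
Proof.
move=> r0 t0 t1 hE hg.
have rk k : 0 < rho m ^+ k by rewrite exprn_gt0.
pose E z := F z - z m ^+ d.
have : forall gj : (pnt -> C) * nat, exists rq : (nat -> pnt -> C) * (pnt -> C),
    power_series m.+1 rho (M * t ^+ gj.2) gj.1 ->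
    [/\ forall k, power_series m rho (M * t ^+ gj.2 / rho m ^+ k) (rq.1 k),
        power_series m.+1 rho (M * t ^+ gj.2 / rho m ^+ d) rq.2
      & forall z, polydisc m.+1 rho z ->
        gj.1 z = \sum_(k < d) rq.1 k z * z m ^+ k + rq.2 z * z m ^+ d].
  move=> [f j] /=; case: (pselect (power_series m.+1 rho (M * t ^+ j) f)) => [hf|nf].
    have [r [h1 _ h3]] := ps_expansion r0 hf; have [q hq1 hq2] := h3 d.
    by exists (r, q).
  by exists (fun _ => f, f) => /nf.
move=> /choice[S hS].
pose G := fix G j : pnt -> C := if j is j'.+1 then
  fun z => - ((S (G j', j')).2 z * E z) else g.
have hG j : power_series m.+1 rho (M * t ^+ j) (G j).
  elim: j => [|j IH]; first by rewrite expr0 mulr1.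
  have [_ hq _] := hS (G j, j) IH.
  have hN : power_series m.+1 rho (cmod (-1 : C)) (fun=> -1) by apply: ps_cst.
  have := ps_mul r0 hN (ps_mul r0 hq hE).
  have -> : cmod (-1 : C) * (M * t ^+ j / rho m ^+ d * (t * rho m ^+ d)) = M * t ^+ j.+1.
    rewrite cmodN cmod1 exprSr; have := rk d; move: (rho m ^+ d) => u u0.
    by field; rewrite gt_eqF.
  by apply: ps_ext => z _; rewrite mulN1r.
pose r j := (S (G j, j)).1; pose q j := (S (G j, j)).2.
have hr j k : power_series m rho (M / rho m ^+ k * t ^+ j) (r j k).
  by rewrite mulrAC; have [h _ _] := hS (G j, j) (hG j).
have hq j : power_series m.+1 rho (M / rho m ^+ d * t ^+ j) (q j).
  by rewrite mulrAC; have [_ h _] := hS (G j, j) (hG j).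
have step j z : polydisc m.+1 rho z ->
    q j z * F z + \sum_(k < d) r j k z * z m ^+ k = G j z - G j.+1 z.
  move=> hz; have [_ _ h] := hS (G j, j) (hG j).
  by have /= -> := h z hz; rewrite -/(r j) -/(q j) /E; ring.
have [Q hQ1 hQ2] := ps_geometric r0 t0 t1 hq.
have /choice[rr hrr] : forall k, exists f,
    power_series m rho (M / rho m ^+ k * (1 - t)^-1) f /\
    forall z, polydisc m rho z -> csum (fun j => r j k z) (f z).
  by move=> k; have [f h1 h2] := ps_geometric r0 t0 t1 (fun j => hr j k); exists f.
have [T hT1 hT2] := ps_geometric r0 t0 t1 hG.
exists rr, Q, (fun k => M / rho m ^+ k * (1 - t)^-1), (M / rho m ^+ d * (1 - t)^-1).
split=> // [k|z hz]; first by case: (hrr k).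
have sumG : csum (fun j => G j z - G j.+1 z) (g z).
  have [s hs] : exists s, csum (fun j => G j.+1 z) s.
    apply: (dominated_csum (B := fun j => M * t ^+ j.+1) (M := M * (1 - t)^-1)) => [j|K].
      exact: ps_bound (hG _) hz.
    have M0 := ps_ge0 hg; rewrite -mulr_sumr; apply: ler_wpM2l => //.
    apply: le_trans (geometric_sum K.+1 t0 t1); rewrite big_ord_recl /= lerDr.
    by rewrite expr0 ler01.
  have e : T z = g z + s by apply: clim_uniq (hT2 z hz) (csum_recl hs).
  have -> : g z = T z + (-1) * s by rewrite e; ring.
  by apply: clim_ext (csumD (hT2 z hz) (csumZ (-1) hs)) => N; apply: eq_bigr => j _; ring.
apply: clim_uniq sumG _.
have hsr : csum (fun j => \sum_(k < d) r j k z * z m ^+ k) (\sum_(k < d) rr k z * z m ^+ k).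
  have -> : \sum_(k < d) rr k z * z m ^+ k = \sum_(k < d) z m ^+ k * rr k z.
    by apply: eq_bigr => k _; rewrite mulrC.
  have hk (k : 'I_d) : csum (fun j => z m ^+ k * r j k z) (z m ^+ k * rr k z).
    by apply: csumZ; case: (hrr k) => _; apply; apply: polydiscS.
  apply: clim_ext (clim_sum (index_enum (ordinal d)) hk) => N.
  by rewrite exchange_big; apply: eq_bigr => j _; apply: eq_bigr => k _; rewrite mulrC.
have hsq : csum (fun j => q j z * F z) (Q z * F z).
  rewrite mulrC; apply: clim_ext (csumZ (F z) (hQ2 z hz)) => N.
  by apply: eq_bigr => j _; rewrite mulrC.
by apply: clim_ext (csumD hsq hsr) => N; apply: eq_bigr => j _; rewrite step.
Qed.

Definition axis m (y : C) : pnt := fun i => if i == m then y else 0.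

Lemma axis_last m y : axis m y m = y.
Proof. by rewrite /axis eqxx. Qed.

Lemma axis0 m : axis m 0 = fun=> 0.
Proof. by apply/funext => i; rewrite /axis; case: eqP. Qed.

Lemma near_axis m (P : pnt -> Prop) : (\forall z \near origin, P z) ->
  exists2 d : R, 0 < d & forall y, cmod y <= d -> P (axis m y).
Proof.
move=> [d d0 h]; exists d => // y hy; apply: h => i; rewrite /axis.
by case: eqP => // _; rewrite cmod0 ltW.
Qed.

Lemma analytic_axis m f y : analytic m f -> f (axis m y) = f (fun=> 0).
Proof.
move=> [r [M [r0 h]]]; apply/esym; apply: ps_local h _ _ => [|i hi].
  by move=> i _; rewrite cmod0 ltW.
by rewrite /axis ltn_eqF.
Qed.

(** [f] is regular of order [d] in its last variable: on the axis it is [y ^+ d]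
    times a function that does not vanish at the origin. *)
Definition regular m d f : Prop :=
  exists (c : nat -> pnt -> C) (v : pnt -> C),
  [/\ forall k, analytic m (c k) /\ c k (fun=> 0) = 0,
      analytic m.+1 v, v (fun=> 0) != 0
    & \forall z \near origin, f z = \sum_(k < d) c k z * z m ^+ k + v z * z m ^+ d].

Lemma regular_exists m f : analytic m.+1 f ->
  ~ (exists2 d : R, 0 < d & forall y, cmod y <= d -> f (axis m y) = 0) ->
  exists d, regular m d f.
Proof.
move=> [r [M [r0 h]]] nz; have hr : forall _ : nat, 0 < r by [].
have [G [h1 h2 h3]] := ps_expansion hr h.
have axP y : cmod y <= r -> polydisc m.+1 (fun=> r) (axis m y).
  by move=> hy i _; rewrite /axis; case: eqP => // _; rewrite cmod0 ltW.
have aG k : analytic m (G k) by exists r, (M / r ^+ k).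
have /existsNP[k0 /eqP hk0] : ~ forall k, G k (fun=> 0) = 0.
  move=> hG; apply: nz; exists r => // y hy.
  apply: clim_uniq (h2 _ (axP y hy)) _; apply: clim_ext (@clim_cst _ 0) => N.
  by rewrite big1 // => k _; rewrite (analytic_axis y (aG k)) hG mul0r.
have exk : exists k, G k (fun=> 0) != 0 by exists k0.
case: (ex_minnP exk) => d hd dmin.
have [q hq hf] := h3 d.+1.
exists d, (fun k => if (k < d)%N then G k else fun=> 0), (fun z => G d z + q z * z m).
split=> [k|||].
- case: ltnP => kd; last by split=> //; apply: analytic_cst.
  split=> //; apply/eqP; rewrite -[_ == 0]negbK; apply/negP => /dmin.
  by rewrite leqNgt kd.
- apply: analyticD; first exact: analytic_embed.
  by apply: analyticM; [exists r, (M / r ^+ d.+1) | apply: analytic_coord].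
- by rewrite mulr0 addr0.
- exists r => // z hz; rewrite hf; last by move=> i _.
  rewrite big_ord_recr /= exprS mulrDl addrA !mulrA.
  by congr (_ + _ + _); apply: eq_bigr => k _; rewrite ltn_ord.
Qed.

Lemma ps_analytic m rho M f (s : R) : 0 < s -> (forall i, s <= rho i) ->
  power_series m rho M f -> analytic m f.
Proof.
move=> s0 hs h; exists s, M; split=> //; apply: ps_shrink h => i _.
by rewrite ltW //= hs.
Qed.

(** On a suitable polydisc a regular function, divided by its leading value,
    differs little from a power of the last variable. *)
Theorem regular_division m d f g : regular m d f -> analytic m.+1 g ->
  exists (q : pnt -> C) (r : nat -> pnt -> C),
  [/\ analytic m.+1 q, forall k, analytic m (r k)
    & \forall z \near origin, g z = q z * f z + \sum_(k < d) r k z * z m ^+ k].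
Proof.
move=> [c [v [hc hv v0 hf]]] hg.
pose v0i := (v (fun=> 0))^-1.
pose w z := v0i * v z.
have hw : analytic m.+1 w by apply: analyticM (analytic_cst _ _) hv.
have w0 : w (fun=> 0) = 1 by rewrite /w mulVf.
have e40 : 0 < (1 / 4 : R) by lra.
have [s1 s10 hs1] := analytic_center hw e40.
have [s2 s20 hs2] := analytic_shrink hg.
pose s := Num.min s1 s2.
have s0 : 0 < s by rewrite lt_min s10.
have sd k : 0 < s ^+ k by rewrite exprn_gt0.
have [Mw Mw4 psw] : exists2 M, M <= 1 / 4 & power_series m.+1 (fun=> s) M (fun z => w z - 1).
  by rewrite -w0; apply: hs1 => //; rewrite ge_min lexx.
have [Mg psg] : exists M, power_series m.+1 (fun=> s) M g.
  by apply: hs2 => //; rewrite ge_min lexx orbT.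
(* The radius of y is fixed first; then the other radii are chosen so small
   that the lower coefficients have little weight. *)
pose e k : R := s ^+ d / (4 * d.+1%:R) / s ^+ k.
have d10 : 0 < 4 * d.+1%:R :> R by rewrite mulr_gt0 ?ltr0n.
have e0 k : 0 < e k by rewrite !divr_gt0.
have /choice[S hS] : forall k, exists t, 0 < t /\ forall r, 0 < r -> r <= t ->
    power_series m (fun=> r) (e k) (fun z => v0i * c k z).
  move=> k; have [ck ck0] := hc k.
  have [t t0 ht] := analytic_center (analyticM (analytic_cst m v0i) ck) (e0 k).
  exists t; split=> // r r0 rt; have [M Me] := ht r r0 rt; move/(ps_le Me).
  by apply: ps_ext => z _; rewrite ck0 mulr0 subr0.
have [k|t t0 ht] := @finite_lower_bound _ S d; first by case: (hS k).
pose u := Num.min s t.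
have u0 : 0 < u by rewrite lt_min s0.
have us : u <= s by rewrite ge_min lexx.
pose rho i := if i == m then s else u.
have rho_m : rho m = s by rewrite /rho eqxx.
have rho0 i : 0 < rho i by rewrite /rho; case: ifP.
have rho_u i : u <= rho i by rewrite /rho; case: ifP.
have rho_s i : (i < m.+1)%N -> 0 <= rho i <= s.
  by move=> _; rewrite ltW //= /rho; case: ifP.
pose F z := z m ^+ d + (\sum_(k < d) v0i * c k z * z m ^+ k + (w z - 1) * z m ^+ d).
have hE : power_series m.+1 rho (1 / 2 * rho m ^+ d) (fun z => F z - z m ^+ d).
  apply: (@ps_le _ _ _ (\sum_(k < d) e k * rho m ^+ k + 1 / 4 * rho m ^+ d)).
    rewrite rho_m; apply: le_trans (_ : 1 / 4 * s ^+ d + 1 / 4 * s ^+ d <= _); last by lra.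
    rewrite lerD2r; apply: le_trans (_ : \sum_(k < d) s ^+ d / (4 * d.+1%:R) <= _).
      by apply: ler_sum => k _; rewrite /e divfK ?gt_eqF.
    rewrite sumr_const card_ord -(mulr_natr _ d) mulrAC ler_pdivrMr //.
    have -> : 1 / 4 * s ^+ d * (4 * d.+1%:R) = s ^+ d * d.+1%:R by field.
    by rewrite ler_pM2l // ler_nat.
  have hsum : power_series m.+1 rho (\sum_(k < d) e k * rho m ^+ k)
      (fun z => \sum_(k < d) v0i * c k z * z m ^+ k).
    apply: (@ps_sum _ _ _ _ (fun k => e k * rho m ^+ k) (fun k z => v0i * c k z * z m ^+ k)) => k kd.
    apply: ps_monomial => //; case: (hS k) => _ h.
    have ut : u <= S k by apply: le_trans (ht k kd); rewrite ge_min lexx orbT.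
    by apply: ps_shrink (h u u0 ut) => i im; rewrite /rho ltn_eqF // ltW //= lexx.
  have hw4 := ps_mulX d rho0 (ps_le Mw4 (ps_shrink rho_s psw)).
  by apply: ps_ext (ps_add hsum hw4) => z _; rewrite /F; ring.
have t0' : 0 <= (1 / 2 : R) by lra.
have t1' : (1 / 2 : R) < 1 by lra.
have [r [q [Mr [Mq [hr hq hg']]]]] := ps_division rho0 t0' t1' hE (ps_shrink rho_s psg).
exists (fun z => q z * v0i), r; split.
- by apply: analyticM (analytic_cst _ _); apply: ps_analytic u0 rho_u hq.
- by move=> k; apply: ps_analytic u0 rho_u (hr k).
- apply: filterS (filterI (origin_small u0) hf) => z [hz fz].
  rewrite hg'; last by move=> i _; apply: le_trans (hz i) (rho_u i).
  congr (_ + _); rewrite -mulrA; congr (_ * _).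
  rewrite fz mulrDr mulr_sumr /F /w.
  under eq_bigr => k _ do rewrite -mulrA.
  by ring.
Qed.

End Weierstrass.
Section Preparation.
Variable R : realType.
Local Notation C := R[i].
Local Notation pnt := (nat -> C).
Implicit Types (z w : pnt) (f g : pnt -> C).

(** Dividing [y ^+ d] by [f] gives a quotient [q] and a remainder of degree less
    than [d]. The remainder vanishes at the origin of the parameters, which makes
    [q] a unit; then [f] is [q^-1] times [y ^+ d] minus the remainder. *)
Theorem regular_preparation m d f : regular m d f ->
  exists (u : pnt -> C) (r : nat -> pnt -> C),
  [/\ analytic m.+1 u, u (fun=> 0) != 0,
      forall k, analytic m (r k) /\ r k (fun=> 0) = 0
    & \forall z \near origin, f z = u z * (z m ^+ d + \sum_(k < d) r k z * z m ^+ k)].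
Proof.
move=> hreg; have [c [v [hc hv v0 hf]]] := hreg.
have [q [r [hq hr hg]]] := regular_division hreg (analyticX d (analytic_coord R (ltnSn m))).
have hqv := analyticM hq hv.
have [K K0 hK] := analytic_bounded (analyticB (analytic_cst m.+1 1) hqv).
have ax : \forall z \near origin, forall y, z = axis m y ->
    (1 - q z * v z) * y ^+ d = \sum_(k < d) r k (fun=> 0) * y ^+ k.
  apply: filterS (filterI hf hg) => z [fz gz] y ez.
  have zm : z m = y by rewrite ez axis_last.
  rewrite zm in gz fz.
  have fz1 : f z = v z * y ^+ d.
    rewrite fz big1 ?add0r // => k _.
    by have [a b] := hc k; rewrite ez (analytic_axis y a) b mul0r.
  have <- : \sum_(k < d) r k z * y ^+ k = \sum_(k < d) r k (fun=> 0) * y ^+ k.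
    by apply: eq_bigr => k _; rewrite ez (analytic_axis y (hr k)).
  have -> : \sum_(k < d) r k z * y ^+ k = y ^+ d - q z * f z.
    by apply/eqP; rewrite eq_sym subr_eq addrC -gz.
  by rewrite fz1; ring.
(* The remainder of y ^+ d is O(y ^+ d) on the axis, hence zero there. *)
have [e e0 hax] := near_axis m (filterI ax hK).
pose p : {poly C} := \poly_(k < d) r k (fun=> 0).
have hp y : p.[y] = \sum_(k < d) r k (fun=> 0) * y ^+ k by rewrite horner_poly.
have p0 : p = 0.
  have dv : root_poly (nseq d 0) %| p.
    apply: (root_poly_dvd (d := e) K0) => [a|y hy].
      by rewrite mem_nseq => /andP[_ /eqP ->]; rewrite cmod0.
    have [h1 h2] := hax y hy; rewrite hp -(h1 y erefl) cmodM root_poly_nseq0 hornerXn.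
    by apply: ler_wpM2r; rewrite ?cmod_ge0.
  apply/eqP; rewrite -[_ == 0]negbK; apply/negP => /dvdp_leq/(_ dv).
  by rewrite root_poly_nseq0 size_polyXn ltnNge size_poly.
have r0 k : (k < d)%N -> r k (fun=> 0) = 0.
  by move=> kd; have := congr1 (fun s : {poly C} => s`_k) p0; rewrite coef_poly kd coef0.
have qv1 : q (fun=> 0) * v (fun=> 0) = 1.
  apply/eqP; rewrite -subr_eq0; apply/eqP/cmod_small => t t0.
  have [s s0 hs] := near_axis m (analytic_cvg0 hqv t0).
  pose y : C := (Num.min s e)%:C.
  have my0 : 0 < Num.min s e by rewrite lt_min s0.
  have cy : cmod y = Num.min s e by rewrite cmod_real gtr0_norm.
  have ys : cmod y <= s by rewrite cy ge_min lexx.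
  have ye : cmod y <= e by rewrite cy ge_min lexx orbT.
  have y0 : y != 0 by rewrite -cmod_gt0 cy.
  have [h1 _] := hax y ye; have := h1 y erefl.
  rewrite big1 => [|k _]; last by rewrite r0 ?mul0r.
  move=> /eqP; rewrite mulf_eq0 expf_eq0 (negbTE y0) andbF orbF subr_eq0 => /eqP qv.
  by rewrite cmodBC qv; apply: hs.
have q0 : q (fun=> 0) != 0.
  by apply/eqP => q0; move: qv1; rewrite q0 mul0r => /esym/eqP; rewrite oner_eq0.
exists (fun z => (q z)^-1), (fun k z => if (k < d)%N then - r k z else 0); split.
- exact: analytic_inv.
- by rewrite invr_eq0.
- move=> k; case: ltnP => kd; last by split=> //; apply: analytic_cst.
  by split; [apply: analyticN | rewrite r0 ?oppr0].
- apply: filterS (filterI hg (analytic_neq0 hq q0)) => z [gz qz].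
  apply: (mulfI qz); rewrite mulrA divff // mul1r gz -[LHS]addr0 -addrA; congr (_ + _).
  apply/esym/eqP; rewrite addr_eq0 -sumrN; apply/eqP; apply: eq_bigr => k _.
  by rewrite ltn_ord mulNr opprK.
Qed.

End Preparation.

(** * The ring of germs of analytic functions at the origin *)

Section Germs.
Variables (R : realType) (m : nat).
Local Notation C := R[i].
Local Notation pnt := (nat -> C).
Implicit Types (z : pnt) (f g : pnt -> C).

(** A germ is the class of all the functions that agree near the origin with a
    given analytic one, so that equality of germs is Leibniz equality. *)
Record germ : Type := Germ {
  germ_set : set (pnt -> C);
  germ_ax : exists2 f, analytic m f & germ_set = [set g | \forall z \near origin, g z = f z]
}.

Definition rep (a : germ) : pnt -> C := projT1 (cid2 (germ_ax a)).

Lemma rep_analytic a : analytic m (rep a).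
Proof. by rewrite /rep; case: cid2. Qed.

Lemma germ_setE a : germ_set a = [set g | \forall z \near origin, g z = rep a z].
Proof. by rewrite /rep; case: cid2. Qed.

Lemma germ_inj a b : (\forall z \near origin, rep a z = rep b z) -> a = b.
Proof.
move=> h; have : germ_set a = germ_set b.
  rewrite !germ_setE; apply/seteqP; split=> g /= hg; apply: filterS2 h hg => z e1 e2.
    by rewrite e2.
  by rewrite e2.
case: a b {h} => s hs [t ht] /= e; case: _ / e in ht *.
by congr Germ; apply: Prop_irrelevance.
Qed.

Definition mkgerm f : germ :=
  if pselect (analytic m f) is left h then Germ (ex_intro2 _ _ f h erefl)
  else Germ (ex_intro2 _ _ _ (analytic_cst m 0) erefl).

Lemma mkgermK f : analytic m f -> \forall z \near origin, rep (mkgerm f) z = f z.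
Proof.
move=> hf; have : germ_set (mkgerm f) f.
  by rewrite /mkgerm; case: pselect => // h /=; apply: filterE.
by rewrite germ_setE /=; apply: filterS => z.
Qed.

Lemma mkgerm_eq f g : analytic m f -> analytic m g ->
  (\forall z \near origin, f z = g z) -> mkgerm f = mkgerm g.
Proof.
move=> hf hg h; apply: germ_inj.
by apply: filterS3 (mkgermK hf) (mkgermK hg) h => z -> ->.
Qed.

Lemma germP a : exists2 f, analytic m f & a = mkgerm f.
Proof.
exists (rep a); first exact: rep_analytic.
by apply: germ_inj; apply: filterS (mkgermK (rep_analytic a)) => z ->.
Qed.

HB.instance Definition _ := gen_eqMixin germ.
HB.instance Definition _ := gen_choiceMixin germ.

Let addg a b := mkgerm (fun z => rep a z + rep b z).
Let mulg a b := mkgerm (fun z => rep a z * rep b z).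
Let oppg a := mkgerm (fun z => - rep a z).

Let addgE f g : analytic m f -> analytic m g ->
  addg (mkgerm f) (mkgerm g) = mkgerm (fun z => f z + g z).
Proof.
move=> hf hg; apply: mkgerm_eq; [by apply: analyticD; apply: rep_analytic | exact: analyticD |].
by apply: filterS2 (mkgermK hf) (mkgermK hg) => z -> ->.
Qed.

Let mulgE f g : analytic m f -> analytic m g ->
  mulg (mkgerm f) (mkgerm g) = mkgerm (fun z => f z * g z).
Proof.
move=> hf hg; apply: mkgerm_eq; [by apply: analyticM; apply: rep_analytic | exact: analyticM |].
by apply: filterS2 (mkgermK hf) (mkgermK hg) => z -> ->.
Qed.

Let oppgE f : analytic m f -> oppg (mkgerm f) = mkgerm (fun z => - f z).
Proof.
move=> hf; apply: mkgerm_eq; [by apply: analyticN; apply: rep_analytic | exact: analyticN |].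
by apply: filterS (mkgermK hf) => z ->.
Qed.

Let addgA : associative addg.
Proof.
move=> a b c; have [f hf ->] := germP a; have [g hg ->] := germP b; have [h hh ->] := germP c.
rewrite !addgE //; [|exact: analyticD..].
by congr mkgerm; apply/funext => z; rewrite addrA.
Qed.

Let addgC : commutative addg.
Proof. by move=> a b; congr mkgerm; apply/funext => z; rewrite addrC. Qed.

Let add0g : left_id (mkgerm (fun=> 0)) addg.
Proof.
move=> a; have [f hf ->] := germP a; rewrite addgE //; last exact: analytic_cst.
by congr mkgerm; apply/funext => z; rewrite add0r.
Qed.

Let addNg : left_inverse (mkgerm (fun=> 0)) oppg addg.
Proof.
move=> a; have [f hf ->] := germP a; rewrite oppgE // addgE //; last exact: analyticN.
by congr mkgerm; apply/funext => z; rewrite addNr.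
Qed.

HB.instance Definition _ := GRing.isZmodule.Build germ addgA addgC add0g addNg.

Let mulgA : associative mulg.
Proof.
move=> a b c; have [f hf ->] := germP a; have [g hg ->] := germP b; have [h hh ->] := germP c.
rewrite !mulgE //; [|exact: analyticM..].
by congr mkgerm; apply/funext => z; rewrite mulrA.
Qed.

Let mulgC : commutative mulg.
Proof. by move=> a b; congr mkgerm; apply/funext => z; rewrite mulrC. Qed.

Let mul1g : left_id (mkgerm (fun=> 1)) mulg.
Proof.
move=> a; have [f hf ->] := germP a; rewrite mulgE //; last exact: analytic_cst.
by congr mkgerm; apply/funext => z; rewrite mul1r.
Qed.

Let mulgDl : left_distributive mulg addg.
Proof.
move=> a b c; have [f hf ->] := germP a; have [g hg ->] := germP b; have [h hh ->] := germP c.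
rewrite addgE // !mulgE ?addgE //; [|exact: analyticM..|exact: analyticD].
by congr mkgerm; apply/funext => z; rewrite mulrDl.
Qed.

Let oneg_neq0 : mkgerm (fun=> 1) != 0.
Proof.
apply/eqP => /(congr1 rep) e.
have := origin0 (mkgermK (analytic_cst m (1 : C))); rewrite e.
rewrite (origin0 (mkgermK (analytic_cst m (0 : C)))) => /esym/eqP.
by rewrite oner_eq0.
Qed.

HB.instance Definition _ :=
  GRing.Zmodule_isComNzRing.Build germ mulgA mulgC mul1g mulgDl oneg_neq0.

Lemma rep0 : \forall z \near origin, rep 0 z = 0.
Proof. exact: mkgermK (analytic_cst m 0). Qed.

Lemma rep1 : \forall z \near origin, rep 1 z = 1.
Proof. exact: mkgermK (analytic_cst m 1). Qed.

Lemma repD (a b : germ) : \forall z \near origin, rep (a + b) z = rep a z + rep b z.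
Proof. exact: mkgermK (analyticD (rep_analytic a) (rep_analytic b)). Qed.

Lemma repM (a b : germ) : \forall z \near origin, rep (a * b) z = rep a z * rep b z.
Proof. exact: mkgermK (analyticM (rep_analytic a) (rep_analytic b)). Qed.

Lemma repMn (a : germ) n : \forall z \near origin, rep (a *+ n) z = rep a z *+ n.
Proof.
elim: n => [|n IH]; first by apply: filterS rep0 => z ->.
by apply: filterS2 (repD a (a *+ n)) IH => z h1 h2; rewrite !mulrS h1 h2.
Qed.

Lemma germ_eq0P (a : germ) : (\forall z \near origin, rep a z = 0) <-> a = 0.
Proof.
split=> [h|->]; last exact: rep0.
by apply: germ_inj; apply: filterS2 h rep0 => z -> ->.
Qed.

Let unitg : pred germ := fun a => rep a (fun=> 0) != 0.
Let invg a := if unitg a then mkgerm (fun z => (rep a z)^-1) else a.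

Let mulVg : {in unitg, left_inverse 1 invg *%R}.
Proof.
move=> a; rewrite unfold_in => ua; have -> : invg a = mkgerm (fun z => (rep a z)^-1) by rewrite /invg /unitg ua.
have ha := rep_analytic a; apply: germ_inj.
apply: filterS3 (repM (mkgerm (fun z => (rep a z)^-1)) a) (filterI (mkgermK (analytic_inv ha ua)) rep1)
  (analytic_neq0 ha ua) => z -> [-> ->] az.
by rewrite mulVf.
Qed.

Let unitgP : forall a b, b * a = 1 -> unitg a.
Proof.
move=> a b ab; apply/negP => /eqP a0.
have := origin0 (repM b a); rewrite ab (origin0 rep1) a0 mulr0 => /eqP.
by rewrite oner_eq0.
Qed.

Let invg_out : {in [predC unitg], invg =1 id}.
Proof. by move=> a; rewrite inE /= unfold_in /invg /unitg => /negbTE ->. Qed.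

HB.instance Definition _ := GRing.ComNzRing_hasMulInverse.Build germ mulVg unitgP invg_out.

Let mulg_eq0 (a b : germ) : a * b = 0 -> (a == 0) || (b == 0).
Proof.
move=> ab; have : \forall z \near origin, rep a z * rep b z = 0.
  by apply: filterS2 (repM a b) rep0 => z; rewrite ab => <-.
case/(analytic_integral (rep_analytic a) (rep_analytic b)) => /germ_eq0P ->; rewrite eqxx //.
by rewrite orbT.
Qed.

HB.instance Definition _ := GRing.ComUnitRing_isIntegral.Build germ mulg_eq0.

Lemma germ_pchar0 n : (n.+1%:R : germ) != 0.
Proof.
apply/eqP => h; have := origin0 (repMn 1 n.+1).
rewrite h (origin0 rep0) (origin0 rep1) => /esym/eqP; by rewrite pnatr_eq0.
Qed.

End Germs.
(** * Polynomials whose coefficients are germs *)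

Section GermPolynomials.
Variables (R : realType) (m : nat).
Local Notation C := R[i].
Local Notation pnt := (nat -> C).
Local Notation A := (germ R m).
Implicit Types (z : pnt) (f g : pnt -> C) (p q : {poly A}).

Definition pev z p : {poly C} := \poly_(i < size p) rep p`_i z.

Lemma near_forall_lt (P : nat -> pnt -> Prop) N :
  (forall i, \forall z \near origin, P i z) ->
  \forall z \near origin, forall i, (i < N)%N -> P i z.
Proof.
move=> h; elim: N => [|N IH]; first exact: filterE.
apply: filterS2 (h N) IH => z h1 h2 i; rewrite ltnS leq_eqVlt => /orP[/eqP -> //|].
exact: h2.
Qed.

Lemma pev_coef p : \forall z \near origin, forall i, (pev z p)`_i = rep p`_i z.
Proof.
apply: filterS (rep0 R m) => z h0 i; rewrite coef_poly; case: ltnP => // hi.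
by rewrite nth_default.
Qed.

(** Identities between germ polynomials hold near the origin as soon as they
    hold coefficientwise, since only finitely many coefficients matter. *)
Lemma pev_eq p N (F : pnt -> {poly C}) :
  (size p <= N)%N -> (\forall z \near origin, (size (F z) <= N)%N) ->
  (forall i, \forall z \near origin, rep p`_i z = (F z)`_i) ->
  \forall z \near origin, pev z p = F z.
Proof.
move=> sp sF h; apply: filterS3 (pev_coef p) (filterI (rep0 R m) (near_forall_lt N h)) sF.
move=> z e [e0 h1] s; apply/polyP => i; rewrite e; case: (ltnP i N) => hi; first exact: h1.
by rewrite nth_default ?(leq_trans sp) // e0 nth_default // (leq_trans s).
Qed.

Lemma size_pev z p : (size (pev z p) <= size p)%N.
Proof. exact: size_poly. Qed.

Lemma pevC (a : A) : \forall z \near origin, pev z a%:P = (rep a z)%:P.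
Proof.
apply: (pev_eq (N := 1%N)) => [||i]; first exact: size_polyC_leq1.
  by apply: filterE => z; apply: size_polyC_leq1.
rewrite coefC; case: eqP => [->|/eqP hi]; first by apply: filterE => z; rewrite coefC.
by apply: filterS (rep0 R m) => z ->; rewrite coefC (negbTE hi).
Qed.

Lemma pevD p q : \forall z \near origin, pev z (p + q) = pev z p + pev z q.
Proof.
apply: (pev_eq (N := maxn (size p) (size q))) => [||i]; first exact: size_polyD.
  apply: filterE => z; apply: leq_trans (size_polyD _ _) _.
  by rewrite geq_max !leq_max !size_pev ?orbT.
rewrite coefD; apply: filterS3 (repD p`_i q`_i) (pev_coef p) (pev_coef q) => z -> h1 h2.
by rewrite coefD h1 h2.
Qed.

Lemma pevZ (a : A) p : \forall z \near origin, pev z (a *: p) = rep a z *: pev z p.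
Proof.
apply: (pev_eq (N := size p)) => [||i]; first exact: size_scale_leq.
  by apply: filterE => z; apply: leq_trans (size_scale_leq _ _) (size_pev _ _).
by rewrite coefZ; apply: filterS2 (repM a p`_i) (pev_coef p) => z -> h; rewrite coefZ h.
Qed.

Lemma pev_mulX p : \forall z \near origin, pev z (p * 'X) = pev z p * 'X.
Proof.
have sX (S : nzRingType) (s : {poly S}) N : (size s <= N)%N -> (size (s * 'X)%R <= N.+1)%N.
  by move=> h; apply: leq_trans (size_polyMleq _ _) _; rewrite size_polyX addn2.
apply: (pev_eq (N := (size p).+1)) => [||i]; first exact: sX.
  by apply: filterE => z; apply/sX/size_pev.
rewrite coefMX; case: i => [|i] /=; first by apply: filterS (rep0 R m) => z ->; rewrite coefMX.
by apply: filterS (pev_coef p) => z h; rewrite coefMX /= h.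
Qed.

Lemma pevM p q : \forall z \near origin, pev z (p * q) = pev z p * pev z q.
Proof.
elim/poly_ind: p => [|p c IH].
  rewrite mul0r; apply: filterS2 (pevC 0) (rep0 R m) => z.
  by rewrite polyC0 => -> ->; rewrite polyC0 mul0r.
have -> : (p * 'X + c%:P) * q = p * q * 'X + c *: q.
  by rewrite mulrDl mul_polyC mulrAC.
apply: filterS3 (filterI (pevD (p * q * 'X) (c *: q)) (pevD (p * 'X) c%:P))
  (filterI (filterI (pev_mulX (p * q)) (pev_mulX p)) (filterI (pevZ c q) (pevC c))) IH.
move=> z [-> ->] [[-> ->] [-> ->]] ->.
by rewrite mulrDl mul_polyC mulrAC.
Qed.

Lemma pev_deriv p : \forall z \near origin, pev z p^`() = (pev z p)^`().
Proof.
apply: (pev_eq (N := size p)) => [||i]; first exact: leq_trans (size_poly _ _) (leq_pred _).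
  by apply: filterE => z; apply: leq_trans (leq_trans (size_poly _ _) (leq_pred _)) (size_pev _ _).
rewrite coef_deriv; apply: filterS2 (repMn p`_i.+1 i.+1) (pev_coef p) => z -> h.
by rewrite coef_deriv h.
Qed.

Lemma pev_monic p : p \is monic ->
  \forall z \near origin, pev z p \is monic /\ size (pev z p) = size p.
Proof.
move=> mp; have sp : (0 < size p)%N by rewrite size_poly_gt0 monic_neq0.
have lp : p`_(size p).-1 = 1 by have /monicP := mp.
apply: filterS (rep1 R m) => z h1.
have e : size (pev z p) = size p.
  by apply: size_poly_eq; rewrite lp h1 oner_eq0.
by split=> //; apply/monicP; rewrite lead_coefE e coef_poly prednK // leqnn lp.
Qed.

Lemma pev_analytic p : analytic m.+1 (fun z => (pev z p).[z m]).
Proof.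
apply: (@analytic_ext _ _ (fun z => \sum_(i < size p) rep p`_i z * z m ^+ i)) => [z|].
  by rewrite horner_poly.
apply: analytic_sum => i _; apply: analyticM; first exact/analytic_embed/rep_analytic.
by apply: analyticX; apply: analytic_coord.
Qed.

Definition upd z (y : C) : pnt := fun i => if i == m then y else z i.

Lemma upd_last z y : upd z y m = y.
Proof. by rewrite /upd eqxx. Qed.

Lemma upd_id z : upd z (z m) = z.
Proof. by apply/funext => i; rewrite /upd; case: eqP => [->|]. Qed.

Lemma pev_upd p : \forall z \near origin, forall y, pev (upd z y) p = pev z p.
Proof.
have h := near_forall_lt (size p) (fun i => analytic_local (rep_analytic p`_i)).
apply: filterS h => z hz y; apply/polyP => i; rewrite !coef_poly; case: ltnP => // hi.
by apply/esym/hz => // j hj; rewrite /upd ltn_eqF.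
Qed.

(** The bound on the last coordinate is chosen before the other coordinates, so
    that all the roots on one vertical line can be treated at once. *)
Lemma near_upd (P : pnt -> Prop) : (\forall z \near origin, P z) ->
  exists2 d : R, 0 < d & \forall z \near origin, forall y, cmod y <= d -> P (upd z y).
Proof.
move=> [d d0 h]; exists d => //; exists d => // z hz y hy; apply: h => i; rewrite /upd.
by case: eqP.
Qed.

Definition weierstrass (d : nat) (W : {poly A}) : Prop :=
  [/\ W \is monic, size W = d.+1 & pev (fun=> 0) W = 'X^d].

(** The lower coefficients vanish at the origin, so that for small parameters the
    leading term dominates the others where [y] is not small. *)
Lemma weierstrass_roots d W (e : R) : weierstrass d W -> 0 < e ->
  \forall z \near origin, forall y, root (pev z W) y -> cmod y < e.
Proof.
move=> [mW sW W0] e0.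
pose t := Num.min 1 e; have t0 : 0 < t by rewrite lt_min ltr01.
have t1 : t <= 1 by rewrite ge_min lexx.
have te : t <= e by rewrite ge_min lexx orbT.
pose eta := t ^+ d / (2 * d.+1%:R).
have eta0 : 0 < eta by rewrite divr_gt0 ?exprn_gt0 // mulr_gt0 ?ltr0n.
have hc : \forall z \near origin, forall i, (i < d)%N -> (i < d)%N -> cmod (rep W`_i z) <= eta.
  apply: near_forall_lt => i; have [hi|hi] := ltnP i d; last by apply: filterE.
  have Wi0 : rep W`_i (fun=> 0) = 0.
    by rewrite -(origin0 (pev_coef W)) W0 coefXn ltn_eqF.
  by apply: filterS (analytic_cvg0 (rep_analytic W`_i) eta0) => z; rewrite Wi0 subr0.
have lW : W`_d = 1 by have /monicP := mW; rewrite lead_coefE sW.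
apply: filterS2 (rep1 R m) hc => z z1 hz y.
rewrite rootE horner_poly sW big_ord_recr /= lW z1 mul1r addrC addr_eq0 => /eqP hy.
rewrite ltNge; apply/negP => ey; have ty := le_trans te ey.
have y0 : 0 < cmod y by apply: lt_le_trans ty.
have := congr1 (@cmod R) hy; rewrite cmodN cmodX => e1.
have : t ^+ d * cmod y ^+ d <= eta * (d%:R * cmod y ^+ d).
  rewrite {1}e1; apply: le_trans (ler_wpM2l _ (cmod_sum _ _ _)) _.
    by rewrite exprn_ge0 // ltW.
  rewrite mulr_sumr; apply: le_trans (_ : \sum_(i < d) eta * cmod y ^+ d <= _).
    apply: ler_sum => i _; rewrite cmodM cmodX mulrCA.
    apply: ler_pM; [exact: cmod_ge0 | by rewrite mulr_ge0 // exprn_ge0 ?(ltW t0) ?cmod_ge0 | |].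
      exact: hz _ (ltn_ord i) (ltn_ord i).
    have -> : cmod y ^+ d = cmod y ^+ (d - i) * cmod y ^+ i.
      by rewrite -exprD subnK // ltnW.
    rewrite ler_pM2r ?exprn_gt0 //.
    apply: le_trans (_ : t ^+ (d - i) <= _); last by apply: lerXl => //; apply: ltW.
    by apply: ler_wiXn2l (leq_subr _ _) => //; apply: ltW.
  by rewrite sumr_const card_ord -[leLHS]mulr_natl mulrCA lexx.
rewrite mulrA ler_pM2r ?exprn_gt0 // /eta mulrAC ler_pdivlMr; last by rewrite mulr_gt0 ?ltr0n.
rewrite ler_pM2l ?exprn_gt0 // => h.
by rewrite -natr1 in h; have := ler0n R d; lra.
Qed.

Lemma weierstrass_of_regular d f : regular m d f ->
  exists (W : {poly A}) (u : pnt -> C),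
  [/\ weierstrass d W, analytic m.+1 u, u (fun=> 0) != 0
    & \forall z \near origin, f z = u z * (pev z W).[z m]].
Proof.
move=> /regular_preparation[u [r [hu u0 hr hf]]].
pose W : {poly A} := 'X^d + \poly_(k < d) mkgerm m (r k).
have sp : (size (\poly_(k < d) mkgerm m (r k)) < size ('X^d : {poly A}))%N.
  by rewrite size_polyXn ltnS size_poly.
have mW : W \is monic by rewrite monicE lead_coefDl // lead_coefXn.
have sW : size W = d.+1 by rewrite size_polyDl // size_polyXn.
have hW : \forall z \near origin, pev z W = 'X^d + \poly_(k < d) r k z.
  apply: (pev_eq (N := d.+1)) => [||i]; first by rewrite sW.
    apply: filterE => z; apply: leq_trans (size_polyD _ _) _.
    by rewrite geq_max size_polyXn leqnn leqW // size_poly.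
  rewrite coefD coefXn coef_poly; have [ir _] := hr i.
  apply: filterS3 (filterI (repD (i == d)%:R (if (i < d)%N then mkgerm m (r i) else 0))
    (mkgermK ir)) (rep0 R m) (rep1 R m) => z [-> h2] h3 h4.
  by rewrite coefD coefXn coef_poly; case: eqP; case: ltnP => _ _; rewrite /= ?h2 ?h3 ?h4.
exists W, u; split=> //; first split=> //.
  rewrite (origin0 hW); rewrite [X in _ + X](_ : _ = 0) ?addr0 //.
  by apply/polyP => i; rewrite coef_poly coef0; case: ifP => // _; case: (hr i).
apply: filterS2 hf hW => z -> ->.
by rewrite hornerD hornerXn horner_poly.
Qed.

Lemma weierstrass_division d f g : regular m d f -> analytic m.+1 g ->
  exists (q : pnt -> C) (p : {poly A}),
  [/\ analytic m.+1 q, (size p <= d)%N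
    & \forall z \near origin, g z = q z * f z + (pev z p).[z m]].
Proof.
move=> hf hg; have [q [r [hq hr h]]] := regular_division hf hg.
exists q, (\poly_(k < d) mkgerm m (r k)); split=> //.
have hp : \forall z \near origin, pev z (\poly_(k < d) mkgerm m (r k)) = \poly_(k < d) r k z.
  apply: (pev_eq (N := d)) => [||i]; first exact: size_poly.
    by apply: filterE => z; apply: size_poly.
  rewrite coef_poly; apply: filterS2 (mkgermK (hr i)) (rep0 R m) => z h2 h3.
  by rewrite coef_poly; case: ltnP.
by apply: filterS2 h hp => z -> ->; rewrite horner_poly.
Qed.

End GermPolynomials.
(** * Bounded quotients of analytic functions are analytic *)

Section BoundedQuotients.
Variable R : realType.
Local Notation C := R[i].
Local Notation pnt := (nat -> C).
Implicit Types (z a : pnt) (f g p q : pnt -> C).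

Definition shear a k z : pnt := fun i => if i == k then z k else z i + a i * z k.

Lemma shearK a k : cancel (shear (fun i => - a i) k) (shear a k).
Proof.
move=> z; apply/funext => i; rewrite /shear eqxx; case: eqP => [->|] //.
by rewrite mulNr subrK.
Qed.

Lemma shear0 a k : shear a k (fun=> 0) = fun=> 0.
Proof. by apply/funext => i; rewrite /shear mulr0 addr0; case: ifP. Qed.

Lemma near_shear a k (B : R) (P : pnt -> Prop) : (forall i, cmod (a i) <= B) ->
  (\forall z \near origin, P z) -> \forall z \near origin, P (shear a k z).
Proof.
move=> hB [d d0 h]; have B0 : 0 <= B := le_trans (cmod_ge0 _) (hB 0%N).
have B1 : 0 < 1 + B by lra.
exists (d / (1 + B)); first exact: divr_gt0.
move=> z hz; apply: h => i; rewrite /shear.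
have e : d = d / (1 + B) + B * (d / (1 + B)) by field; lra.
have dB : 0 <= B * (d / (1 + B)) by rewrite mulr_ge0 // divr_ge0 ?ltW.
case: eqP => _; first by have := hz k; lra.
apply: le_trans (cmodD _ _) _; rewrite cmodM.
have h2 : cmod (a i) * cmod (z k) <= B * (d / (1 + B)).
  by apply: ler_pM; rewrite ?cmod_ge0.
by have := hz i; lra.
Qed.

Lemma analytic_shear m a k f : (k < m)%N -> analytic m f ->
  analytic m (fun z => f (shear a k z)).
Proof.
move=> km hf; apply: (@analytic_comp R m m f (fun i z => shear a k z i)) => // i im.
  rewrite /shear; case: eqP => _; first exact: analytic_coord.
  apply: analyticD; first exact: analytic_coord.
  by apply: analyticM; [exact: analytic_cst | exact: analytic_coord].
by rewrite shear0.
Qed.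

(** The new last axis is taken through a point where the function does not
    vanish. The bound on [a] makes the change of coordinates preserve
    neighborhoods of the origin. *)
Lemma regular_after_shear k q : analytic k.+1 q -> ~ (\forall z \near origin, q z = 0) ->
  exists (a : pnt) (B : R), (forall i, cmod (a i) <= B) /\
    exists d, regular k d (fun z => q (shear a k z)).
Proof.
move=> hq nq; have [r [M [r0 psq]]] := hq.
have r20 : 0 < r / 2 by lra.
have [z0 [hz0 cq] /eqP qz0] := not_near_ex nq
  (filterI (origin_small r20) (analytic_continuous hq)).
have e0 : 0 < cmod (q z0) / 2 by rewrite divr_gt0 ?cmod_gt0.
have [d1 d10 hd1] := cq _ e0.
pose d := Num.min d1 (r / 2).
have d0 : 0 < d by rewrite lt_min d10.
have dd1 : d <= d1 by rewrite ge_min lexx.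
have dr : d <= r / 2 by rewrite ge_min lexx orbT.
pose vk : C := if z0 k == 0 then d%:C else z0 k.
have vk0 : vk != 0.
  by rewrite /vk; case: ifP => [_|/negbT //]; rewrite -cmod_gt0 cmod_real gtr0_norm.
have vkr : cmod vk <= r.
  rewrite /vk; case: ifP => _; last by have := hz0 k; lra.
  by rewrite cmod_real gtr0_norm //; lra.
pose v i : C := if (i < k)%N then z0 i else if i == k then vk else 0.
have vE : v k = vk by rewrite /v ltnn eqxx.
have vr i : cmod (v i) <= r.
  rewrite /v; case: ltnP => _; first by have := hz0 i; lra.
  by case: eqP => _ //; rewrite cmod0 ltW.
have qv : q v != 0.
  pose v' i := if (i < k.+1)%N then v i else z0 i.
  have -> : q v = q v'.
    by apply: ps_local psq _ _ => i hi; [apply: vr | rewrite /v' hi].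
  have h : cmod (q v' - q z0) <= cmod (q z0) / 2.
    apply: hd1 => i; rewrite /v' /v ltnS leq_eqVlt.
    have s0 : cmod (z0 i - z0 i) <= d1 by rewrite subrr cmod0 ltW.
    case: eqP => [->|_] /=; last by case: ltnP.
    rewrite ltnn /vk; case: eqP => [->|_].
      by rewrite subr0 cmod_real gtr0_norm.
    by rewrite subrr cmod0 ltW.
  rewrite -cmod_gt0; have := cmodB_ge (q z0) (q v'); rewrite cmodBC in h.
  by rewrite -cmod_gt0 in qz0; lra.
pose a i := if (i < k)%N then v i / vk else 0.
have hB i : cmod (a i) <= r / cmod vk.
  rewrite /a; case: ifP => _; last by rewrite cmod0 divr_ge0 ?cmod_ge0 ?ltW.
  by rewrite cmodM cmodV ler_pM2r ?invr_gt0 ?cmod_gt0.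
exists a, (r / cmod vk); split=> //.
apply: regular_exists; first exact: analytic_shear.
move=> [e ep he]; move: qv; apply/negP/negPn/eqP.
have one0 : forall _ : nat, (0 : R) < 1 by move=> _; exact: ltr01.
have psv : power_series 1 (fun=> 1) M (fun w => q (fun i => v i * w 0%N)).
  apply: (@ps_comp R k.+1 1 (fun=> r) (fun=> 1) M q (fun i w => v i * w 0%N)) => // i _.
  apply: ps_le (vr i) _; rewrite -[cmod _]mulr1.
  by apply: ps_mul => //; [apply: ps_cst | apply: (@ps_coord R 1 (fun=> 1))].
have dk : 0 < e / cmod vk by rewrite divr_gt0 ?cmod_gt0.
have -> : v = (fun i => v i * (fun=> 1 : C) 0%N) by apply/funext => i; rewrite mulr1.
apply: (ps_identity one0 dk psv _ (z := fun=> 1)) => [w _ hw|i _]; last by rewrite cmod1.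
rewrite -(he (w 0%N * vk)); last first.
  by rewrite cmodM -ler_pdivlMr ?cmod_gt0 //; apply: hw.
congr q; apply/funext => i; rewrite /shear /axis eqxx /a /v.
case: (ltngtP i k) => ik.
- by rewrite add0r; field.
- by rewrite !mul0r addr0.
- by rewrite mulrC.
Qed.

(** Make the denominator regular in the last variable. The remainder of the
    division of the numerator is bounded by a multiple of the Weierstrass
    polynomial [W] of the denominator, hence divisible by it on each vertical
    line; its degree being too small, it is zero. *)
Theorem analytic_dvd_of_le m p q (K : R) : analytic m p -> analytic m q -> 0 <= K ->
  ~ (\forall z \near origin, q z = 0) ->
  (\forall z \near origin, cmod (p z) <= K * cmod (q z)) ->
  exists2 s, analytic m s & \forall z \near origin, p z = s z * q z.
Proof.
case: m => [|k].
  move=> [r [M [r0 [c [_ hc]]]]] [r' [M' [r'0 [c' [_ hc']]]]] _ nq _.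
  exists (fun=> c / c'); first exact: analytic_cst.
  apply: filterE => z; rewrite hc hc' divfK //; apply/eqP => c'0; apply: nq.
  by apply: filterE => y; rewrite hc'.
move=> hp hq K0 nq hpq.
have [a [B [hB [d hreg]]]] := regular_after_shear hq nq.
pose p' z := p (shear a k z); pose q' z := q (shear a k z).
have hp' : analytic k.+1 p' by apply: analytic_shear.
have hq' : analytic k.+1 q' by apply: analytic_shear.
have [W [u [wW hu u0 hW]]] := weierstrass_of_regular hreg.
have [s [r [hs sr hdiv]]] := weierstrass_division hreg hp'.
have [S S0 hS] := analytic_bounded hs.
have [U U0 hU] := analytic_bounded hu.
pose K' := (K + S) * U.
have K'0 : 0 <= K' by rewrite mulr_ge0 ?addr_ge0.
have hr : \forall z \near origin, cmod (pev z r).[z k] <= K' * cmod (pev z W).[z k].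
  have hpq' : \forall z \near origin, cmod (p' z) <= K * cmod (q' z) by apply: near_shear hpq.
  apply: filterS3 (filterI hdiv hW) (filterI hS hU) hpq' => z [h1 h2] [h3 h4] h5.
  have -> : (pev z r).[z k] = p' z - s z * q' z by rewrite h1 addrC addKr.
  apply: le_trans (cmodD _ _) _; rewrite cmodN cmodM.
  apply: le_trans (_ : (K + S) * cmod (q' z) <= _).
    by rewrite mulrDl; apply: lerD => //; rewrite ler_wpM2r ?cmod_ge0.
  by rewrite /q' h2 cmodM mulrA ler_wpM2r ?cmod_ge0 // ler_wpM2l // addr_ge0.
have [e e0 hre] := near_upd k hr.
have r0 : \forall z \near origin, pev z r = 0.
  case: (wW) => mW sW _.
  apply: filterS3 (filterI hre (filterI (pev_upd r) (pev_upd W))) (pev_monic mW)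
    (weierstrass_roots wW e0) => z [h1 [h2 h3]] [h4 h5] h6.
  have [t ht] := monic_split h4.
  have dv : root_poly t %| pev z r.
    apply: (root_poly_dvd (d := e) K'0) => [b hb|y hy].
      by apply: h6; rewrite ht root_prod_XsubC.
    by have := h1 y hy; rewrite upd_last h2 h3 ht.
  apply/eqP; rewrite -[_ == 0]negbK; apply/negP => /dvdp_leq/(_ dv).
  by rewrite -ht h5 sW ltnNge (leq_trans (size_pev _ _)).
have hdiv' : \forall z \near origin, p' z = s z * q' z.
  by apply: filterS2 hdiv r0 => z -> ->; rewrite horner0 addr0.
have hB' i : cmod (- a i) <= B by rewrite cmodN.
exists (fun z => s (shear (fun i => - a i) k z)); first exact: analytic_shear.
have h : \forall z \near origin, (fun z => p' z = s z * q' z) (shear (fun i => - a i) k z).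
  exact: near_shear hdiv'.
by apply: filterS h => z; rewrite /p' /q' shearK.
Qed.

End BoundedQuotients.

(** * Hypersurface germs given by Weierstrass polynomials *)

Section Hypersurfaces.
Variables (R : realType) (m : nat).
Local Notation C := R[i].
Local Notation pnt := (nat -> C).
Local Notation A := (germ R m).
Implicit Types (z : pnt) (f g : pnt -> C) (W P Q G : {poly A}).

Lemma germ_neq0_ex (c : A) (P : pnt -> Prop) : c != 0 -> (\forall z \near origin, P z) ->
  exists2 z, P z & rep c z != 0.
Proof.
move=> c0 hP; have [|z Pz /eqP cz] := @not_near_ex R (fun z => rep c z = 0) P _ hP.
  by move/germ_eq0P/eqP; apply/negP.
by exists z.
Qed.

Lemma root_poly_coef_le (s : seq C) i : (forall a, a \in s -> cmod a <= 1) ->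
  cmod (root_poly s)`_i <= 2 ^+ size s.
Proof.
elim: s i => [|a s IH] i hs.
  by rewrite /root_poly big_nil coef1 expr0; case: eqP => _; rewrite ?cmod1 ?cmod0 ?ler01.
have ha : cmod a <= 1 by apply: hs; rewrite mem_head.
have {}IH j : cmod (root_poly s)`_j <= 2 ^+ size s.
  by apply: IH => b hb; apply: hs; rewrite in_cons hb orbT.
have E : 0 <= (2 : R) ^+ size s by rewrite exprn_ge0.
rewrite /root_poly big_cons mulrBl mul_polyC coefB coefXM coefZ /= exprS.
apply: le_trans (cmodD _ _) _; rewrite cmodN cmodM.
have h1 : cmod a * cmod (root_poly s)`_i <= 2 ^+ size s.
  rewrite -[leRHS]mul1r; apply: ler_pM; rewrite ?cmod_ge0 //.
have h2 : cmod (if i == 0%N then 0 else (root_poly s)`_i.-1) <= 2 ^+ size s.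
  by case: ifP => _; rewrite ?cmod0.
by rewrite mulr_natl mulr2n; lra.
Qed.

(** Normalized to be monic, a divisor over the fraction field has its roots among
    those of [W], which are bounded. Hence its coefficients are bounded quotients
    of analytic functions, so they are analytic. *)
Lemma weierstrass_divisor d W G : weierstrass d W -> G %| W ->
  exists2 G1 : {poly A}, G1 \is monic & G = lead_coef G *: G1.
Proof.
move=> wW /Pdiv.Idomain.dvdpP[[c Q] /= c0 e].
have [mW sW _] := wW.
pose g := lead_coef G.
have cE : c = lead_coef Q * g.
  by rewrite -lead_coefM -e lead_coefZ (monicP mW) mulr1.
have g0 : g != 0 by apply: contraNneq c0 => g0; rewrite cE g0 mulr0.
have sG0 : (0 < size G)%N by rewrite size_poly_gt0 -lead_coef_eq0.
have bnd i : \forall z \near origin, cmod (rep G`_i z) <= 2 ^+ size G * cmod (rep g z).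
  apply: (analytic_le_extend (rep_analytic c)); try exact: rep_analytic.
  - by rewrite exprn_ge0.
  - by move/germ_eq0P/eqP; apply/negP.
  have h1 : \forall z \near origin, rep c z *: pev z W = pev z Q * pev z G.
    by apply: filterS2 (pevZ c W) (pevM Q G) => z <- <-; rewrite e.
  apply: filterS3 (filterI h1 (pev_coef G)) (filterI (pev_monic mW) (weierstrass_roots wW ltr01))
    (filterI (repM (lead_coef Q) g) (rep0 R m)).
  move=> z [h2 h3] [[h4 h5] h6] [h7 h8] cz.
  have gz : rep g z != 0 by apply: contraNneq cz => gz; rewrite cE h7 gz mulr0.
  have sGz : size (pev z G) = size G by apply: size_poly_eq.
  have lGz : lead_coef (pev z G) = rep g z by rewrite lead_coefE sGz h3.
  have [s hs] := closed_field_poly_normal (pev z G).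
  rewrite -/(root_poly s) lGz in hs.
  have ss : (size s <= size G)%N.
    rewrite -sGz hs size_scale // size_prod_XsubC; exact: leqnSn.
  rewrite -h3 hs coefZ cmodM mulrC ler_wpM2r ?cmod_ge0 //.
  apply: le_trans (root_poly_coef_le _ _) _ => [a ha|]; last first.
    by apply: ler_weXn2l => //; rewrite ler1n.
  apply/ltW/h6; rewrite -(rootZ _ _ cz) h2 rootM hs rootZ //.
  by rewrite (root_prod_XsubC s) ha orbT.
have ng : ~ (\forall z \near origin, rep g z = 0) by move/germ_eq0P/eqP; apply/negP.
have E0 : 0 <= (2 : R) ^+ size G by rewrite exprn_ge0.
have /choice[s hs] : forall i, exists s, analytic m s /\
    \forall z \near origin, rep G`_i z = s z * rep g z.
  move=> i; have [s h1 h2] := analytic_dvd_of_le (rep_analytic G`_i) (rep_analytic g) E0 ng (bnd i).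
  by exists s.
pose G1 : {poly A} := \poly_(i < size G) mkgerm m (s i).
have gG1 : g *: G1 = G.
  apply/polyP => i; rewrite coefZ coef_poly; case: ltnP => hi; last first.
    by rewrite mulr0 nth_default.
  have [s1 s2] := hs i; apply: germ_inj.
  by apply: filterS3 (repM g (mkgerm m (s i))) (mkgermK s1) s2 => z -> -> ->; rewrite mulrC.
exists G1; last by rewrite gG1.
apply/monicP/(mulfI g0); by rewrite -lead_coefZ gG1 mulr1.
Qed.

Definition square_free f : Prop := forall g h, analytic m.+1 g -> analytic m.+1 h ->
  (\forall z \near origin, f z = g z ^+ 2 * h z) -> g (fun=> 0) != 0.

Definition irreducible f : Prop := forall g h, analytic m.+1 g -> analytic m.+1 h ->
  (\forall z \near origin, f z = 0 <-> g z * h z = 0) ->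
  (\forall z \near origin, f z = 0 <-> g z = 0) \/
  (\forall z \near origin, f z = 0 <-> h z = 0).

Lemma bezout_germ P Q : coprimep P Q ->
  exists (u v : {poly A}) (c : A), c != 0 /\ u * P + v * Q = c%:P.
Proof.
move=> /Bezout_coprimepP[[u v] /= /eqpP[[a b] /= /andP[a0 b0] e]].
exists (a *: u), (a *: v), b; split=> //.
by rewrite -!scalerAl -scalerDr e alg_polyC.
Qed.

Lemma pev_bezout P Q (u v : {poly A}) c : u * P + v * Q = c%:P ->
  \forall z \near origin, pev z u * pev z P + pev z v * pev z Q = (rep c z)%:P.
Proof.
move=> e; apply: filterS3 (filterI (pevM u P) (pevM v Q)) (pevD (u * P) (v * Q)) (pevC c).
by move=> z [<- <-] <- <-; rewrite e.
Qed.

(** A repeated factor of [W] over the fraction field of the ring of germs would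
    by [weierstrass_divisor] be a factor with analytic coefficients, and give a
    square factor of [f] in the ring of germs in one more variable. *)
Lemma weierstrass_separable d W f u : weierstrass d W -> analytic m.+1 u ->
  (\forall z \near origin, f z = u z * (pev z W).[z m]) -> square_free f ->
  coprimep W W^`().
Proof.
move=> wW hu hf sf; have [mW sW W0] := wW.
suff : separable.separable_poly W by rewrite unlock.
apply/separable.separable_polyP; split=> [|G GW sG].
  apply/separable.poly_square_freeP => G sG; apply/negP => GW.
  have G2W : G %| W by apply: dvdp_trans GW; apply: dvdp_mulr.
  have [G1 mG1 eG] := weierstrass_divisor wW G2W.
  have lG0 : lead_coef G != 0.
    rewrite lead_coef_eq0; apply: contraTneq GW => ->.
    by rewrite expr0n /= dvd0p monic_neq0.
  have sG1 : (1 < size G1)%N.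
    rewrite ltn_neqAle size_poly_gt0 (monic_neq0 mG1) andbT eq_sym.
    by rewrite -(size_scale G1 lG0) -eG.
  have /(Pdiv.IdomainMonic.dvdpP (monic_exp 2 mG1))[Q eQ] : G1 ^+ 2 %| W.
    by rewrite eG exprZn dvdpZl ?expf_neq0 // in GW.
  have := sf (fun z => (pev z G1).[z m]) (fun z => u z * (pev z Q).[z m]) (pev_analytic _)
    (analyticM hu (pev_analytic _)).
  have eW : \forall z \near origin, pev z W = pev z Q * pev z G1 ^+ 2.
    by apply: filterS2 (pevM Q (G1 ^+ 2)) (pevM G1 G1) => z h1 h2; rewrite eQ h1 expr2 h2 -expr2.
  case/(_ _)/negP => [|].
    by apply: filterS2 hf eW => z -> ->; rewrite hornerM horner_exp; ring.
  have [mG10 sG10] := origin0 (pev_monic mG1).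
  have /closed_rootP[y hy] : size (pev (fun=> 0) G1) != 1%N by rewrite sG10 gtn_eqF.
  have : root 'X^d y by rewrite -W0 (origin0 eW) rootE hornerM horner_exp (rootP hy) expr0n mulr0.
  by rewrite rootE hornerXn expf_eq0 => /andP[_ /eqP y0]; move: hy; rewrite rootE y0.
have lG0 : G != 0 by rewrite -size_poly_gt0 ltnW.
have [n hn] : exists n, size G = n.+2 by case: (size G) sG => [|[|n]] // _; exists n.
have lG : G`_n.+1 != 0 by rewrite -[n.+1]/(n.+2.-1) -hn -lead_coefE lead_coef_eq0.
apply/eqP => /(congr1 (fun p : {poly A} => p`_n)); rewrite coef0 coef_deriv -mulr_natr => /eqP.
by rewrite mulf_eq0 (negbTE lG) (negbTE (germ_pchar0 _ _ _)).
Qed.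

End Hypersurfaces.
Section Components.
Variables (R : realType) (m : nat).
Local Notation C := R[i].
Local Notation pnt := (nat -> C).
Local Notation A := (germ R m).
Implicit Types (z : pnt) (f g u : pnt -> C) (W P Q G : {poly A}).

(** The analytic functions that are reduced equations of irreducible
    hypersurface germs meeting the last axis properly. *)
Definition component f : Prop :=
  [/\ analytic m.+1 f, f (fun=> 0) = 0, square_free m f, irreducible m f
    & ~ (exists2 e : R, 0 < e & forall y, cmod y <= e -> f (axis m y) = 0)].

Definition presents f d W u : Prop :=
  [/\ regular m d f, weierstrass d W, analytic m.+1 u, u (fun=> 0) != 0
    & \forall z \near origin, f z = u z * (pev z W).[z m]].

Definition divides f g : Prop :=
  exists2 q, analytic m.+1 q & \forall z \near origin, g z = q z * f z.

Lemma component_presents f : component f -> exists d W u, (0 < d)%N /\ presents f d W u.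
Proof.
move=> [hf f0 _ _ nz]; have [d hd] := regular_exists hf nz.
have [W [u [hW hu u0 h]]] := weierstrass_of_regular hd.
exists d, W, u; split=> //; rewrite lt0n; apply/eqP => d0.
have := origin0 h; have [_ _ ->] := hW; rewrite f0 d0 expr0 hornerC mulr1 => /esym/eqP.
by apply/negP.
Qed.

Lemma presents_roots f d W u (e : R) : presents f d W u -> 0 < e ->
  \forall z \near origin, exists s : seq C,
    [/\ pev z W = root_poly s, size s = d, forall y, y \in s -> cmod y < e
      & forall y, y \in s -> f (upd m z y) = 0].
Proof.
move=> [_ wW _ _ hf] e0; have [mW sW _] := wW.
have [t t0 ht] := near_upd m hf.
have m0 : 0 < Num.min e t by rewrite lt_min e0.
apply: filterS3 (filterI (pev_upd W) ht) (pev_monic mW) (weierstrass_roots wW m0).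
move=> z [h1 h2] [h3 h4] h5; have [s hs] := monic_split h3; exists s.
have hr y : y \in s -> root (pev z W) y by rewrite hs root_prod_XsubC.
split=> // [|y /hr/h5|y ys].
- by apply: succn_inj; rewrite -sW -h4 hs size_prod_XsubC.
- by rewrite lt_min => /andP[].
- rewrite h2; last by have /hr/h5 := ys; rewrite lt_min => /andP[_ /ltW].
  by rewrite upd_last h1 (rootP (hr y ys)) mulr0.
Qed.

Lemma generic_zero f d W u (c : A) (P : pnt -> Prop) : presents f d W u -> (0 < d)%N ->
  c != 0 -> (\forall z \near origin, P z) ->
  exists z, [/\ P z, rep c z != 0 & f z = 0].
Proof.
move=> hf d0 c0 hP; have [e e0 he] := near_upd m hP.
have [z [[h1 [s [_ ss hs fs]]] h3] cz] := germ_neq0_ex c0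
  (filterI (filterI he (presents_roots hf e0)) (analytic_local (rep_analytic c))).
case: s ss hs fs => [ss|y s _ hs fs]; first by rewrite -ss in d0.
exists (upd m z y); split; first by apply: h1; apply/ltW/hs; rewrite mem_head.
  by rewrite -(h3 (upd m z y)) // => i im; rewrite /upd ltn_eqF.
by apply: fs; rewrite mem_head.
Qed.

Lemma generic_uniq f d W u : presents f d W u -> square_free m f ->
  exists2 c : A, c != 0 & \forall z \near origin, rep c z != 0 ->
    forall s, pev z W = root_poly s -> uniq s.
Proof.
move=> [_ wW hu _ hf] sf.
have [U [V [c [c0 e]]]] := bezout_germ (weierstrass_separable wW hu hf sf).
exists c => //; apply: filterS2 (pev_bezout e) (pev_deriv W) => z h1 h2 cz s hs.
rewrite -(separable.separable_prod_XsubC s) -/(root_poly s) -hs unlock.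
apply/Bezout_eq1_coprimepP; exists ((rep c z)^-1 *: pev z U, (rep c z)^-1 *: pev z V) => /=.
by rewrite -!scalerAl -scalerDr -h2 h1 -mul_polyC -polyCM mulVf.
Qed.

(** Generically [W] has [d] distinct roots, and all of them are roots of [G]. *)
Lemma same_zeros_size f d W u G : presents f d W u -> square_free m f -> G \is monic ->
  (\forall z \near origin, f z = 0 -> (pev z G).[z m] = 0) -> (d < size G)%N.
Proof.
move=> hf sf mG h.
have [c c0 hc] := generic_uniq hf sf.
have [e e0 he] := near_upd m h.
have [z [[h1 [s [Ws ss hs fs]]] [[h2 h3] h4]] cz] := germ_neq0_ex c0
  (filterI (filterI he (presents_roots hf e0)) (filterI (filterI hc (pev_upd G)) (pev_monic mG))).
have us := h2 cz s Ws; have [mGz sGz] := h4.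
rewrite -sGz -ss; apply: max_poly_roots => //; first exact: monic_neq0.
apply/allP => y ys; rewrite rootE -(h3 y) -[X in _.[X]](upd_last m z y).
by apply/eqP; apply: h1; [apply/ltW/hs | apply: fs].
Qed.

(** The remainder of [g] modulo the Weierstrass polynomial [W] is zero or coprime
    to [W], because a common factor would decompose the germ. In the coprime case
    a Bezout relation shows that the common zeros of [f] and [g] lie over the
    zeros of one nonzero germ [c] in the parameters. *)
Lemma divides_or_generic f d W u g : presents f d W u -> component f -> analytic m.+1 g ->
  divides f g \/ exists2 c : A, c != 0 &
    \forall z \near origin, rep c z != 0 -> f z = 0 -> g z != 0.
Proof.
move=> pf [hf f0 sf irr _] hg; have [hreg wW hu u0 hW] := pf.
have [mW sW _] := wW.
have [q [p [hq sp hdiv]]] := weierstrass_division hreg hg.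
have fW : \forall z \near origin, f z = 0 <-> (pev z W).[z m] = 0.
  apply: filterS2 hW (analytic_neq0 hu u0) => z -> uz; split=> [/eqP|->]; last by rewrite mulr0.
  by rewrite mulf_eq0 (negbTE uz) => /eqP.
have [p0|p0] := eqVneq p 0.
  left; exists q => //; apply: filterS hdiv => z ->.
  by rewrite p0 /pev size_poly0 poly_def big_ord0 horner0 addr0.
right; have [cop|ncop] := boolP (coprimep W p).
  have [U [V [c [c0 e]]]] := bezout_germ cop.
  exists c => //; apply: filterS3 (filterI (pev_bezout e) fW) hdiv hW => z [h1 h2] h3 h4 cz fz.
  apply: contraNneq cz => gz.
  have := congr1 (horner^~ (z m)) h1; rewrite /= hornerD !hornerM hornerC => <-.
  have -> : (pev z p).[z m] = 0 by move: h3; rewrite gz fz mulr0 add0r.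
  by rewrite (h2.1 fz) !mulr0 addr0.
exfalso.
(* A common factor of W and p splits W, against irreducibility. *)
have [G1 mG1 eG] := weierstrass_divisor wW (dvdp_gcdl W p).
have W0 := monic_neq0 mW.
have G0 : gcdp W p != 0 by rewrite gcdp_eq0 negb_and W0.
have lG0 : lead_coef (gcdp W p) != 0 by rewrite lead_coef_eq0.
have sG : size (gcdp W p) = size G1 by rewrite {1}eG size_scale.
have sG1 : (1 < size G1)%N.
  rewrite -sG ltn_neqAle size_poly_gt0 G0 andbT eq_sym.
  by rewrite coprimep_def in ncop.
have sG1d : (size G1 <= d)%N.
  by rewrite -sG; apply: leq_trans sp; apply: dvdp_leq => //; apply: dvdp_gcdr.
have /(Pdiv.IdomainMonic.dvdpP mG1)[Q eQ] : G1 %| W.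
  by have := dvdp_gcdl W p; rewrite {1}eG dvdpZl.
have mQ : Q \is monic by rewrite -(monicMr _ mG1) -eQ.
have sQ : (size Q <= d)%N.
  have : (size Q + size G1).-1 = d.+1 by rewrite -sW eQ size_Mmonic // monic_neq0.
  by case: (size G1) sG1 => [|[|k]] // _; rewrite !addnS /= => -[<-]; apply: leq_addr.
have WQG : \forall z \near origin, pev z W = pev z Q * pev z G1 by apply: filterS (pevM Q G1) => z <-; rewrite eQ.
have hz : \forall z \near origin, f z = 0 <-> (pev z Q).[z m] * (pev z G1).[z m] = 0.
  by apply: filterS2 fW WQG => z h1 h2; rewrite -hornerM -h2.
case: (irr _ _ (pev_analytic Q) (pev_analytic G1) hz) => h.
  have h' : \forall z \near origin, f z = 0 -> (pev z Q).[z m] = 0.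
    by apply: filterS h => z [].
  by have := same_zeros_size pf sf mQ h'; rewrite ltnNge sQ.
have h' : \forall z \near origin, f z = 0 -> (pev z G1).[z m] = 0.
  by apply: filterS h => z [].
by have := same_zeros_size pf sf mG1 h'; rewrite ltnNge sG1d.
Qed.

(** The Nullstellensatz for a reduced irreducible hypersurface germ. *)
Lemma vanishing_divides f g (c : A) : component f -> analytic m.+1 g -> c != 0 ->
  (\forall z \near origin, rep c z != 0 -> f z = 0 -> g z = 0) -> divides f g.
Proof.
move=> hf hg c0 h; have [d [W [u [d0 pf]]]] := component_presents hf.
case: (divides_or_generic pf hf hg) => // -[c' c'0 h'].
have cc : c * c' != 0 by rewrite mulf_neq0.
have [z [[h1 [h2 h3]] cz fz]] := generic_zero pf d0 cc (filterI h (filterI h' (repM c c'))).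
move: cz; rewrite h3 mulf_eq0 negb_or => /andP[cz c'z].
by have := h2 c'z fz; rewrite h1 ?eqxx.
Qed.

(** If [g] is [q] times [f], then by irreducibility the zeros of [g] are those of
    [f] or those of [q]. In the second case [f] divides [q] as well, and its
    square divides the reduced equation [g]. *)
Lemma component_divides f g : component f -> component g -> divides f g ->
  \forall z \near origin, f z = 0 <-> g z = 0.
Proof.
move=> hf hg [q hq gqf]; have [af f0 _ _ _] := hf; have [_ _ sg irr _] := hg.
have hz : \forall z \near origin, g z = 0 <-> q z * f z = 0.
  by apply: filterS gqf => z ->.
case: (irr q f hq af hz) => h; last by apply: filterS h => z; tauto.
have [|p hp qpf] := @vanishing_divides f q 1 hf hq (oner_neq0 _).
  apply: filterS2 h gqf => z h1 h2 _ fz; apply/h1; by rewrite h2 fz mulr0.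
have : f (fun=> 0) != 0.
  by apply: (sg f p) => //; apply: filterS2 gqf qpf => z -> ->; ring.
by rewrite f0 eqxx.
Qed.

End Components.
(** * Analytic functions of a vector variable *)

Section VectorVariable.
Variable R : realType.
Local Notation C := R[i].
Local Notation pnt := (nat -> C).

Lemma nbhs_complexP (y0 : C) (P : C -> Prop) :
  (\forall y \near y0, P y) <->
  exists2 d : R, 0 < d & forall y, cmod (y - y0) < d -> P y.
Proof.
split.
  move/nbhs_ballP => [e /= e0 h].
  have er : e = (complex.Re e)%:C by apply/esym/RRe_real/gtr0_real.
  exists (complex.Re e); first by rewrite -ltcR -er.
  by move=> y hy; apply: h; rewrite /ball /= distrC normcE_cmod er ltcR.
move=> [d d0 h]; apply/nbhs_ballP; exists d%:C; first by rewrite /= ltcR.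
by move=> y; rewrite /ball /= distrC normcE_cmod ltcR; apply: h.
Qed.

Lemma nbhs_rowP m (p : 'rV[C]_m) (P : 'rV[C]_m -> Prop) :
  (\forall y \near p, P y) <->
  exists2 d : R, 0 < d & forall y : 'rV[C]_m, (forall i, cmod (y 0 i - p 0 i) < d) -> P y.
Proof.
split.
  move/nbhs_ballP => [e /= e0 h].
  have er : e = (complex.Re e)%:C by apply/esym/RRe_real/gtr0_real.
  exists (complex.Re e); first by rewrite -ltcR -er.
  by move=> y hy; apply: h; split=> // i j; rewrite /ball /= distrC normcE_cmod er ltcR ord1.
move=> [d d0 h]; apply/nbhs_ballP; exists d%:C; first by rewrite /= ltcR.
move=> y [_ hy]; apply: h => i; have := hy 0 i.
by rewrite /ball /= distrC normcE_cmod ltcR.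
Qed.

Lemma cvg_climP (u : nat -> C) l : u @ \oo --> l <-> clim u l.
Proof.
split.
  move=> /cvg_ballP h e e0.
  have e0' : 0 < e%:C by rewrite ltcR.
  have [N _ hN] := h _ e0'; exists N => n hn; have := hN n hn.
  by rewrite /ball /= distrC normcE_cmod ltcR.
move=> h; apply/cvg_ballP => e e0.
have er : e = (complex.Re e)%:C by apply/esym/RRe_real/gtr0_real.
have [|N hN] := h (complex.Re e); first by rewrite -ltcR -er.
by exists N => // n hn; rewrite /ball /= distrC normcE_cmod er ltcR; apply: hN.
Qed.

(** The sums over boxes of multi-indices are compared with iterated sums by
    splitting off the last index. *)
Definition box (V : nmodType) m N (F : {ffun 'I_m -> nat} -> V) : V :=
  \sum_(e : {ffun 'I_m -> 'I_N}) F [ffun i => nat_of_ord (e i)].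

Definition ext (T : Type) m (e : {ffun 'I_m -> T}) (k : T) : {ffun 'I_m.+1 -> T} :=
  [ffun i => if unlift ord_max i is Some j then e j else k].

Definition restr (T : Type) m (e : {ffun 'I_m.+1 -> T}) : {ffun 'I_m -> T} :=
  [ffun j => e (lift ord_max j)].

Lemma ext_lift (T : Type) m (e : {ffun 'I_m -> T}) k j : ext e k (lift ord_max j) = e j.
Proof. by rewrite ffunE liftK. Qed.

Lemma ext_max (T : Type) m (e : {ffun 'I_m -> T}) k : ext e k ord_max = k.
Proof. by rewrite ffunE unlift_none. Qed.

Lemma restrK (T : Type) m (e : {ffun 'I_m.+1 -> T}) : ext (restr e) (e ord_max) = e.
Proof.
by apply/ffunP => i; rewrite ffunE; case: unliftP => [j ->|->]; rewrite ?ffunE.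
Qed.

Lemma extK (T : Type) m (e : {ffun 'I_m -> T}) k : restr (ext e k) = e.
Proof. by apply/ffunP => j; rewrite ffunE ext_lift. Qed.

Lemma box0 (V : nmodType) N (F : {ffun 'I_0 -> nat} -> V) : box N F = F [ffun=> 0%N].
Proof.
rewrite /box (big_pred1 [ffun i : 'I_0 => match i with Ordinal _ h => False_rect _ (notF h) end]).
  by congr F; apply/ffunP => -[].
by move=> e /=; apply/esym/eqP/ffunP => -[].
Qed.

Lemma boxS (V : nmodType) m N (F : {ffun 'I_m.+1 -> nat} -> V) :
  box N F = \sum_(k < N) box N (fun e => F (ext e k)).
Proof.
rewrite /box (reindex (fun p : 'I_N * {ffun 'I_m -> 'I_N} => ext p.2 p.1)) /=; last first.
  exists (fun e : {ffun 'I_m.+1 -> 'I_N} => (e ord_max, restr e)) => [[k e]|e] _ /=.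
    by rewrite ext_max extK.
  exact: restrK.
rewrite pair_big /=; apply: eq_bigr => -[k e] _ /=; congr F; apply/ffunP => i.
by rewrite !ffunE; case: unlift => [j|]; rewrite ?ffunE.
Qed.

Lemma box_mono m N N' (F : {ffun 'I_m -> nat} -> R) : (forall e, 0 <= F e) ->
  (N <= N')%N -> box N F <= box N' F.
Proof.
move=> F0 le; elim: m F F0 => [|m IH] F F0; first by rewrite !box0.
rewrite !boxS; apply: le_trans (_ : \sum_(k < N) box N' (fun e => F (ext e k)) <= _).
  by apply: ler_sum => k _; apply: IH.
rewrite -!(big_mkord xpredT (fun k => box N' (fun e => F (ext e k)))).
by rewrite (big_cat_nat (n := N) (p := N')) //= lerDl; apply: sumr_ge0 => k _; apply: sumr_ge0.
Qed.

Definition mon m (e : {ffun 'I_m -> nat}) (z : pnt) : C := \prod_(i < m) z i ^+ e i.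

Lemma lift_widen m (i : 'I_m) : lift ord_max i = widen_ord (leqnSn m) i.
Proof. by apply: val_inj; rewrite /= /bump leqNgt ltn_ord. Qed.

Lemma mon_ext m (e : {ffun 'I_m -> nat}) k z : mon (ext e k) z = mon e z * z m ^+ k.
Proof.
rewrite /mon big_ord_recr /= ext_max; congr (_ * _); apply: eq_bigr => i _.
by rewrite -(ext_lift e k i) lift_widen.
Qed.

Lemma deg_ext m (e : {ffun 'I_m -> nat}) k : (\sum_i ext e k i = \sum_i e i + k)%N.
Proof.
rewrite big_ord_recr /= ext_max; congr (_ + _)%N; apply: eq_bigr => i _.
by rewrite -(ext_lift e k i) lift_widen.
Qed.

Definition weight m (r : R) (c : {ffun 'I_m -> nat} -> C) (e : {ffun 'I_m -> nat}) : R :=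
  cmod (c e) * r ^+ (\sum_i e i).

Lemma weight_ext m r (c : {ffun 'I_m.+1 -> nat} -> C) N k :
  box N (fun e => weight r c (ext e k)) = box N (weight r (fun e => c (ext e k))) * r ^+ k.
Proof.
rewrite /box mulr_suml; apply: eq_bigr => e _.
by rewrite /weight deg_ext exprD mulrA.
Qed.

Lemma box_mon_ext m (c : {ffun 'I_m.+1 -> nat} -> C) N k z :
  box N (fun e => c (ext e k) * mon (ext e k) z)
  = box N (fun e => c (ext e k) * mon e z) * z m ^+ k.
Proof. by rewrite /box mulr_suml; apply: eq_bigr => e _; rewrite mon_ext mulrA. Qed.

Lemma mon_le m (r : R) e z : 0 <= r -> polydisc m (fun=> r) z ->
  cmod (mon e z) <= r ^+ (\sum_(i < m) e i).
Proof.
move=> r0; elim: m e => [|m IH] e hz.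
  by rewrite /mon !big_ord0 cmod1.
rewrite -[e]restrK mon_ext deg_ext exprD cmodM cmodX.
apply: ler_pM; [exact: cmod_ge0 | by rewrite exprn_ge0 ?cmod_ge0 | |].
  exact: IH (polydiscS hz).
exact: lerXl (cmod_ge0 _) (hz m (ltnSn m)).
Qed.

Lemma box_mon_le m (r M : R) (c : {ffun 'I_m -> nat} -> C) N z : 0 <= r -> polydisc m (fun=> r) z ->
  box N (weight r c) <= M -> cmod (box N (fun e => c e * mon e z)) <= M.
Proof.
move=> r0 hz; apply: le_trans; apply: le_trans (cmod_sum _ _ _) _.
by apply: ler_sum => e _; rewrite cmodM ler_wpM2l ?cmod_ge0 ?mon_le.
Qed.

Lemma weight_ge0 m r (c : {ffun 'I_m -> nat} -> C) e : 0 <= r -> 0 <= weight r c e.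
Proof. by move=> r0; rewrite mulr_ge0 ?cmod_ge0 ?exprn_ge0. Qed.

Lemma power_series_of_box m (r M : R) (c : {ffun 'I_m -> nat} -> C) : 0 < r ->
  (forall N, box N (weight r c) <= M) ->
  exists2 F, power_series m (fun=> r) M F &
    forall z, polydisc m (fun=> r) z -> clim (fun N => box N (fun e => c e * mon e z)) (F z).
Proof.
move=> r0; elim: m M c => [|m IH] M c hM.
  exists (fun=> c [ffun=> 0%N]).
    exists (c [ffun=> 0%N]); split=> //; have := hM 0%N.
    by rewrite box0 /weight big_ord0 expr0 mulr1.
  move=> z _; apply: clim_ext (@clim_cst _ _) => N.
  by rewrite box0 /mon big_ord0 mulr1.
have rk k : 0 < r ^+ k by rewrite exprn_gt0.
pose u N k := box N (fun e => weight r c (ext e k)).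
have u_mono k N N' : (N <= N')%N -> u N k <= u N' k.
  by move=> le; apply: box_mono le => e; apply: weight_ge0; apply: ltW.
have uM K N : \sum_(k < K) u N k <= M.
  apply: le_trans (hM (maxn K N)); rewrite boxS.
  apply: le_trans (_ : \sum_(k < K) u (maxn K N) k <= _).
    by apply: ler_sum => k _; apply: u_mono; apply: leq_maxr.
  rewrite -!(big_mkord xpredT (u (maxn K N))) (big_cat_nat (n := K) (p := maxn K N)) ?leq_maxl //=.
  rewrite lerDl; apply: sumr_ge0 => k _; apply: sumr_ge0 => e _; apply: weight_ge0; exact: ltW.
have [B [uB BM]] := monotone_columns u_mono uM.
have cB k N : box N (weight r (fun e => c (ext e k))) <= B k / r ^+ k.
  by rewrite ler_pdivlMr //; have := uB N k; rewrite /u weight_ext.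
have /choice[F hF] : forall k, exists F, power_series m (fun=> r) (B k / r ^+ k) F /\
    forall z, polydisc m (fun=> r) z ->
      clim (fun N => box N (fun e => c (ext e k) * mon e z)) (F z).
  by move=> k; have [F h1 h2] := IH _ _ (cB k); exists F.
have BE K : \sum_(k < K) B k / r ^+ k * r ^+ k <= M.
  by under eq_bigr do rewrite divfK ?gt_eqF //.
have bnd (h : nat -> C) z k : polydisc m.+1 (fun=> r) z -> cmod (h k) <= B k / r ^+ k ->
    cmod (h k * z m ^+ k) <= B k / r ^+ k * r ^+ k.
  move=> hz hk; rewrite cmodM cmodX.
  apply: ler_pM => //; [exact: cmod_ge0 | by rewrite exprn_ge0 ?cmod_ge0 |].
  exact: lerXl (cmod_ge0 _) (hz m (ltnSn m)).
have : forall z, exists s, polydisc m.+1 (fun=> r) z -> csum (fun k => F k z * z m ^+ k) s.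
  move=> z; case: (pselect (polydisc m.+1 (fun=> r) z)) => hz; last by exists 0.
  have [s hs] := @dominated_csum _ (fun k => F k z * z m ^+ k) _ M
    (fun k => bnd (F^~ z) z k hz (ps_bound (hF k).1 (polydiscS hz))) BE.
  by exists s.
move=> /choice[f hf]; exists f.
  by exists F, (fun k => B k / r ^+ k); split=> // k; case: (hF k).
move=> z hz.
apply: clim_ext (@csum_diagonal _ (fun k N => box N (fun e => c (ext e k) * mon e z) * z m ^+ k)
  (fun k => F k z * z m ^+ k) _ M _ _ BE _ (hf z hz)) => [N|k N|k].
- by rewrite boxS; apply: eq_bigr => k _; rewrite box_mon_ext.
- apply: (bnd (fun k => box N (fun e => c (ext e k) * mon e z))) => //.
  by apply: box_mon_le (ltW r0) (polydiscS hz) (cB k N).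
- rewrite mulrC; apply: clim_ext (climZ (z m ^+ k) ((hF k).2 z (polydiscS hz))) => N.
  by rewrite mulrC.
Qed.

Lemma box_of_power_series m (r M : R) F : 0 < r -> power_series m (fun=> r) M F ->
  exists2 c : {ffun 'I_m -> nat} -> C, forall N, box N (weight r c) <= M &
    forall z, polydisc m (fun=> r) z -> clim (fun N => box N (fun e => c e * mon e z)) (F z).
Proof.
move=> r0; elim: m M F => [|m IH] M F.
  move=> [c [hc hF]]; exists (fun=> c) => [N|z _].
    by rewrite box0 /weight big_ord0 expr0 mulr1.
  by rewrite hF; apply: clim_ext (@clim_cst _ _) => N; rewrite box0 /mon big_ord0 mulr1.
move=> [g [B [h1 h2 h3]]].
have /choice[c hc] : forall k, exists c : {ffun 'I_m -> nat} -> C,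
    (forall N, box N (weight r c) <= B k) /\
    forall z, polydisc m (fun=> r) z -> clim (fun N => box N (fun e => c e * mon e z)) (g k z).
  by move=> k; have [c hc1 hc2] := IH _ _ (h1 k); exists c.
exists (fun e : {ffun 'I_m.+1 -> nat} => c (e ord_max) (restr e)).
  move=> N; rewrite boxS; apply: le_trans (h2 N); apply: ler_sum => k _.
  rewrite weight_ext ler_wpM2r ?exprn_ge0 ?(ltW r0) //.
  rewrite (_ : (fun e => c _ _) = c k); first by case: (hc k).
  by apply/funext => e; rewrite ext_max extK.
move=> z hz.
apply: clim_ext (@csum_diagonal _ (fun k N => box N (fun e => c k e * mon e z) * z m ^+ k)
  (fun k => g k z * z m ^+ k) _ M _ _ h2 _ (h3 z hz)) => [N|k N|k].
- rewrite boxS; apply: eq_bigr => k _.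
  rewrite (box_mon_ext (fun e : {ffun 'I_m.+1 -> nat} => c (e ord_max) (restr e))).
  congr (_ * _); by apply: eq_bigr => e _; rewrite ext_max extK.
- rewrite cmodM cmodX; apply: ler_pM; [exact: cmod_ge0 | by rewrite exprn_ge0 ?cmod_ge0 | |].
    by apply: box_mon_le (ltW r0) (polydiscS hz) _; case: (hc k).
  exact: lerXl (cmod_ge0 _) (hz m (ltnSn m)).
- rewrite mulrC; apply: clim_ext (climZ (z m ^+ k) ((hc k).2 z (polydiscS hz))) => N.
  by rewrite mulrC.
Qed.

Definition row_of m (z : pnt) : 'rV[C]_m := \row_i z i.

Definition seq_of m (v : 'rV[C]_m) : pnt := fun i => if insub i is Some j then v 0 j else 0.

Lemma seq_ofE m (v : 'rV[C]_m) (i : 'I_m) : seq_of v i = v 0 i.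
Proof. by rewrite /seq_of valK. Qed.

Lemma seq_ofK m (v : 'rV[C]_m) : row_of m (seq_of v) = v.
Proof. by apply/rowP => i; rewrite mxE seq_ofE. Qed.

Lemma seq_of_le m (v : 'rV[C]_m) (d : R) : 0 <= d -> (forall i, cmod (v 0 i) <= d) ->
  forall i, cmod (seq_of v i) <= d.
Proof. by move=> d0 h i; rewrite /seq_of; case: insubP => [j _ _|_]; rewrite ?cmod0. Qed.

Lemma near_row_of m (p : 'rV[C]_m) (P : 'rV[C]_m -> Prop) :
  (\forall v \near p, P v) -> \forall z \near origin, P (p + row_of m z).
Proof.
move=> /nbhs_rowP[d d0 h]; exists (d / 2); first by lra.
move=> z hz; apply: h => i.
have -> : (p + row_of m z) 0 i - p 0 i = z i by rewrite !mxE; ring.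
by have := hz i; lra.
Qed.

Lemma near_seq_of m (p : 'rV[C]_m) (P : pnt -> Prop) :
  (\forall z \near origin, P z) -> \forall v \near p, P (seq_of (v - p)).
Proof.
move=> [d d0 h]; apply/nbhs_rowP; exists d => // v hv; apply: h.
by apply: seq_of_le (ltW d0) _ => i; rewrite !mxE ltW.
Qed.

Lemma box_sum_real m N (r : R) (c : {ffun 'I_m -> nat} -> C) :
  box_sum N (fun e => `|c e| * r%:C ^+ (\sum_i e i)) = (box N (weight r c))%:C.
Proof.
rewrite /box_sum /box rmorph_sum; apply: eq_bigr => e _.
by rewrite /weight rmorphM rmorphXn normcE_cmod.
Qed.

Lemma monomial_mon m e (v : 'rV[C]_m) : monomial e v = mon e (seq_of v).
Proof. by apply: eq_bigr => i _; rewrite seq_ofE. Qed.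

(** The bridge between the two notions of analyticity: the coefficient of a
    multi-index is found by expanding along the variables one after the other. *)
Lemma analytic_atP m (f : 'rV[C]_m -> C) (p : 'rV[C]_m) :
  analytic_at f p <-> analytic m (fun z => f (p + row_of m z)).
Proof.
split.
  move=> [c [r [M [r0 hM hf]]]].
  have hM' N : box N (weight r c) <= M by rewrite -lecR -box_sum_real.
  have [F psF hF] := power_series_of_box r0 hM'.
  have [d d0 hd] := near_row_of hf.
  have s0 : 0 < Num.min r d by rewrite lt_min r0.
  exists (Num.min r d), M; split=> //.
  have psF' : power_series m (fun=> Num.min r d) M F.
    by apply: ps_shrink psF => i _; rewrite ltW //= ge_min lexx.
  apply: ps_ext psF' => z hz.
  pose z' := seq_of (row_of m z).
  have z'i i : (i < m)%N -> z' i = z i.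
    by move=> im; have := seq_ofE (row_of m z) (Ordinal im); rewrite mxE.
  have hz' i : cmod (z' i) <= d.
    apply: (seq_of_le (ltW d0)) => j; rewrite mxE; apply: le_trans (hz j (ltn_ord j)) _.
    by rewrite ge_min lexx orbT.
  have hzr : polydisc m (fun=> r) z.
    by move=> i im; apply: le_trans (hz i im) _; rewrite ge_min lexx.
  apply: clim_uniq (hF z hzr) _.
  have /cvg_climP := hd z' hz'; rewrite seq_ofK; apply: clim_ext => N.
  apply: eq_bigr => e _; rewrite [p + _]addrC addrK monomial_mon; congr (_ * _).
  by apply: eq_bigr => i _; rewrite -/z' z'i.
move=> [r [M [r0 psF]]].
have [c hc hF] := box_of_power_series r0 psF.
exists c, r, M; split=> //; first by move=> N; rewrite box_sum_real lecR.
apply: filterS (near_seq_of p (origin_small r0)) => v hv.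
have := hF _ (fun i _ => hv i); rewrite seq_ofK [p + _]addrC subrK => h.
apply/cvg_climP; apply: clim_ext h => N.
by apply: eq_bigr => e _; rewrite monomial_mon.
Qed.

End VectorVariable.
(** * Local equations of irreducible germs *)

Section LocalEquations.
Variables (R : realType) (n : nat).
Local Notation C := R[i].
Local Notation pnt := (nat -> C).

Lemma seq_of_row m (z : pnt) i : (i < m)%N -> seq_of (row_of m z) i = z i.
Proof. by move=> im; have := seq_ofE (row_of m z) (Ordinal im); rewrite mxE. Qed.

Lemma analytic_seq_of m (p : 'rV[C]_m) (g : pnt -> C) : analytic m g ->
  analytic_at (fun v => g (seq_of (v - p))) p.
Proof.
move=> [r [M [r0 psg]]]; apply/analytic_atP; exists r, M; split=> //.
apply: ps_ext (psg) => z hz; rewrite [p + _]addrC addrK.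
by apply: ps_local psg hz _ => i im; rewrite seq_of_row.
Qed.

Lemma near_truncate m (g : pnt -> C) : analytic m g ->
  \forall z \near origin, g (seq_of (row_of m z)) = g z.
Proof.
move=> hg; apply: filterS (analytic_local hg) => z hz; apply/esym/hz => i im.
by rewrite seq_of_row.
Qed.

Lemma genericallyP m (P : 'rV[C]_m -> Prop) :
  generically P <-> exists2 c : germ R m, c != 0 &
    \forall z \near origin, rep c z != 0 -> P (row_of m z).
Proof.
split.
  move=> [g [/analytic_atP ag ng hg]].
  pose G z := g (0 + row_of m z); exists (mkgerm m G).
    apply/eqP => /germ_eq0P h; apply: ng.
    have h' : \forall z \near origin, G z = 0 by apply: filterS2 (mkgermK ag) h => z e1 e2; rewrite -e2 e1.
    apply: filterS (near_seq_of 0 h') => v; rewrite /G subr0 seq_ofK add0r //.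
  apply: filterS2 (mkgermK ag) (near_row_of hg) => z -> h; rewrite add0r in h.
  by rewrite add0r; apply: h.
move=> [c c0 h]; exists (fun v => rep c (seq_of (v - 0))); split.
- exact/analytic_seq_of/rep_analytic.
- move=> /near_row_of h0; move/eqP: c0; apply; apply/germ_eq0P.
  by apply: filterS2 (near_truncate (rep_analytic c)) h0 => z h1; rewrite add0r subr0 h1.
- by apply: filterS (near_seq_of 0 h) => v; rewrite seq_ofK subr0.
Qed.

Definition local_eqn (X : irr_germ R n) (z : pnt) : C :=
  Defs.eqn X (pt (row_of n z) (base X + z n)).

Lemma pt_row (c : C) (z : pnt) :
  pt 0 c + row_of (n + 1) z = pt (row_of n z) (c + z n).
Proof.
apply/rowP => i; rewrite !mxE; case: splitP => j ->; rewrite !mxE ?add0r //.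
by rewrite ord1 /= !mulr1n addn0.
Qed.

Lemma local_eqnE X z : local_eqn X z = Defs.eqn X (base_pt X + row_of (n + 1) z).
Proof. by rewrite /base_pt pt_row. Qed.

Lemma eqn_spec (X : irr_germ R n) : irr_equation (Defs.eqn X) (base X) /\
  germ_class X = [set A | germ_eq_set (pt 0 (base X)) A (zeros (Defs.eqn X))].
Proof. by rewrite /Defs.eqn; case: (cid _). Qed.

Lemma local_eqn_seq X v : local_eqn X (seq_of (v - base_pt X)) = Defs.eqn X v.
Proof. by rewrite local_eqnE seq_ofK [_ + (v - _)]addrC subrK. Qed.

Lemma row_of_axis y : row_of n (axis n y) = 0 :> 'rV[C]_n.
Proof. by apply/rowP => i; rewrite !mxE /axis ltn_eqF. Qed.

(** The conditions on an equation at the point [(0, base X)], read in coordinates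
    centred at this point. *)
Lemma local_component X : component n (local_eqn X).
Proof.
have [[af f0 rf irf nf] _] := eqn_spec X.
have e1 : (n + 1 = n.+1)%N by rewrite addn1.
have aF : analytic n.+1 (local_eqn X).
  rewrite -e1; move/analytic_atP: af; apply: analytic_ext => z.
  by rewrite local_eqnE.
split=> //.
- by rewrite /local_eqn addr0 (_ : row_of n _ = 0) //; apply/rowP => i; rewrite !mxE.
- move=> g h ag ah e; rewrite -e1 in ag ah.
  have := rf _ _ (analytic_seq_of (pt 0 (base X)) ag) (analytic_seq_of (pt 0 (base X)) ah).
  rewrite subrr (_ : seq_of 0 = fun=> 0); last first.
    by apply/funext => i; rewrite /seq_of; case: insubP => // j _ _; rewrite mxE.
  apply; apply: filterS (near_seq_of (pt 0 (base X)) e) => v.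
  by rewrite local_eqn_seq.
- move=> g h ag ah e; rewrite -e1 in ag ah.
  pose p : 'rV[C]_(n + 1) := pt 0 (base X).
  have aset (k : pnt -> C) : analytic (n + 1) k -> analytic_set_at (zeros (fun v => k (seq_of (v - p)))) p.
    move=> ak; exists 1%N, (fun _ v => k (seq_of (v - p))); split.
      by move=> _; apply: analytic_seq_of.
    by rewrite /germ_eq_set; apply: filterE => v; split=> [hv i //|/(_ ord0)].
  have back (k : pnt -> C) : analytic (n + 1) k ->
      germ_eq_set p (zeros (Defs.eqn X)) (zeros (fun v => k (seq_of (v - p)))) ->
      \forall z \near origin, local_eqn X z = 0 <-> k z = 0.
    move=> ak /near_row_of hk; apply: filterS2 hk (near_truncate ak) => z.
    by rewrite /zeros /= [p + _]addrC addrK addrC => hz <-; rewrite local_eqnE.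
  case: irf => _ /(_ _ _ (aset g ag) (aset h ah)); case.
  + rewrite /germ_eq_set; apply: filterS (near_seq_of p e) => v; rewrite local_eqn_seq /zeros /= => hv.
    split=> [/hv/eqP|]; last by case=> k0; apply/hv; rewrite k0 ?mul0r ?mulr0.
    by rewrite mulf_eq0 => /orP[/eqP|/eqP]; [left | right].
  + by move/(back g ag); left.
  + by move/(back h ah); right.
- move=> [e e0 he]; apply: nf; apply/nbhs_complexP; exists e => // y hy.
  by have := he (y - base X) (ltW hy); rewrite /local_eqn row_of_axis axis_last addrC subrK.
Qed.

Lemma irr_germ_eq X X' : base X = base X' ->
  (\forall z \near origin, local_eqn X z = 0 <-> local_eqn X' z = 0) -> X = X'.
Proof.
move=> eb h; have eg : germ_class X = germ_class X'.
  have [_ ->] := eqn_spec X; have [_ ->] := eqn_spec X'.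
  have h' : \forall v \near base_pt X, Defs.eqn X v = 0 <-> Defs.eqn X' v = 0.
    apply: filterS (near_seq_of (base_pt X) h) => v; rewrite local_eqn_seq.
    by rewrite (_ : base_pt X = base_pt X') ?local_eqn_seq // /base_pt eb.
  have -> : pt 0 (base X') = base_pt X :> 'rV[C]_(n + 1) by rewrite /base_pt eb.
  apply/funext => A; apply/propext; split; apply: filterS2 h' => v h1 h2.
    exact: iff_trans h2 h1.
  exact: iff_trans h2 (iff_sym h1).
case: X X' eb eg {h} => b g hx [b' g' hx'] /= eb eg.
by case: _ / eb in hx' *; case: _ / eg in hx' *; congr IrrGerm; apply: Prop_irrelevance.
Qed.

End LocalEquations.

(** * Sums over the points of a vertical fibre *)

Section Fibres.
Variable R : realType.
Local Notation C := R[i].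
Local Notation pnt := (nat -> C).

Lemma continuous_cmodP (u : C -> C) y0 : {for y0, continuous u} <->
  forall e : R, 0 < e -> exists2 d : R, 0 < d &
    forall y, cmod (y - y0) < d -> cmod (u y - u y0) < e.
Proof.
split=> [h e e0|h].
  have : \forall v \near u y0, cmod (v - u y0) < e by apply/nbhs_complexP; exists e.
  by move/h => /nbhs_complexP.
move=> P /nbhs_complexP[e e0 hP]; apply/nbhs_complexP.
by have [d d0 hd] := h e e0; exists d => // y /hd/hP.
Qed.

Lemma continuous_mul (u v : C -> C) y0 : {for y0, continuous u} ->
  {for y0, continuous v} -> {for y0, continuous (fun y => u y * v y)}.
Proof.
move=> /continuous_cmodP hu /continuous_cmodP hv; apply/continuous_cmodP => e e0.
have a0 := cmod_ge0 (u y0); have b0 := cmod_ge0 (v y0).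
pose K := cmod (u y0) + cmod (v y0) + 2.
have K0 : 0 < K by rewrite /K; lra.
have [t [t0 t1 tK]] : exists t : R, [/\ 0 < t, t <= 1 & t * K <= e].
  exists (Num.min 1 (e / K)); split; first by rewrite lt_min ltr01 divr_gt0.
    by rewrite ge_min lexx.
  by rewrite -ler_pdivlMr // ge_min lexx orbT.
have [d d0 hd] := hu t t0; have [d' d'0 hd'] := hv t t0.
exists (Num.min d d'); first by rewrite lt_min d0.
move=> y; rewrite lt_min => /andP[/hd h1 /hd' h2].
have -> : u y * v y - u y0 * v y0
  = (u y - u y0) * (v y - v y0) + ((u y - u y0) * v y0 + u y0 * (v y - v y0)) by ring.
apply: le_lt_trans (cmodD _ _) _; rewrite cmodM.
have h3 := cmodD ((u y - u y0) * v y0) (u y0 * (v y - v y0)); rewrite !cmodM in h3.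
have p1 := cmod_ge0 (u y - u y0); have p2 := cmod_ge0 (v y - v y0).
move: h1 h2 h3 tK p1 p2 a0 b0; rewrite /K.
move: (cmod ((u y - u y0) * v y0 + _)) (cmod (u y - u y0)) (cmod (v y - v y0)).
move: (cmod (u y0)) (cmod (v y0)) => a b S p q h1 h2 h3 tK p1 p2 a0 b0.
have i1 : p * q <= t * 1 by apply: ler_pM => //; lra.
have i2 : p * b <= t * b by rewrite ler_wpM2r //; lra.
have i3 : a * q <= a * t by rewrite ler_wpM2l //; lra.
by rewrite !mulrDr mulr1 in tK i1 *; lra.
Qed.

Lemma zero_orderE (phi u : C -> C) y0 k : {for y0, continuous u} -> u y0 != 0 ->
  (\forall y \near y0, phi y = (y - y0) ^+ k * u y) -> zero_order phi y0 = k.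
Proof.
move=> cu u0 hu; rewrite /zero_order; set S := [set _ | _].
have Sk : S k by exists u.
have lt_absurd (i j : nat) (v w : C -> C) : (i < j)%N -> {for y0, continuous v} ->
    {for y0, continuous w} -> v y0 != 0 ->
    (\forall y \near y0, (y - y0) ^+ i * v y = (y - y0) ^+ j * w y) -> False.
  move=> ij cv cw v0 h; move/eqP: v0; apply; apply: cmod_small => e e0.
  pose g y := (y - y0) ^+ (j - i) * w y.
  have cg : {for y0, continuous g}.
    apply: continuous_mul cw; apply/continuous_cmodP => t t0.
    exists (Num.min 1 t); first by rewrite lt_min ltr01.
    move=> y; rewrite lt_min => /andP[y1 yt].
    have ji : (0 < j - i)%N by rewrite subn_gt0.
    rewrite subrr expr0n gtn_eqF // subr0 cmodX -(prednK ji) exprS.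
    apply: le_lt_trans yt; rewrite ler_piMr ?cmod_ge0 // exprn_ile1 ?cmod_ge0 // ltW //.
  have e20 : 0 < e / 2 by lra.
  move/continuous_cmodP: cv => /(_ _ e20)[d1 d10 h1].
  move/continuous_cmodP: cg => /(_ _ e20)[d2 d20 h2].
  move/nbhs_complexP: h => [d3 d30 h3].
  pose d := Num.min d1 (Num.min d2 d3).
  have d0 : 0 < d by rewrite !lt_min d10 d20.
  have dd1 : d <= d1 by rewrite !ge_min lexx.
  have dd2 : d <= d2 by rewrite !ge_min lexx !orbT.
  have dd3 : d <= d3 by rewrite !ge_min lexx !orbT.
  pose y := y0 + (d / 2)%:C.
  have yy0 : y - y0 = (d / 2)%:C by rewrite /y addrC addKr.
  have cy : cmod (y - y0) = d / 2 by rewrite yy0 cmod_real gtr0_norm //; lra.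
  have y1 : cmod (y - y0) < d1 by rewrite cy; lra.
  have y2 : cmod (y - y0) < d2 by rewrite cy; lra.
  have y3 : cmod (y - y0) < d3 by rewrite cy; lra.
  have vg : v y = g y.
    have n0 : (y - y0) ^+ i != 0 by rewrite expf_neq0 // -cmod_gt0 cy; lra.
    apply: (mulfI n0); rewrite (h3 y y3) /g mulrA -exprD subnKC //; exact: ltnW.
  have g0 : g y0 = 0 by rewrite /g subrr expr0n gtn_eqF ?subn_gt0 // mul0r.
  have := h1 y y1; have := h2 y y2; rewrite g0 subr0 vg => k1 k2.
  by have := cmodB_ge (v y0) (g y); rewrite cmodBC in k2; lra.
have Sx : S (xget 0%N S) by apply: xgetPex; exists k.
case: Sx => v [cv v0 hv].
case: (ltngtP (xget 0%N S) k) => // lt; exfalso.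
  by apply: (lt_absurd _ _ v u lt) => //; apply: filterS2 hv hu => y <- <-.
by apply: (lt_absurd _ _ u v lt) => //; apply: filterS2 hv hu => y <- <-.
Qed.

Lemma root_poly_count (s : seq C) (y t : C) :
  (root_poly s).[t] = (t - y) ^+ count_mem y s * (root_poly [seq x <- s | x != y]).[t].
Proof.
elim: s => [|a s IH]; first by rewrite /root_poly !big_nil expr0 mul1r.
rewrite {1}/root_poly big_cons hornerM -/(root_poly s) IH hornerXsubC /=.
have [->|ay] := eqVneq a y; first by rewrite add1n exprS mulrA.
by rewrite add0n {2}/root_poly big_cons hornerM hornerXsubC mulrCA.
Qed.

(** The unit [u] changes neither the zeros of the Weierstrass polynomial nor their
    orders, and for small parameters all its roots have modulus less than [r]. *)
Lemma fibre_sum m F d (W : {poly germ R m}) u (c : C) :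
  weierstrass d W -> analytic m.+1 u -> u (fun=> 0) != 0 ->
  (\forall z \near origin, F z = u z * (pev z W).[z m]) ->
  exists2 r0 : R, 0 < r0 & forall r : R, 0 < r -> r < r0 ->
  \forall z \near origin, forall (s : seq C) (phi : C -> C),
    pev z W = root_poly s -> (forall t, phi (c + t) = F (upd m z t)) ->
    (forall y, y \in s -> zero_order phi (c + y) = count_mem y s) /\
    forall h : C -> C,
      \sum_(y \in [set y | `|y - c| < r%:C /\ phi y = 0]) (zero_order phi y)%:R * h y
      = \sum_(y <- s) h (c + y).
Proof.
move=> wW hu u0 hF.
have [r0 r00 hr0] := near_upd m (filterI hF (filterI (analytic_neq0 hu u0) (analytic_continuous hu))).
exists r0 => // r rp rr; apply: filterS3 hr0 (pev_upd W) (weierstrass_roots wW rp).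
move=> z h1 h2 h3 s phi ps hphi.
have phiE t : cmod t <= r0 -> phi (c + t) = u (upd m z t) * (root_poly s).[t].
  by move=> tr; have [e1 _] := h1 t tr; rewrite hphi e1 upd_last h2 ps.
have sr y : y \in s -> cmod y < r by move=> ys; apply: h3; rewrite ps root_prod_XsubC.
have ord y : y \in s -> zero_order phi (c + y) = count_mem y s.
  move=> /sr yr; have yr0 := ltW (lt_trans yr rr).
  have [_ [uy cu]] := h1 y yr0.
  pose q := root_poly [seq x <- s | x != y].
  have qy : q.[y] != 0.
    rewrite -rootE root_prod_XsubC mem_filter eqxx //.
  pose v t := q.[t - c] * u (upd m z (t - c)).
  have cv : {for c + y, continuous v}.
    apply: continuous_mul; apply/continuous_cmodP => e e0; have e20 : 0 < e / 2 by lra.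
      have [t t0 ht] := poly_continuous q y e20.
      exists t => // x xt; rewrite [c + y]addrC addrK.
      apply: le_lt_trans (ht _ _) _; last by lra.
      by apply: ltW; rewrite (_ : x - c - y = x - (c + y)) //; ring.
    have [t t0 ht] := cu _ e20.
    exists t => // x xt; rewrite [c + y]addrC addrK.
    apply: le_lt_trans (ht _ _) _; last by lra.
    move=> i; rewrite /upd; case: eqP => _; last by rewrite subrr cmod0 ltW.
    by apply: ltW; rewrite (_ : x - c - y = x - (c + y)) //; ring.
  apply: zero_orderE cv _ _.
    by rewrite /v [c + y]addrC addrK mulf_neq0.
  apply/nbhs_complexP; exists (r - cmod y); first by rewrite subr_gt0.
  move=> t ht; have -> : t = c + (t - c) by ring.
  have tr : cmod (t - c) <= r0.
    have -> : t - c = (t - (c + y)) + y by ring.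
    by have := cmodD (t - (c + y)) y; lra.
  rewrite phiE // (root_poly_count s y) /v.
  have -> : c + (t - c) - (c + y) = t - c - y by ring.
  by rewrite (_ : c + (t - c) - c = t - c) ?mulrA -/q; ring.
split=> // h.
have -> : [set y | `|y - c| < r%:C /\ phi y = 0] = [set` undup [seq c + y | y <- s]].
  apply/seteqP; split=> y /=; rewrite mem_undup normcE_cmod ltcR.
    move=> [yr py]; apply/mapP; exists (y - c); last by rewrite addrC subrK.
    have yr0 := ltW (lt_trans yr rr).
    have [_ [uy _]] := h1 _ yr0.
    have := phiE _ yr0; rewrite addrC subrK py => /esym/eqP.
    by rewrite mulf_eq0 (negbTE uy) -rootE root_prod_XsubC.
  move=> /mapP[x xs ->]; rewrite [c + x]addrC addrK; split; first exact: sr.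
  have /rootP x0 : root (root_poly s) x by rewrite root_prod_XsubC.
  rewrite [x + c]addrC phiE; last exact: ltW (lt_trans (sr _ xs) rr).
  by rewrite x0 mulr0.
rewrite -fsbig_seq ?undup_uniq // -(big_map (fun y => c + y) xpredT h).
rewrite -[RHS]big_undup_iterop_count; apply: eq_big_seq => y; rewrite mem_undup => /mapP[x xs ->].
rewrite ord // count_map mulr_natl; congr (iterop _ _ _ _).
by apply: eq_count => t /=; rewrite (inj_eq (addrI c)).
Qed.

End Fibres.
(** * Traces *)

Section Traces.
Variables (R : realType) (n : nat).
Local Notation C := R[i].
Local Notation pnt := (nat -> C).
Local Notation irr := (irr_germ R n).
Implicit Types (X : irr) (z : pnt).

Definition degree X : nat := projT1 (cid (component_presents (local_component X))).

Lemma degree_spec X : exists W : {poly germ R n}, exists u, (0 < degree X)%N /\ presents (local_eqn X) (degree X) W u.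
Proof. by rewrite /degree; case: (cid _). Qed.

Definition wpoly X : {poly germ R n} := projT1 (cid (degree_spec X)).

Lemma wpolyP X : exists u, (0 < degree X)%N /\ presents (local_eqn X) (degree X) (wpoly X) u.
Proof. by rewrite /wpoly; case: (cid _). Qed.

Lemma degree_gt0 X : (0 < degree X)%N.
Proof. by have [u []] := wpolyP X. Qed.

(** The points of [X] near its base point on the vertical line over [z], given by
    their ordinates relative to the base point and repeated according to
    multiplicity. *)
Definition fibre X z : seq C := sval (closed_field_poly_normal (pev z (wpoly X))).

Lemma near_fibre X (e : R) : 0 < e -> \forall z \near origin,
  [/\ pev z (wpoly X) = root_poly (fibre X z), size (fibre X z) = degree X
    & forall y, y \in fibre X z -> cmod y < e].
Proof.
move=> e0; have [u [d0 pX]] := wpolyP X; have [_ wW _ _ _] := pX.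
have [mW sW _] := wW.
apply: filterS2 (pev_monic mW) (weierstrass_roots wW e0) => z [h1 h2] h3.
have ps : pev z (wpoly X) = root_poly (fibre X z).
  by rewrite /fibre; case: closed_field_poly_normal => s /= e1; rewrite {1}e1 (monicP h1) scale1r.
split=> //; last by move=> y ys; apply: h3; rewrite ps root_prod_XsubC.
by apply: succn_inj; rewrite -sW -h2 ps size_prod_XsubC.
Qed.

Lemma row_of_upd m z t : row_of m (upd m z t) = row_of m z.
Proof. by apply/rowP => i; rewrite !mxE /upd ltn_eqF. Qed.

Lemma near_small_radii (P : irr -> R -> pnt -> Prop) (s : seq irr) :
  (forall X, exists2 r0 : R, 0 < r0 & forall r, 0 < r -> r < r0 ->
    \forall z \near origin, P X r z) ->
  exists2 r0 : R, 0 < r0 & forall r, 0 < r -> r < r0 ->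
    \forall z \near origin, forall X, X \in s -> P X r z.
Proof.
move=> h; elim: s => [|X s [r0 r00 IH]].
  by exists 1 => // r _ _; apply: filterE => z X; rewrite in_nil.
have [r1 r10 h1] := h X.
exists (Num.min r0 r1); first by rewrite lt_min r00.
move=> r rp; rewrite lt_min => /andP[/(IH r rp) a /(h1 r rp) b].
by apply: filterS2 a b => z a b Y; rewrite in_cons => /orP[/eqP -> // | /a].
Qed.

(** For small [r] the trace no longer depends on [r]: the zeros at distance less
    than [r] from the base point are then all the roots of the Weierstrass
    polynomial. *)
Lemma trace0_fibre (V : vcycle R n) h :
  exists2 r0 : R, 0 < r0 & forall r, 0 < r -> r < r0 ->
  \forall z \near origin, trace0 V h r (row_of n z) =
    \sum_(X <- finsupp V) (V X)%:R *
      \sum_(y <- fibre X z) h (base X) (pt (row_of n z) (base X + y)).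
Proof.
have [X|r0 r00 hr0] := @near_small_radii (fun X r z =>
    local_trace X (h (base X)) r (row_mx 0 (row_of n z)) =
    \sum_(y <- fibre X z) h (base X) (pt (row_of n z) (base X + y))) (finsupp V).
  have [u [d0 pX]] := wpolyP X; have [_ wW hu u0 hF] := pX.
  have [r0 r00 hr0] := fibre_sum (base X) wW hu u0 hF.
  exists r0 => // r rp rr; apply: filterS2 (hr0 r rp rr) (near_fibre X ltr01) => z hz [ps _ _].
  pose phi t := Defs.eqn X (line_pt 0 (row_of n z) t).
  have phiE t : phi (base X + t) = local_eqn X (upd n z t).
    by rewrite /phi /local_eqn /line_pt scaler0 add0r row_of_upd upd_last.
  have [_ hs] := hz _ phi ps phiE.
  have -> : \sum_(y <- fibre X z) h (base X) (pt (row_of n z) (base X + y))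
      = \sum_(y <- fibre X z) h (base X) (line_pt 0 (row_of n z) (base X + y)).
    by apply: eq_bigr => y _; rewrite /line_pt scaler0 add0r.
  rewrite -(hs (fun t => h (base X) (line_pt 0 (row_of n z) t))).
  by rewrite /local_trace /= row_mxKl row_mxKr.
exists r0 => // r rp rr; apply: filterS (hr0 r rp rr) => z hz.
by rewrite /trace0 /trace; apply: eq_big_seq => X /hz ->.
Qed.

(** * The vertical degree *)

(** The equation of [X] along the line of parameters [(z_0, ..., z_(2n-1))], in
    terms of the parameters and of the ordinate relative to the base point. *)
Definition line_eqn X z : C :=
  Defs.eqn X (line_pt (lsubmx (row_of (n + n) z)) (rsubmx (row_of (n + n) z))
    (base X + z (n + n)%N)).

Lemma line_eqn_analytic X : analytic (n + n).+1 (line_eqn X).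
Proof.
have [aF _ _ _ _] := local_component X.
pose g i z : C := if (i < n)%N then (base X + z (n + n)%N) * z i + z (n + i)%N else z (n + n)%N.
have E z : line_eqn X z = local_eqn X (g^~ z).
  rewrite /line_eqn /local_eqn /line_pt {2}/g ltnn; congr (Defs.eqn X (pt _ _)).
  by apply/rowP => i; rewrite !mxE /g ltn_ord.
apply: analytic_ext (fun z => esym (E z)) _.
apply: (@analytic_comp R n.+1 _ (local_eqn X) g) => // i im; rewrite /g; last first.
  by case: ifP => _; rewrite ?mulr0 ?addr0.
case: ltnP => hi; last by apply: analytic_coord; rewrite ltnS.
apply: analyticD; last by apply: analytic_coord; lia.
apply: analyticM; last by apply: analytic_coord; lia.
by apply: analyticD; [exact: analytic_cst | apply: analytic_coord].
Qed.

Lemma line_eqn_axis X y : line_eqn X (axis (n + n) y) = local_eqn X (axis n y).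
Proof.
rewrite /line_eqn /local_eqn /line_pt !row_of_axis !axis_last.
by congr (Defs.eqn X (pt _ _)); apply/rowP => i; rewrite !mxE mulr0 addr0.
Qed.

(** The degree of the Weierstrass polynomial is the order of the restriction to
    the axis. It is therefore the same for the family of the vertical lines and
    for the family of all the lines close to the axis. *)
Lemma order_at_origin m F d (W : {poly germ R m}) u (c : C) phi :
  weierstrass d W -> analytic m.+1 u -> u (fun=> 0) != 0 ->
  (\forall z \near origin, F z = u z * (pev z W).[z m]) -> F (fun=> 0) = 0 ->
  (forall t, phi (c + t) = F (axis m t)) -> zero_order phi c = d.
Proof.
move=> wW hu u0 hF F0 hphi; have [_ _ W0] := wW.
have d0 : (0 < d)%N.
  rewrite lt0n; apply/eqP => d0; have := origin0 hF.
  by rewrite F0 W0 d0 expr0 hornerC mulr1 => /esym/eqP; apply/negP.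
have [r0 r00 hr0] := fibre_sum c wW hu u0 hF.
have r20 : 0 < r0 / 2 by lra.
have r2l : r0 / 2 < r0 by lra.
have := origin0 (hr0 _ r20 r2l) => /(_ (nseq d 0) phi); rewrite root_poly_nseq0.
case=> // /(_ 0) + _.
by rewrite mem_nseq d0 eqxx addr0 count_nseq /= eqxx mul1n; apply.
Qed.

Lemma local_trace1 X : exists2 r0 : R, 0 < r0 & forall r, 0 < r -> r < r0 ->
  \forall z \near origin, local_trace X (fun=> 1) r (row_of (n + n) z) = (degree X)%:R.
Proof.
have [aF F0 _ _ nz] := local_component X.
have [|d hd] := regular_exists (line_eqn_analytic X).
  move=> [e e0 he]; apply: nz; exists e => // y hy; by rewrite -line_eqn_axis he.
have [W [u [wW hu u0 hF]]] := weierstrass_of_regular hd.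
have line0 : line_eqn X (fun=> 0) = 0 by rewrite -(axis0 R (n + n)) line_eqn_axis axis0.
pose phi t := Defs.eqn X (pt 0 t).
have phiE t : phi (base X + t) = local_eqn X (axis n t).
  by rewrite /local_eqn row_of_axis axis_last.
have dE : d = degree X.
  have [u' [_ [_ wW' hu' u'0 hF']]] := wpolyP X.
  rewrite -(order_at_origin (c := base X) (phi := phi) wW hu u0 hF line0).
    exact: order_at_origin wW' hu' u'0 hF' F0 phiE.
  by move=> t; rewrite line_eqn_axis.
have [r0 r00 hr0] := fibre_sum (base X) wW hu u0 hF.
exists r0 => // r rp rr.
have [mW sW _] := wW.
apply: filterS2 (hr0 r rp rr) (pev_monic mW) => z hz [mz sz].
have [s ps] := monic_split mz.
pose a := lsubmx (row_of (n + n) z); pose b := rsubmx (row_of (n + n) z).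
have [|_ hs] := hz s (fun t => Defs.eqn X (line_pt a b t)) ps.
  by move=> t; rewrite /line_eqn row_of_upd upd_last.
rewrite /local_trace /= (hs (fun=> 1)) -dE big_const_seq count_predT.
have -> : size s = d by apply: succn_inj; rewrite -sW -sz ps size_prod_XsubC.
by elim: (d) => //= k ->; rewrite mulrS.
Qed.

Lemma vdegE (V : vcycle R n) : vdeg V = (\sum_(X <- finsupp V) V X * degree X)%N.
Proof.
set d := (\sum_(X <- _) _)%N.
have const_generic (m : nat) (P : 'rV[C]_m -> Prop) :
    (\forall z \near origin, P (row_of m z)) -> generically P.
  by move=> h; apply/genericallyP; exists 1; [exact: oner_neq0 | apply: filterS h].
have hd : germ_eq (trace V (fun _ _ => 1)) (fun _ _ => d%:R).
  have [r0 r00 hr0] := near_small_radii (finsupp V) local_trace1.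
  exists r0; split=> // r /andP[rp rr]; apply: const_generic.
  apply: filterS (hr0 r rp rr) => z hz; rewrite /trace /d natr_sum.
  by apply: eq_big_seq => X /hz ->; rewrite natrM.
have uniq_d (k : nat) : germ_eq (trace V (fun _ _ => 1)) (fun _ _ => k%:R) -> k = d.
  move=> [r1 [r10 h1]]; have [r0 [r00 h0]] := hd.
  pose r := Num.min r0 r1 / 2.
  have m0 : 0 < Num.min r0 r1 by rewrite lt_min r00.
  have rr0 : 0 < r < r0.
    rewrite /r divr_gt0 //=; have : Num.min r0 r1 <= r0 by rewrite ge_min lexx.
    by move: m0; move: (Num.min _ _) => t; lra.
  have rr1 : 0 < r < r1.
    rewrite /r divr_gt0 //=; have : Num.min r0 r1 <= r1 by rewrite ge_min lexx orbT.
    by move: m0; move: (Num.min _ _) => t; lra.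
  have /genericallyP[c c0 hc] := h0 r rr0.
  have /genericallyP[c' c'0 hc'] := h1 r rr1.
  have cc : c * c' != 0 by rewrite mulf_neq0.
  have [z [[a b] e]] := germ_neq0_ex cc (filterI (filterI hc hc') (repM c c')).
  rewrite e mulf_eq0 negb_or => /andP[/a {}a /b {}b].
  by move: b; rewrite a => /eqP; rewrite eqr_nat => /eqP.
apply: uniq_d; rewrite /vdeg; set S := [set _ | _].
exact: (@xgetPex _ 0%N S (ex_intro _ d hd)).
Qed.

End Traces.
(** * Power sums and Vandermonde systems *)

Section PowerSums.
Variable R : realType.
Local Notation C := R[i].
Implicit Types s t : seq C.

(** The generating polynomial of the signed elementary symmetric functions of the
    points; unlike the coefficients of [root_poly], its coefficients are indexed
    by their degree in the points, as Newton's identities require. *)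
Definition recip_poly s : {poly C} := \prod_(y <- s) (1 - y *: 'X).

Lemma recip_poly_cons y s k :
  (recip_poly (y :: s))`_k = (recip_poly s)`_k - (if k is k'.+1 then y * (recip_poly s)`_k' else 0).
Proof.
rewrite /recip_poly big_cons mulrBl mul1r coefB -scalerAl coefZ coefXM.
by case: k => [|k] //=; rewrite mulr0.
Qed.

Lemma size_recip_poly s : (size (recip_poly s) <= (size s).+1)%N.
Proof.
elim: s => [|y s IH]; first by rewrite /recip_poly big_nil size_poly1.
apply/leq_sizeP => -[//|k] hk; rewrite recip_poly_cons.
have h j : (size s < j)%N -> (recip_poly s)`_j = 0.
  by move=> hj; apply: nth_default; apply: leq_trans IH _.
by rewrite !h ?mulr0 ?subr0 // ltnW.
Qed.

Lemma root_poly_coef s k : (k <= size s)%N ->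
  (root_poly s)`_(size s - k) = (recip_poly s)`_k.
Proof.
elim: s k => [|y s IH] k; first by rewrite leqn0 => /eqP ->; rewrite /root_poly /recip_poly !big_nil.
rewrite /= => hk; rewrite recip_poly_cons /root_poly big_cons -/(root_poly s).
rewrite mulrBl mul_polyC coefB coefZ coefXM subn_eq0.
have sz j : (size s < j)%N -> (root_poly s)`_j = 0.
  by move=> hj; apply: nth_default; rewrite size_prod_XsubC.
case: k hk => [_|k]; first by rewrite subn0 /= subr0 (sz (size s).+1) // mulr0 subr0 -(IH 0%N) // subn0.
rewrite ltnS subSS => hk; rewrite IH //; congr (_ - _).
case: ifPn; rewrite ltnS => sk.
  have {sk} -> : k = size s by apply/eqP; rewrite eqn_leq hk.
  by rewrite nth_default // size_recip_poly.
by rewrite -subnS IH // ltnNge.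
Qed.

Lemma newton_identity s k :
  (recip_poly s)`_k *+ k + \sum_(i < k) (\sum_(y <- s) y ^+ i.+1) * (recip_poly s)`_(k.-1 - i) = 0.
Proof.
elim: s k => [|y s IH] k.
  rewrite /recip_poly big_nil coef1; under eq_bigr => i _ do rewrite big_nil mul0r.
  rewrite big1 // addr0; case: k => [|k]; first by rewrite mulr0n.
  by rewrite /= mul0rn.
case: k => [|k]; first by rewrite mulr0n big_ord0 addr0.
pose a := fun j => (recip_poly s)`_j; pose b := fun j => (recip_poly (y :: s))`_j.
have bE j : b j = a j - (if j is j'.+1 then y * a j' else 0) by apply: recip_poly_cons.
pose p i := \sum_(x <- s) x ^+ i.+1.
have tel j : \sum_(i < j.+1) y ^+ i * b (j - i)%N = a j.
  elim: j => [|j IHj]; first by rewrite big_ord_recl big_ord0 addr0 expr0 mul1r subnn bE subr0.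
  rewrite big_ord_recl expr0 mul1r subn0 bE.
  have -> : \sum_(i < j.+1) y ^+ lift ord0 i * b (j.+1 - lift ord0 i)%N = y * a j.
    rewrite -IHj mulr_sumr; apply: eq_bigr => i _.
    by rewrite /= /bump /= add1n subSS exprS mulrA.
  by rewrite subrK.
have h1 := IH k.+1; have h0 := IH k.
rewrite -/(b _) (eq_bigr (fun i : 'I_k.+1 => p i * b (k - i)%N + y * (y ^+ i * b (k - i)%N))); last first.
  by move=> i _; rewrite big_cons -/(p i) mulrDl addrC exprS -mulrA.
rewrite big_split /= -mulr_sumr tel.
have -> : \sum_(i < k.+1) p i * b (k - i)%N
    = \sum_(i < k.+1) p i * a (k - i)%N - y * \sum_(i < k) p i * a (k.-1 - i)%N.
  rewrite big_ord_recr [in RHS]big_ord_recr /= subnn bE subr0 mulr_sumr.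
  rewrite [RHS]addrAC -sumrB; congr (_ + _); apply: eq_bigr => i _.
  rewrite bE; have -> : (k - i = (k.-1 - i).+1)%N by have := ltn_ord i; lia.
  by rewrite mulrBr mulrCA.
have e1 : \sum_(i < k.+1) p i * a (k - i)%N = - (a k.+1 *+ k.+1).
  by apply/eqP; rewrite -addr_eq0 addrC; apply/eqP.
have e0 : \sum_(i < k) p i * a (k.-1 - i)%N = - (a k *+ k).
  by apply/eqP; rewrite -addr_eq0 addrC; apply/eqP.
rewrite e1 e0 bE mulrnBl (mulrS (y * a k)) mulrN opprK mulrnAr.
by move: (a k.+1 *+ k.+1) (y * a k *+ k) => u v; ring.
Qed.

Lemma root_poly_perm s t : root_poly s = root_poly t -> perm_eq s t.
Proof.
elim: s t => [|y s IH] t e.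
  have : size (root_poly t) = 1%N by rewrite -e /root_poly big_nil size_poly1.
  by rewrite size_prod_XsubC; case: t {e}.
have yt : y \in t by rewrite -root_prod_XsubC -/(root_poly t) -e root_prod_XsubC mem_head.
have pyt := perm_to_rem yt; rewrite perm_sym; apply: (perm_trans pyt).
rewrite perm_cons perm_sym; apply: IH.
have n0 : 'X - y%:P != 0 by rewrite polyXsubC_eq0.
by apply: (mulfI n0); move: e; rewrite /root_poly (perm_big _ pyt) !big_cons.
Qed.

(** Newton's identities give, in characteristic zero, the elementary symmetric
    functions of the points one after the other in terms of the power sums. *)
Lemma power_sums_perm s t : size s = size t ->
  (forall k, (k <= size s)%N -> \sum_(y <- s) y ^+ k = \sum_(y <- t) y ^+ k) ->
  perm_eq s t.
Proof.
move=> st h; apply: root_poly_perm.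
have e k : (k <= size s)%N -> (recip_poly s)`_k = (recip_poly t)`_k.
  elim/ltn_ind: k => k IH ks; case: k IH ks => [_ _|k IH ks].
    rewrite -!root_poly_coef // !subn0.
    have lc u : (root_poly u)`_(size u) = 1.
      by rewrite -(monicP (monic_prod_XsubC u xpredT id)) lead_coefE size_prod_XsubC.
    by rewrite !lc.
  have n0 : (k.+1%:R : C) != 0 by rewrite pnatr_eq0.
  apply: (mulIf n0); rewrite !mulr_natr.
  have := newton_identity s k.+1; have := newton_identity t k.+1.
  have -> : \sum_(i < k.+1) (\sum_(y <- s) y ^+ i.+1) * (recip_poly s)`_(k.+1.-1 - i)
      = \sum_(i < k.+1) (\sum_(y <- t) y ^+ i.+1) * (recip_poly t)`_(k.+1.-1 - i).
    apply: eq_bigr => i _; have ik := ltn_ord i.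
    by rewrite h ?IH //=; lia.
  set S := \sum_(i < k.+1) _ => ht hs; apply: (addIr S).
  exact: etrans hs (esym ht).
apply/polyP => i; have [si|si] := ltnP (size s) i.
  by rewrite !nth_default // size_prod_XsubC // -st.
by rewrite -(subKn si) root_poly_coef ?leq_subr // e ?leq_subr // st -root_poly_coef // -st leq_subr.
Qed.

(** Combine the equations with the coefficients of the polynomial that vanishes
    at all the points but one. *)
Lemma vandermonde (I : eqType) (s : seq I) (x w : I -> C) : uniq (map x s) ->
  (forall k, (k < size s)%N -> \sum_(i <- s) x i ^+ k * w i = 0) ->
  forall i, i \in s -> w i = 0.
Proof.
move=> us h i si; have ps := perm_to_rem si.
pose f := root_poly (map x (rem i s)).
have sf : (size f <= size s)%N.
  by rewrite size_prod_XsubC size_map (size_rem si); case: (s) si.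
have : \sum_(j <- s) f.[x j] * w j = 0.
  transitivity (\sum_(k < size f) f`_k * \sum_(j <- s) x j ^+ k * w j); last first.
    by rewrite big1 // => k _; rewrite h ?mulr0 // (leq_trans _ sf).
  under [RHS]eq_bigr do rewrite mulr_sumr; rewrite exchange_big; apply: eq_bigr => j _.
  by rewrite horner_coef mulr_suml; apply: eq_bigr => k _; rewrite mulrA.
rewrite (perm_big _ ps) big_cons big_seq big1 => [|j jr]; last first.
  have /rootP -> : root f (x j) by rewrite root_prod_XsubC map_f.
  by rewrite mul0r.
rewrite /= addr0 => /eqP; rewrite mulf_eq0 => /orP[|/eqP //].
rewrite -rootE root_prod_XsubC => xi.
by move: us; rewrite (perm_uniq (perm_map x ps)) /= xi.
Qed.

End PowerSums.

(** * Traces of cycles over generic points *)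

Section Recovery.
Variables (R : realType) (n : nat).
Local Notation C := R[i].
Local Notation pnt := (nat -> C).
Local Notation irr := (irr_germ R n).
Implicit Types (X : irr) (z : pnt).

(** As [generically], with the exceptional set given by an element of the ring of
    germs: since this ring is a domain, finitely many generic conditions hold
    simultaneously. *)
Definition generic (P : pnt -> Prop) : Prop :=
  exists2 c : germ R n, c != 0 & \forall z \near origin, rep c z != 0 -> P z.

Lemma generic_near (P : pnt -> Prop) : (\forall z \near origin, P z) -> generic P.
Proof. by move=> h; exists 1; [exact: oner_neq0 | apply: filterS h]. Qed.

Lemma genericS (P Q : pnt -> Prop) : (forall z, P z -> Q z) -> generic P -> generic Q.
Proof. by move=> PQ [c c0 h]; exists c => //; apply: filterS h => z h cz; apply/PQ/h. Qed.

Lemma genericI (P Q : pnt -> Prop) : generic P -> generic Q -> generic (fun z => P z /\ Q z).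
Proof.
move=> [c c0 hP] [c' c'0 hQ]; exists (c * c'); first exact: mulf_neq0.
apply: filterS3 hP hQ (repM c c') => z a b ->.
by rewrite mulf_eq0 negb_or => /andP[/a ? /b].
Qed.

Lemma generic_all (T : eqType) (s : seq T) (P : T -> pnt -> Prop) :
  (forall t, t \in s -> generic (P t)) -> generic (fun z => forall t, t \in s -> P t z).
Proof.
elim: s => [|t s IH] h; first by apply: generic_near; apply: filterE => z t; rewrite in_nil.
have h1 := h t (mem_head _ _).
have h2 := IH (fun t' st' => h t' (mem_behead (s := t :: s) st')).
by apply: genericS (genericI h1 h2) => z [a b] t'; rewrite in_cons => /orP[/eqP -> //|/b].
Qed.

Lemma generic_ex (P : pnt -> Prop) : generic P -> exists z, P z.
Proof. by move=> [c c0 h]; have [z hz cz] := germ_neq0_ex c0 h; exists z; apply: hz. Qed.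

Lemma generically_row (P : 'rV[C]_n -> Prop) :
  generically P <-> generic (fun z => P (row_of n z)).
Proof. exact: genericallyP. Qed.

Lemma generic_on_fibre X (c : germ R n) (P : pnt -> Prop) : c != 0 ->
  (\forall w \near origin, rep c w != 0 -> local_eqn X w = 0 -> P w) ->
  generic (fun z => forall y, y \in fibre X z -> P (upd n z y)).
Proof.
move=> c0 h; exists c => //; have [u [_ [_ _ _ _ hF]]] := wpolyP X.
have [e e0 he] := near_upd n (filterI h hF).
apply: filterS3 (filterI he (near_fibre X e0)) (pev_upd (wpoly X)) (analytic_local (rep_analytic c)).
move=> z [h1 [ps _ hs]] h2 h3 cz y ys; have [h4 h5] := h1 y (ltW (hs y ys)).
apply: h4; first by rewrite -(h3 (upd n z y)) // => i im; rewrite /upd ltn_eqF.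
rewrite h5 upd_last h2 ps; have /rootP -> : root (root_poly (fibre X z)) y.
  by rewrite root_prod_XsubC.
by rewrite mulr0.
Qed.

Lemma vanishing_on_fibres X g : analytic n.+1 g ->
  generic (fun z => forall y, y \in fibre X z -> g (upd n z y) = 0) ->
  divides n (local_eqn X) g.
Proof.
move=> hg [c c0 h]; apply: (vanishing_divides (local_component X) hg c0).
have [u [_ [_ _ hu u0 hF]]] := wpolyP X.
apply: filterS3 h (filterI hF (analytic_neq0 hu u0)) (near_fibre X ltr01).
move=> z h1 [-> uz] [ps _ _] cz /eqP; rewrite mulf_eq0 (negbTE uz) /= -rootE ps root_prod_XsubC.
by move=> /(h1 cz); rewrite upd_id.
Qed.

Lemma divides_eq X X' : base X = base X' ->
  divides n (local_eqn X) (local_eqn X') -> X = X'.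
Proof.
move=> eb h; apply: irr_germ_eq eb _.
exact: component_divides (local_component X) (local_component X') h.
Qed.

Lemma divides_or_generic_fibre X g : analytic n.+1 g ->
  divides n (local_eqn X) g \/
  generic (fun z => forall y, y \in fibre X z -> g (upd n z y) != 0).
Proof.
move=> hg; have [u [_ pX]] := wpolyP X.
case: (divides_or_generic pX (local_component X) hg); first by left.
by move=> [c c0 h]; right; apply: generic_on_fibre c0 h.
Qed.

Lemma base_separated (s : seq irr) : exists2 e : R, 0 < e &
  forall X X', X \in s -> X' \in s -> base X != base X' -> 2 * e <= cmod (base X - base X').
Proof.
have [e e0 he] : exists2 e : R, 0 < e & forall p, p \in [seq (X, X') | X <- s, X' <- s] ->
    base p.1 != base p.2 -> e <= cmod (base p.1 - base p.2).
  elim: [seq _ | _ <- _, _ <- _] => [|p l [e e0 IH]]; first by exists 1.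
  have [E|NE] := eqVneq (base p.1) (base p.2).
    exists e => // q; rewrite in_cons => /orP[/eqP -> | /IH //].
    by rewrite E eqxx.
  have d0 : 0 < cmod (base p.1 - base p.2) by rewrite cmod_gt0 subr_eq0.
  exists (Num.min e (cmod (base p.1 - base p.2))); first by rewrite lt_min e0.
  move=> q; rewrite in_cons ge_min => /orP[/eqP -> _ | /IH h /h -> //].
  by rewrite lexx orbT.
exists (e / 2); first by lra.
move=> X X' sX sX' NE; rewrite mulrC divfK ?pnatr_eq0 //.
by apply: (he (X, X')) => //; apply/allpairsP; exists (X, X').
Qed.

Lemma generic_fibre_uniq X : generic (fun z => uniq (fibre X z)).
Proof.
have [u [_ pX]] := wpolyP X; have [_ _ sf _ _] := local_component X.
have [c c0 hc] := generic_uniq pX sf; exists c => //.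
by apply: filterS2 hc (near_fibre X ltr01) => z h [ps _ _] cz; apply: h.
Qed.

(** Germs with distinct base points are separated by their distance. For distinct
    germs with the same base point neither equation divides the other, so their
    common points lie over a thin set. *)
Lemma generic_fibres_disjoint (s : seq irr) :
  generic (fun z => forall X X' y y', X \in s -> X' \in s ->
    y \in fibre X z -> y' \in fibre X' z -> base X + y = base X' + y' -> X = X').
Proof.
have [e e0 he] := base_separated s.
have h1 : generic (fun z => forall X, X \in s -> forall y, y \in fibre X z -> cmod y < e).
  by apply: generic_all => X _; apply: generic_near; apply: filterS (near_fibre X e0) => z [].
have h2 : generic (fun z => forall X, X \in s -> forall X', X' \in s ->
    base X = base X' -> X <> X' -> forall y, y \in fibre X z -> y \notin fibre X' z).
  apply: generic_all => X _; apply: generic_all => X' _.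
  have [E|NE] := pselect (base X = base X' /\ X <> X'); last first.
    by apply: generic_near; apply: filterE => z eb nX; case: NE.
  have [aF _ _ _ _] := local_component X'.
  case: (divides_or_generic_fibre X aF) => [/(divides_eq E.1) /E.2 //|h].
  have one0 : (1 : germ R n) != 0 by apply: oner_neq0.
  have h0 : \forall w \near origin, rep (1 : germ R n) w != 0 -> local_eqn X' w = 0 ->
      local_eqn X' w = 0 by apply: filterE.
  apply: genericS (genericI h (generic_on_fibre one0 h0)) => z [a b] _ _ y /a.
  by apply: contraNN => /b ->.
apply: genericS (genericI h1 h2) => z [a b] X X' y y' sX sX' yX yX' E.
have eb : base X = base X'.
  apply/eqP; rewrite -[_ == _]negbK; apply/negP => /(he X X' sX sX').
  have -> : base X - base X' = y' - y.
    by rewrite -(addrK y (base X)) E; ring.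
  have := cmodD y' (- y); rewrite cmodN; have := a X sX y yX; have := a X' sX' y' yX'.
  by lra.
have ey : y = y' by apply: (addrI (base X)); rewrite E eb.
apply: contrapT => nX; have := b X sX X' sX' eb nX y yX.
by rewrite ey yX'.
Qed.

End Recovery.
Section Determination.
Variables (R : realType) (n : nat).
Local Notation C := R[i].
Local Notation pnt := (nat -> C).
Local Notation irr := (irr_germ R n).
Local Notation space := 'rV[C]_(n + 1).
Implicit Types (X : irr) (z : pnt) (V : vcycle R n) (h : C -> space -> C).

Definition fibre_trace V h z : C :=
  \sum_(X <- finsupp V) (V X)%:R *
    \sum_(y <- fibre X z) h (base X) (pt (row_of n z) (base X + y)).

Lemma germ_eq_trace0P V V' h h' : germ_eq (trace0 V h) (trace0 V' h') <->
  generic n (fun z => fibre_trace V h z = fibre_trace V' h' z).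
Proof.
have [r1 r10 h1] := trace0_fibre V h; have [r2 r20 h2] := trace0_fibre V' h'.
split=> [[r3 [r30 h3]]|hg].
  pose r := Num.min r1 (Num.min r2 r3) / 2.
  have m0 : 0 < Num.min r1 (Num.min r2 r3) by rewrite !lt_min r10 r20.
  have [a1 a2 a3] : [/\ r < r1, r < r2 & r < r3].
    have b1 : Num.min r1 (Num.min r2 r3) <= r1 by rewrite !ge_min lexx.
    have b2 : Num.min r1 (Num.min r2 r3) <= r2 by rewrite !ge_min lexx !orbT.
    have b3 : Num.min r1 (Num.min r2 r3) <= r3 by rewrite !ge_min lexx !orbT.
    by rewrite /r; move: m0 b1 b2 b3; move: (Num.min _ _) => t; split; lra.
  have rp : 0 < r by rewrite divr_gt0.
  have /generically_row hr : generically (fun t => trace0 V h r t = trace0 V' h' r t).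
    by apply: h3; rewrite rp.
  apply: genericS (genericI hr (genericI (generic_near n (h1 r rp a1)) (generic_near n (h2 r rp a2)))).
  by move=> z [e [e1 e2]]; rewrite /fibre_trace -e1 -e2.
exists (Num.min r1 r2); rewrite lt_min r10 r20; split=> // r.
rewrite lt_min => /andP[rp /andP[a1 a2]]; apply/generically_row.
apply: genericS (genericI hg (genericI (generic_near n (h1 r rp a1)) (generic_near n (h2 r rp a2)))).
by move=> z [e [-> ->]].
Qed.

Lemma ycoord_pt (x : 'rV[C]_n) (y : C) : ycoord (pt x y) = y.
Proof. by rewrite /ycoord /pt row_mxEr mxE eqxx mulr1n. Qed.

Definition points (S : seq irr) (w : irr -> nat) z : seq C :=
  flatten [seq flatten (nseq (w X) [seq base X + y | y <- fibre X z]) | X <- S].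

Lemma count_points S w z a :
  count a (points S w z) = (\sum_(X <- S) w X * count a [seq (base X + y)%R | y <- fibre X z])%N.
Proof.
rewrite /points count_flatten -map_comp sumnE big_map; apply: eq_bigr => X _ /=.
by rewrite count_flatten map_nseq sumn_nseq mulnC.
Qed.

Lemma sum_points S w z (f : C -> C) :
  \sum_(p <- points S w z) f p = \sum_(X <- S) (w X)%:R * \sum_(y <- fibre X z) f (base X + y).
Proof.
rewrite /points big_flatten big_map; apply: eq_bigr => X _.
rewrite mulr_natl; elim: (w X) => [|k IH] /=; first by rewrite big_nil mulr0n.
by rewrite big_cat big_map IH mulrS.
Qed.

(** Over a generic point the power sums determine the list of all the points of
    the cycle. A point of the fibre of [X0] occurs in it exactly [V X0] times,
    since the fibre of [X0] is simple and meets no other fibre. *)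
Lemma cycle_eq V V' : vdeg V = vdeg V' ->
  (forall k, (k <= vdeg V)%N -> germ_eq (trace0 V (@ypow R n k)) (trace0 V' (@ypow R n k))) ->
  V = V'.
Proof.
move=> ed hk; apply/msetP => X0.
pose S : {fset irr} := (finsupp V `|` finsupp V')%fset.
have [X0S|] := boolP (X0 \in S); last first.
  rewrite in_fsetU negb_or => /andP[a b].
  by rewrite (fsfun_dflt a) (fsfun_dflt b).
have onS (T : Type) (idx : T) (op : Monoid.com_law idx) (U : vcycle R n) (F : irr -> T) :
    (finsupp U `<=` S)%fset -> (forall X, U X = 0%N -> F X = idx) ->
    \big[op/idx]_(X <- finsupp U) F X = \big[op/idx]_(X <- S) F X.
  move=> sub F0; apply: big_fset_incl => // X _ nX; apply: F0; exact: fsfun_dflt.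
have sV : (finsupp V `<=` S)%fset by apply: fsubsetUl.
have sV' : (finsupp V' `<=` S)%fset by apply: fsubsetUr.
have tr (U : vcycle R n) k z : (finsupp U `<=` S)%fset ->
    fibre_trace U (@ypow R n k) z = \sum_(p <- points S U z) p ^+ k.
  move=> sub; rewrite sum_points /fibre_trace onS // => [|X ->]; last by rewrite mul0r.
  by apply: eq_bigr => X _; congr (_ * _); apply: eq_bigr => y _; rewrite /ypow ycoord_pt.
have deg (U : vcycle R n) : (finsupp U `<=` S)%fset ->
    vdeg U = (\sum_(X <- S) U X * degree X)%N.
  by move=> sub; rewrite vdegE; apply: onS => // X ->.
have g1 : generic n (fun z => forall k, k \in iota 0 (vdeg V).+1 ->
    \sum_(p <- points S V z) p ^+ k = \sum_(p <- points S V' z) p ^+ k).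
  apply: generic_all => k; rewrite mem_iota ltnS /= => kd.
  by apply: genericS ((germ_eq_trace0P _ _ _ _).1 (hk k kd)) => z; rewrite !tr.
have g2 : generic n (fun z => forall X, X \in enum_fset S -> size (fibre X z) = degree X).
  by apply: generic_all => X _; apply: generic_near; apply: filterS (near_fibre X ltr01) => z [].
have [z [[h1 h2] [h3 h4]]] := generic_ex (genericI (genericI g1 g2)
  (genericI (generic_fibre_uniq X0) (generic_fibres_disjoint (enum_fset S)))).
have sz (U : vcycle R n) : (finsupp U `<=` S)%fset -> size (points S U z) = vdeg U.
  move=> sub; rewrite -count_predT count_points deg //; apply: eq_big_seq => X XS.
  by rewrite count_predT size_map h2.
have pe : perm_eq (points S V z) (points S V' z).
  apply: power_sums_perm => [|k]; rewrite !sz // => kd.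
  by apply: h1; rewrite mem_iota.
have [y0 hy0] : exists y, y \in fibre X0 z.
  have := degree_gt0 X0; rewrite -(h2 X0 X0S); case: (fibre X0 z) => // y s _.
  by exists y; rewrite mem_head.
have cnt (U : vcycle R n) : count_mem (base X0 + y0) (points S U z) = U X0.
  rewrite count_points (bigD1_seq X0) ?fset_uniq //= big_seq_cond big1 ?addn0.
    rewrite count_uniq_mem ?map_f ?muln1 //.
    by rewrite map_inj_uniq //; apply: addrI.
  move=> X /andP[XS XX0]; rewrite (count_memPn _) ?muln0 //.
  apply/negP => /mapP[y yX E]; move/eqP: XX0; apply.
  by apply/esym; apply: h4 X0S XS hy0 yX E.
by rewrite -cnt -[RHS]cnt; move/permP: pe; apply.
Qed.

(** * Traces of meromorphic functions *)

Definition pull (f : space -> C) X z : C := f (base_pt X + row_of (n + 1) z).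

Lemma pull_analytic f X : analytic_at f (base_pt X) -> analytic n.+1 (pull f X).
Proof. by move/analytic_atP => af; rewrite -[n.+1]addn1. Qed.

Lemma pull_upd f X z y : pull f X (upd n z y) = f (pt (row_of n z) (base X + y)).
Proof. by rewrite /pull /base_pt pt_row row_of_upd upd_last. Qed.

Lemma near_pull (P : space -> Prop) X :
  (\forall v \near base_pt X, P v) <-> (\forall z \near origin, P (base_pt X + row_of (n + 1) z)).
Proof.
split; first exact: near_row_of.
move=> h; apply: filterS (near_seq_of (base_pt X) h) => v.
by rewrite seq_ofK [_ + (v - _)]addrC subrK.
Qed.

Lemma generic_den V (h : mero V) X : X \in finsupp V ->
  generic n (fun z => forall y, y \in fibre X z ->
    Defs.den h (base X) (pt (row_of n z) (base X + y)) != 0).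
Proof.
move=> XV; case: (divides_or_generic_fibre X (pull_analytic (den_analytic h XV))).
  move=> [q _ hq]; case: (den_neq0 (m := h) XV); apply/near_pull.
  apply: filterS hq => z; rewrite /pull => -> f0.
  by rewrite local_eqnE f0 mulr0.
by apply: genericS => z hz y /hz; rewrite pull_upd.
Qed.

(** Generically no denominator vanishes on the fibres, so the sums agree term by
    term. *)
Lemma mero_eq_trace V (h h' : mero V) k : mero_eq h h' ->
  germ_eq (trace0 V (ypow_mul k h)) (trace0 V (ypow_mul k h')).
Proof.
move=> heq; apply/germ_eq_trace0P.
pose P X z := forall y, y \in fibre X z ->
  Defs.num h (base X) (pt (row_of n z) (base X + y)) / Defs.den h (base X) (pt (row_of n z) (base X + y))
  = Defs.num h' (base X) (pt (row_of n z) (base X + y)) / Defs.den h' (base X) (pt (row_of n z) (base X + y)).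
have g : generic n (fun z => forall X, X \in enum_fset (finsupp V) -> P X z).
  apply: generic_all => X XV.
  have one0 : (1 : germ R n) != 0 by apply: oner_neq0.
  have h0 : \forall w \near origin, rep (1 : germ R n) w != 0 -> local_eqn X w = 0 ->
      pull (Defs.num h (base X)) X w * pull (Defs.den h' (base X)) X w
      = pull (Defs.num h' (base X)) X w * pull (Defs.den h (base X)) X w.
    by apply: filterS ((near_pull _ X).1 (heq X XV)) => w hw _; rewrite local_eqnE; apply: hw.
  apply: genericS (genericI (generic_on_fibre one0 h0) (genericI (generic_den h XV) (generic_den h' XV))).
  move=> z [a [b b']] y yX; have := a y yX; rewrite !pull_upd => e.
  by apply/eqP; rewrite eqr_div ?b ?b' //; apply/eqP.
apply: genericS g => z hz; apply: eq_big_seq => X XV; congr (_ * _).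
by apply: eq_big_seq => y yX; rewrite /ypow_mul (hz X XV y yX).
Qed.

(** Over a generic point the points of the fibres are distinct and as many as the
    equations, so the values at all of them are determined. Equality over generic
    points is equality because of the Nullstellensatz. *)
Lemma trace_mero_eq V (h h' : mero V) : reduced_cycle V ->
  (forall k, (k < vdeg V)%N ->
    germ_eq (trace0 V (ypow_mul k h)) (trace0 V (ypow_mul k h'))) -> mero_eq h h'.
Proof.
move=> redV hk X0 X0V.
have V1 X : X \in finsupp V -> V X = 1%N.
  by rewrite mem_finsupp => VX; apply/eqP; rewrite eqn_leq redV lt0n.
pose S := enum_fset (finsupp V).
pose val (g : mero V) X z y := Defs.num g (base X) (pt (row_of n z) (base X + y)) /
  Defs.den g (base X) (pt (row_of n z) (base X + y)).
have g1 : generic n (fun z => forall k, k \in iota 0 (vdeg V) ->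
    fibre_trace V (ypow_mul k h) z = fibre_trace V (ypow_mul k h') z).
  apply: generic_all => k; rewrite mem_iota /= => kd.
  exact: (germ_eq_trace0P _ _ _ _).1 (hk k kd).
have g2 : generic n (fun z => forall X, X \in S -> size (fibre X z) = degree X).
  by apply: generic_all => X _; apply: generic_near; apply: filterS (near_fibre X ltr01) => z [].
have g3 : generic n (fun z => forall X, X \in S -> uniq (fibre X z)).
  by apply: generic_all => X _; apply: generic_fibre_uniq.
pose N z := pull (Defs.num h (base X0)) X0 z * pull (Defs.den h' (base X0)) X0 z
  - pull (Defs.num h' (base X0)) X0 z * pull (Defs.den h (base X0)) X0 z.
have aN : analytic n.+1 N.
  apply: analyticB; apply: analyticM; apply: pull_analytic;
    by [apply: num_analytic | apply: den_analytic].
suff [q _ hq] : divides n (local_eqn X0) N.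
  apply/near_pull; apply: filterS hq => z Nz f0; apply/eqP; rewrite -subr_eq0; apply/eqP.
  by move: Nz; rewrite /N /pull local_eqnE f0 mulr0.
apply: vanishing_on_fibres aN _.
apply: genericS (genericI (genericI g1 g2) (genericI (genericI g3 (generic_fibres_disjoint S))
  (genericI (generic_den h X0V) (generic_den h' X0V)))).
move=> z [[h1 h2] [[h3 h4] [b b']]] y yX0.
(* At z the sums form a Vandermonde system in the values of the difference. *)
pose s := [seq (X, y) | X <- S, y <- fibre X z].
pose w (p : irr * C) := val h p.1 z p.2 - val h' p.1 z p.2.
have us : uniq [seq base p.1 + p.2 | p <- s].
  have su : uniq s.
    apply: allpairs_uniq_dep => [|X XS|[X1 y1] [X2 y2] _ _ [-> ->] //]; first exact: fset_uniq.
    exact: h3.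
  rewrite map_inj_in_uniq // => -[X1 y1] [X2 y2] /allpairsPdep[X [t [XS tX [-> ->]]]].
  move=> /allpairsPdep[X' [t' [XS' tX' [-> ->]]]] /= E.
  have XX' := h4 X X' t t' XS XS' tX tX' E.
  by move: E; rewrite XX' => /addrI ->.
have ss : size s = vdeg V.
  rewrite vdegE size_allpairs_dep sumnE big_map; apply: eq_big_seq => X XS.
  by rewrite h2 // V1 ?mul1n.
have sys k : (k < size s)%N -> \sum_(p <- s) (base p.1 + p.2) ^+ k * w p = 0.
  rewrite ss => kd; have := h1 k; rewrite mem_iota => /(_ kd) /eqP.
  rewrite -subr_eq0 /fibre_trace -sumrB => /eqP e; rewrite -[RHS]e.
  rewrite /s big_allpairs_dep; apply: eq_big_seq => X XS; rewrite V1 // !mul1r -sumrB.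
  by apply: eq_bigr => t _; rewrite /ypow_mul ycoord_pt /w mulrBr.
have ys : (X0, y) \in s by apply/allpairsPdep; exists X0, y.
have /eqP := vandermonde us sys ys; rewrite subr_eq0 /= /val eqr_div ?b ?b' // => /eqP e.
by rewrite /N !pull_upd e subrr.
Qed.

End Determination.

Theorem theorem1 (R : realType) (n : nat) (n_gt0 : (1 <= n)%N) :
  (forall V V' : vcycle R n,
      V = V' <->
      vdeg V = vdeg V' /\
      forall k : nat, (k <= vdeg V)%N ->
        germ_eq (trace0 V (@ypow R n k)) (trace0 V' (@ypow R n k)))
  /\
  (forall V : vcycle R n, reduced_cycle V ->
    forall h h' : mero V,
      mero_eq h h' <->
      forall k : nat, (k < vdeg V)%N ->
        germ_eq (trace0 V (ypow_mul k h)) (trace0 V (ypow_mul k h'))).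
Proof.
split=> [V V'|V redV h h'].
  split=> [<-|[ed hk]]; last exact: cycle_eq.
  by split=> // k _; apply/germ_eq_trace0P/generic_near; apply: filterE.
split=> [heq k _|]; first exact: mero_eq_trace.
exact: trace_mero_eq.
Qed.
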